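(* Let $k\ge 1$, let $\bm\lambda=(\lambda_1,\dots,\lambda_k)\in(\mathfrak h^* )^k$ and let $\bm a=(a_1,\dots,a_k)\in(\mathbb C^\times)^k$ be such that $\lambda_i(\mathrm k_0)\neq 0$ for all $i$ and $a_1,\dots,a_k$ are distinct. Then the $\widetilde{\mathfrak g}(\mu)$-module $\widetilde V(\bm\lambda,\bm a)$ is completely reducible. More precisely, let $r\ge 1$ be the integer such that the image of the homomorphism $\widetilde\psi_{\bm\lambda,\bm a}$ is $\mathbb C[t_1^{r},t_1^{-r}]$, let the indices be ordered as in the context, and let $\widetilde V^i(\bm\lambda,\bm a)$, $i=0,1,\dots,r-1$, be the eigenspaces of $\sigma$ defined in the context, so that $\widetilde V(\bm\lambda,\bm a)=\bigoplus_{i=0}^{r-1}\widetilde V^i(\bm\lambda,\bm a)$ as $\widetilde{\mathfrak g}(\mu)$-modules. Then each $\widetilde V^i(\bm\lambda,\bm a)$, $i=0,1,\dots,r-1$, is an irreducible $\widetilde{\mathfrak g}(\mu)$-submodule.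
   Context: **The Lie algebra.** $\dot{\mathfrak g}$ is a finite dimensional complex simple Lie algebra with Cartan subalgebra $\dot{\mathfrak h}$, root system $\dot\Delta$, a choice of positive roots with sum of positive root spaces $\dot{\mathfrak n}_+$, and normalized invariant symmetric form $\langle\cdot,\cdot\rangle$. $\mu\in\mathbb C$ is fixed. $\mathcal R=\mathbb C[t_0^{\pm1},t_1^{\pm1}]$; for $m=(m_0,m_1)\in\mathbb Z^2$ put $t^m=t_0^{m_0}t_1^{m_1}$, and put $\det(m,n)=m_0n_1-m_1n_0$. $\mathcal K$ is spanned by symbols $t^m\mathrm k_0,t^m\mathrm k_1$ subject to $m_0t^m\mathrm k_0+m_1t^m\mathrm k_1=0$; $\mathrm k_a=t^0\mathrm k_a$. $\mathcal S$ is spanned by the derivations $\mathrm d_i=t_i\frac{\partial}{\partial t_i}$ ($i=0,1$) and $\mathrm d(m)=\mathrm d(m_0,m_1)=m_0t^m\mathrm d_1-m_1t^m\mathrm d_0$. As a vector space $\widetilde{\mathfrak g}(\mu)=(\mathcal R\otimes\dot{\mathfrak g})\oplus\mathcal K\oplus\mathcal S$, with brackets $[t^m\otimes x,t^n\otimes y]=t^{m+n}\otimes[x,y]+\langle x,y\rangle\sum_{a}m_at^{m+n}\mathrm k_a$; $[\mathcal K,\mathcal K]=[\mathcal K,\mathcal R\otimes\dot{\mathfrak g}]=0$; $[\mathrm d_i,t^n\otimes x]=n_it^n\otimes x$, $[\mathrm d_i,t^n\mathrm k_j]=n_it^n\mathrm k_j$, $[\mathrm d_i,\mathrm d(m)]=m_i\mathrm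 d(m)$, $[\mathrm d_0,\mathrm d_1]=0$; $[\mathrm d(m),t^n\otimes x]=\det(m,n)t^{m+n}\otimes x$; $[\mathrm d(m),t^n\mathrm k_j]=\det(m,n)t^{m+n}\mathrm k_j+(m_0\delta_{j,1}-m_1\delta_{j,0})\sum_am_at^{m+n}\mathrm k_a$; $[\mathrm d(m),\mathrm d(n)]=\det(m,n)\mathrm d(m+n)+\mu\det(m,n)^2\sum_am_at^{m+n}\mathrm k_a$. $\widehat{\mathfrak g}(\mu)=(\mathcal R\otimes\dot{\mathfrak g})\oplus\mathcal K\oplus\sum_m\mathbb C\,\mathrm d(m)\oplus\mathbb C\mathrm d_0$, a subalgebra with $\widetilde{\mathfrak g}(\mu)=\widehat{\mathfrak g}(\mu)\oplus\mathbb C\mathrm d_1$. It is $\mathbb Z$-graded by $\mathrm{ad}\,\mathrm d_1$: $\widehat{\mathfrak g}(\mu)=\bigoplus_n\widehat{\mathfrak g}(\mu)_n$. Put $\tilde{\mathrm d}(m,n)=\mathrm d(m,n)+n\mu\,t_0^mt_1^n\mathrm k_0$. Also $\mathfrak h=\dot{\mathfrak h}\oplus\mathbb C\mathrm k_0\oplus\mathbb C\mathrm d_0$. **The Virasoro-affine algebra.** $\dot{\mathfrak b}=\mathbb C\mathrm k_1\oplus\mathbb C\mathrm d_1$ is an abelian Lie algebra with symmetric form $\langle\mathrm d_1,\mathrm k_1\rangle=1$, $\langle\mathrm d_1,\mathrm d_1\rangle=\langle\mathrm k_1,\mathrm k_1\rangle=0$; $\dot{\mathfrak f}=\dot{\mathfrak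 g}\oplus\dot{\mathfrak b}$ (orthogonal direct sum). $\bar{\mathfrak f}$ is the Lie algebra with spanning elements $L(m)$, $x(m)=t_0^m\otimes x$ ($m\in\mathbb Z$, $x\in\dot{\mathfrak f}$, linear in $x$) and central $\mathrm k_0,\mathrm k_v$, with $[L(m),L(n)]=(m-n)L(m+n)+\frac{m^3-m}{12}\delta_{m+n,0}\mathrm k_v$, $[x(m),y(n)]=[x,y](m+n)+m\delta_{m+n,0}\langle x,y\rangle\mathrm k_0$, $[L(m),x(n)]=-nx(m+n)$; here $\mathrm d_0=-L(0)$. Put $\bar{\mathfrak f}_0=\mathfrak h\oplus\dot{\mathfrak b}\oplus\mathbb C\mathrm k_v$ (identify $x$ with $x(0)$) and $\bar{\mathfrak f}_+=\mathrm{span}\{L(m),x(m):m>0,x\in\dot{\mathfrak f}\}+\dot{\mathfrak n}_+$. For $\eta\in\bar{\mathfrak f}_0^*$, $V_{\bar{\mathfrak f}}(\eta)$ is the irreducible highest weight $\bar{\mathfrak f}$-module of highest weight $\eta$ (highest weight vector killed by $\bar{\mathfrak f}_+$). For $\lambda\in\mathfrak h^*$ let $\bar\lambda\in\bar{\mathfrak f}_0^*$ be given by $\bar\lambda|_{\mathfrak h}=\lambda$, $\bar\lambda(\mathrm k_v)=24\mu\lambda(\mathrm k_0)$, $\bar\lambda(\mathrm k_1)=\bar\lambda(\mathrm d_1)=0$. **Operators on $V_{\bar{\mathfrak f}}(\bar\lambda)$.** Let $c=\lambda(\mathrm k_0)\ne0$. Put $x(z)=\sum_mx(m)z^{-m-1}$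 ($x\in\dot{\mathfrak f}$), $L(z)=\sum_mL(m)z^{-m-2}$, $\bar L(z)=L(z)-\frac1c{:}\mathrm d_1(z)\mathrm k_1(z){:}$, $\bar{\mathrm k}_1(z)=(z^{-1}+\frac{\partial}{\partial z})\mathrm k_1(z)=\sum_m(-m)\mathrm k_1(m)z^{-m-2}$, $\bar{\mathrm d}_1(z)=(z^{-1}+\frac{\partial}{\partial z})\mathrm d_1(z)=\sum_m(-m)\mathrm d_1(m)z^{-m-2}$, and $E(n,z)=\exp\big(\frac1c\sum_{j\ge1}\frac{n\mathrm k_1(-j)}{j}z^{j}\big)\exp\big(-\frac1c\sum_{j\ge1}\frac{n\mathrm k_1(j)}{j}z^{-j}\big)$. In normal ordered products ${:}\ {:}$ the modes $\mathrm d_1(m)$ with $m<0$ are put on the left and those with $m\ge0$ on the right. Define operators for $m,n\in\mathbb Z$, $x\in\dot{\mathfrak g}$ by $\sum_m\mathrm k_0(m,n)z^{-m}=cE(n,z)$, $\sum_m\mathrm k_1(m,n)z^{-m-1}=\mathrm k_1(z)E(n,z)$, $\sum_mx(m,n)z^{-m-1}=x(z)E(n,z)$, $\sum_m\bar L(m,n)z^{-m-2}=\bar L(z)E(n,z)$, $\sum_m\bar{\mathrm k}_1(m,n)z^{-m-2}=\bar{\mathrm k}_1(z)E(n,z)$, $\sum_m\bar{\mathrm d}_1(m,n)z^{-m-2}={:}\bar{\mathrm d}_1(z)E(n,z){:}$, and $\bar{\mathrm d}(m,n)=n\bar L(m,n)+n^2\mu\bar{\mathrm k}_1(m,n)-\bar{\mathrm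 d}_1(m,n)$. **The modules.** $\widehat V(\bm\lambda,\bm a)=V_{\bar{\mathfrak f}}(\bar\lambda_1)\otimes\cdots\otimes V_{\bar{\mathfrak f}}(\bar\lambda_k)$ is a $\widehat{\mathfrak g}(\mu)$-module in which each of $t_0^mt_1^n\mathrm k_j$ ($j=0,1$), $t_0^mt_1^n\otimes x$, $\tilde{\mathrm d}(m,n)$ acts on $v_1\otimes\cdots\otimes v_k$ by $\sum_{i=1}^ka_i^n\,v_1\otimes\cdots\otimes X(m,n).v_i\otimes\cdots\otimes v_k$ with $X(m,n)=\mathrm k_j(m,n)$, $x(m,n)$, $\bar{\mathrm d}(m,n)$ respectively (formed with $c=\lambda_i(\mathrm k_0)$ on the $i$-th factor), and $\mathrm d_0$ acts by $\sum_iv_1\otimes\cdots\otimes\mathrm d_0.v_i\otimes\cdots\otimes v_k$. The space $\widetilde V(\bm\lambda,\bm a)=\widehat V(\bm\lambda,\bm a)\otimes\mathbb C[t_1,t_1^{-1}]$ is a $\widetilde{\mathfrak g}(\mu)$-module by $x.(v\otimes t_1^l)=(x.v)\otimes t_1^{l+n}$ for $x\in\widehat{\mathfrak g}(\mu)_n$, and $\mathrm d_1.(v\otimes t_1^l)=l\,v\otimes t_1^l$. **The integer $r$ and the submodules $\widetilde V^i$.** $\widehat{\mathcal H}=(\mathbb C[t_1^{\pm1}]\otimes\dot{\mathfrak h})\oplus\sum_{n}(\mathbb Ct_1^n\mathrm k_0\oplus\mathbb Ct_1^n\mathrm d_0)\oplus\mathbb C\mathrm k_1\subset\widehat{\mathfrak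 g}(\mu)$. Let $\widehat\psi_{\bm\lambda,\bm a}$ be the linear functional on $\widehat{\mathcal H}$ with $t_1^n\otimes\dot h\mapsto\sum_ia_i^n\lambda_i(\dot h)$, $t_1^n\mathrm k_0\mapsto\sum_ia_i^n\lambda_i(\mathrm k_0)$, $\mathrm k_1\mapsto0$, $\mathrm d_0\mapsto\sum_i\lambda_i(\mathrm d_0)$, and $t_1^m\mathrm d_0\mapsto\sum_ia_i^m(\lambda_i(\mathrm d_0)+\mu\lambda_i(\mathrm k_0))$ for $m\ne0$. Let $\widetilde\psi_{\bm\lambda,\bm a}:\mathcal U(\widehat{\mathcal H})\to\mathbb C[t_1,t_1^{-1}]$ be the algebra homomorphism with $h\mapsto\widehat\psi_{\bm\lambda,\bm a}(h)t_1^n$ for $h\in\widehat{\mathcal H}$ of $\mathrm d_1$-degree $n$. Its image is $\mathbb C[t_1^r,t_1^{-r}]$ for some integer $r\ge1$; then $r$ divides $k$ and, after a simultaneous permutation of the $\lambda_i$ and the $a_i$, there are a primitive $r$-th root of unity $\varepsilon$ and complex numbers $a_{(0)},\dots,a_{(p-1)}$, $p=k/r$, with $\lambda_{sr+1}=\lambda_{sr+2}=\cdots=\lambda_{(s+1)r}$ and $a_{sr+j}=\varepsilon^ja_{(s)}$ for $1\le j\le r$, $0\le s\le p-1$. Fix such an ordering. Let $\sigma$ be the permutation $(1,2,\dots,r)(r+1,\dots,2r)\cdots(k-r+1,\dots,k)$ and also the linear automorphism of $\widetilde V(\bm\lambda,\bm a)$ given by $\sigma(v_1\otimes\cdots\otimes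 v_k\otimes t_1^n)=\varepsilon^{-n}(v_{\sigma(1)}\otimes\cdots\otimes v_{\sigma(k)}\otimes t_1^n)$; it commutes with $\widetilde{\mathfrak g}(\mu)$. Put $\widetilde V^i(\bm\lambda,\bm a)=\{v\in\widetilde V(\bm\lambda,\bm a):\sigma(v)=\varepsilon^{-i}v\}$. *)

(* Defs.v *)
From HB Require Import structures.
From mathcomp Require Import all_boot all_order all_algebra.
From mathcomp Require Export boolp classical_sets fsbigop reals complex.
From mathcomp Require Export freeg.
Set Implicit Arguments.
Unset Strict Implicit.
Unset Printing Implicit Defensive.
Import Order.TTheory GRing.Theory Num.Theory.
Local Open Scope ring_scope.

(** * Free modules modulo relations, and tensor products *)

Section FreegLift.
Variables (C : fieldType) (X : choiceType).

Lemma fgliftB (U : lmodType C) (f : X -> U) u v : fglift f (u - v) = fglift f u - fglift f v.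
Proof. exact: lift_is_additive. Qed.

Lemma fglift0 (U : lmodType C) (f : X -> U) : fglift f 0 = 0.
Proof. by rewrite -(subrr 0) fgliftB subrr. Qed.

Lemma fgliftD (U : lmodType C) (f : X -> U) u v : fglift f (u + v) = fglift f u + fglift f v.
Proof. by rewrite -[v in LHS]opprK -[-v]sub0r !fgliftB fglift0 sub0r opprK. Qed.

Lemma fglift_sum (U : lmodType C) (f : X -> U) (I : Type) (s : seq I) F :
  fglift f (\sum_(i <- s) F i) = \sum_(i <- s) fglift f (F i).
Proof. exact: (big_morph _ (fgliftD f) (fglift0 f)). Qed.

Lemma fgliftZ (U : lmodType C) (f : X -> U) a u : fglift f (a *: u) = a *: fglift f u.
Proof.
have e : a *: u = \sum_(z <- dom u) (a *: << coeff z u *g z >>).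
  by rewrite -[u in LHS]freeg_sumE scaler_sumr.
rewrite e -[u in RHS]freeg_sumE !fglift_sum scaler_sumr.
apply: eq_bigr => z _.
have -> : a *: << coeff z u *g z >> = << a * coeff z u *g z >>.
  by apply/eqP/freeg_eqP => w; rewrite coeffZ !coeffU mulrA.
by rewrite !liftU scalerA.
Qed.

End FreegLift.

Section FreeQuotient.
Variables (C : fieldType) (X : choiceType) (rel : {freeg X / C} -> Prop).

(* the linear span of the relations *)
Definition relspan : {pred {freeg X / C}} := fun u =>
  `[< exists2 s : seq (C * {freeg X / C}),
        forall p, p \in s -> rel p.2 & u = \sum_(p <- s) p.1 *: p.2 >].

Lemma relspan_scaler a u : u \in relspan -> a *: u \in relspan.
Proof.
move=> /asboolP[s hs ->]; apply/asboolP.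
exists [seq (a * p.1, p.2) | p <- s].
  by move=> p /mapP[q qs ->]; exact: (hs q).
by rewrite big_map scaler_sumr; apply: eq_bigr => p _; rewrite scalerA.
Qed.

Lemma relspan_zmod_closed : zmod_closed relspan.
Proof.
split; first by apply/asboolP; exists [::] => //; rewrite big_nil.
move=> u v hu /(relspan_scaler (-1)); rewrite scaleN1r.
case/asboolP: hu => s hs -> /asboolP[t ht ->].
apply/asboolP; exists (s ++ t); last by rewrite big_cat.
by move=> p; rewrite mem_cat => /orP[/hs|/ht].
Qed.

HB.instance Definition _ :=
  GRing.isZmodClosed.Build _ relspan relspan_zmod_closed.

Definition relsub : zmodClosed {freeg X / C} := GRing.ZmodClosed.clone _ relspan _.

Definition freequot : Type := Quotient.quot relsub.
HB.instance Definition _ := GRing.Zmodule.on freequot.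

Definition fq_pi (u : {freeg X / C}) : freequot := \pi_(Quotient.quot relsub)%qT u.
Definition fq_repr (x : freequot) : {freeg X / C} := generic_quotient.repr x.

Lemma fq_piK x : fq_pi (fq_repr x) = x.
Proof. exact: generic_quotient.reprK. Qed.

Lemma fq_piD u v : fq_pi (u + v) = fq_pi u + fq_pi v.
Proof. exact: (raddfD (\pi_(Quotient.quot relsub))%qT). Qed.

Lemma fq_piP u v : (fq_pi u = fq_pi v) <-> (u - v \in relspan).
Proof.
rewrite Quotient.idealrBE; split=> [h|/eqP h] //; exact/eqP.
Qed.

Definition fq_scale (a : C) (x : freequot) : freequot := fq_pi (a *: fq_repr x).

Lemma fq_piZ a u : fq_pi (a *: u) = fq_scale a (fq_pi u).
Proof.
apply/fq_piP; rewrite -scalerBr; apply: relspan_scaler.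
by apply/fq_piP; rewrite fq_piK.
Qed.

Fact fq_scaleA a b x : fq_scale a (fq_scale b x) = fq_scale (a * b) x.
Proof. by rewrite -[x]fq_piK -!fq_piZ scalerA. Qed.
Fact fq_scale1 : left_id 1 fq_scale.
Proof. by move=> x; rewrite -[x]fq_piK -fq_piZ scale1r. Qed.
Fact fq_scaleDr : right_distributive fq_scale +%R.
Proof.
by move=> a x y; rewrite -[x]fq_piK -[y]fq_piK -fq_piD -!fq_piZ scalerDr fq_piD.
Qed.
Fact fq_scaleDl x : {morph fq_scale^~ x : a b / a + b}.
Proof. by move=> a b; rewrite -[x]fq_piK -!fq_piZ scalerDl fq_piD. Qed.

HB.instance Definition _ := GRing.Zmodule_isLmodule.Build C freequot
  fq_scaleA fq_scale1 fq_scaleDr fq_scaleDl.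

Definition fq_gen (x : X) : freequot := fq_pi << x >>.

(* Linear extension of [f]; it maps [fq_gen x] to [f x] as soon as [f]
   respects the relations. *)
Definition fq_lift (U : lmodType C) (f : X -> U) (x : freequot) : U :=
  fglift f (fq_repr x).

Lemma fq_liftE (U : lmodType C) (f : X -> U) :
  (forall u, rel u -> fglift f u = 0) -> forall x, fq_lift f (fq_gen x) = f x.
Proof.
move=> hf x; rewrite -[RHS]scale1r -(liftU f 1 x) /fq_lift.
apply/eqP; rewrite -subr_eq0 -fgliftB.
have /fq_piP/asboolP[s hs ->] := fq_piK (fq_gen x).
rewrite fglift_sum big1_seq//= => p /hs hp.
by rewrite fgliftZ hf ?scaler0.
Qed.

End FreeQuotient.

Section Tensor.
Variable C : fieldType.

Definition multilinear_rel (I : finType) (V : I -> lmodType C)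
    (u : {freeg {classic (forall i, V i)} / C}) : Prop :=
  exists (v : forall i, V i) (i : I) (x y : V i) (a : C),
    u = << (dfwith v (a *: x + y) : {classic (forall i, V i)}) >>
        - a *: << (dfwith v x : {classic (forall i, V i)}) >>
        - << (dfwith v y : {classic (forall i, V i)}) >>.

Definition tensor (I : finType) (V : I -> lmodType C) : lmodType C :=
  freequot (@multilinear_rel I V).

Definition tens (I : finType) (V : I -> lmodType C) (v : forall i, V i) :
  tensor V := fq_gen _ (v : {classic (forall i, V i)}).

Definition tensor_lift (I : finType) (V : I -> lmodType C) (U : lmodType C)
    (f : (forall i, V i) -> U) : tensor V -> U :=
  @fq_lift _ _ _ U (f : {classic (forall i, V i)} -> U).

Lemma tensor_liftE (I : finType) (V : I -> lmodType C) (U : lmodType C)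
    (f : (forall i, V i) -> U) :
  (forall v i a (x y : V i),
     f (dfwith v (a *: x + y)) = a *: f (dfwith v x) + f (dfwith v y)) ->
  forall v, tensor_lift f (tens v) = f v.
Proof.
move=> hf v; apply: fq_liftE => u [w [i [x [y [a ->]]]]].
rewrite !fgliftB fgliftZ.
rewrite (liftU _ 1) (liftU _ 1) (liftU _ 1) !scale1r hf.
by rewrite [X in X - _ - _]addrC addrK subrr.
Qed.

Definition bilinear_rel (U V : lmodType C) (w : {freeg (U * V)%type / C}) : Prop :=
  (exists (a : C) (x y : U) (v : V),
     w = << (a *: x + y, v) >> - a *: << (x, v) >> - << (y, v) >>)
  \/ (exists (a : C) (u : U) (x y : V),
     w = << (u, a *: x + y) >> - a *: << (u, x) >> - << (u, y) >>).

Definition tensor2 (U V : lmodType C) : lmodType C :=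
  freequot (@bilinear_rel U V).

Definition tens2 (U V : lmodType C) (u : U) (v : V) : tensor2 U V :=
  fq_gen _ (u, v).

Definition tensor2_lift (U V W : lmodType C) (f : U -> V -> W) :
  tensor2 U V -> W := @fq_lift _ _ _ W (fun uv => f uv.1 uv.2).

Lemma tensor2_liftE (U V W : lmodType C) (f : U -> V -> W) :
  (forall v, linear (f^~ v)) -> (forall u, linear (f u)) ->
  forall u v, tensor2_lift f (tens2 u v) = f u v.
Proof.
move=> hl hr u v; apply: (@fq_liftE _ _ _ W (fun uv => f uv.1 uv.2)).
move=> w [[a [x [y [z ->]]]]|[a [z [x [y ->]]]]]; rewrite !fgliftB fgliftZ;
  rewrite !(liftU _ 1) !scale1r /= ?hl ?hr; by rewrite [X in X - _ - _]addrC addrK subrr.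
Qed.

End Tensor.

(** * Laurent polynomials [C[t, t^-1]], with basis [t^l = << l >>] *)

Section Laurent.
Variable C : fieldType.

Definition laurent : lmodType C := {freeg int / C}.
Definition lmonom (l : int) : laurent := << l >>.
Definition laurent_shift (n : int) (p : laurent) : laurent :=
  fglift (fun l => lmonom (l + n)) p.
Definition laurent_diag (w : int -> C) (p : laurent) : laurent :=
  fglift (fun l => w l *: lmonom l) p.

(* membership in C[t^r, t^-r] *)
Definition in_laurent_pow (r : nat) (p : laurent) : Prop :=
  forall l : int, coeff l p != 0 -> (r%:Z %| l)%Z.

End Laurent.

(** * Subspaces and submodules for a family of operators *)

Section Submodules.
Variables (C : fieldType) (M : lmodType C).

Definition subspace (W : M -> Prop) : Prop :=
  W 0 /\ forall (a : C) u v, W u -> W v -> W (a *: u + v).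

Variables (T : Type) (act : T -> M -> M).

Definition submodule (W : M -> Prop) : Prop :=
  subspace W /\ forall t v, W v -> W (act t v).

Definition irreducible_submodule (W : M -> Prop) : Prop :=
  [/\ submodule W,
      exists2 v, W v & v != 0
    & forall U : M -> Prop, submodule U -> (forall v, U v -> W v) ->
        (forall v, U v -> v = 0) \/ (forall v, W v -> U v)].

Definition direct_sum_of (I : choiceType) (W : I -> M -> Prop) : Prop :=
  (forall v, exists (s : seq I) (f : I -> M),
     (forall i, W i (f i)) /\ v = \sum_(i <- s) f i)
  /\ (forall (s : seq I) (f : I -> M), uniq s -> (forall i, W i (f i)) ->
        \sum_(i <- s) f i = 0 -> forall i, i \in s -> f i = 0).

Definition completely_reducible : Prop :=
  exists (I : choiceType) (W : I -> M -> Prop),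
    (forall i, irreducible_submodule (W i)) /\ direct_sum_of W.

End Submodules.

(** * Finite dimensional Lie algebras *)

Record lieAlgebra (C : fieldType) := LieAlgebra {
  lie_car :> vectType C;
  lieb : lie_car -> lie_car -> lie_car;
  lieb_linearl : forall y, linear (lieb^~ y);
  lieb_linearr : forall x, linear (lieb x);
  liebxx : forall x, lieb x x = 0;
  lieb_jacobi : forall x y z,
    lieb x (lieb y z) + lieb y (lieb z x) + lieb z (lieb x y) = 0
}.
Notation "[: x , y :]" := (lieb x y) (format "[:  x ,  y  :]") : ring_scope.

Section LieTheory.
Variables (C : numFieldType) (g : lieAlgebra C).

Definition simple_lie : Prop :=
  (exists x y : g, [: x, y :] != 0) /\
  (forall J : {vspace g}, (forall x y, y \in J -> [: x, y :] \in J) ->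
     J = 0%VS \/ J = fullv).

Definition lie_comm (U V : {vspace g}) : {vspace g} :=
  span [seq [: x, y :] | x <- vbasis U, y <- vbasis V].

Definition lower_central (U : {vspace g}) (n : nat) : {vspace g} :=
  iter n (lie_comm U) U.

(* nilpotent and self-normalizing subalgebra *)
Definition cartan_subalgebra (H : {vspace g}) : Prop :=
  [/\ forall x y, x \in H -> y \in H -> [: x, y :] \in H,
      exists n, lower_central H n = 0%VS
    & forall x, (forall y, y \in H -> [: x, y :] \in H) -> x \in H].

Variable H : {vspace g}.

Definition hdual := 'Hom(subvs_of H, C^o).

Definition root_vector (al : hdual) (x : g) : Prop :=
  forall h : subvs_of H, [: vsval h, x :] = (al h : C) *: x.

Definition is_root (al : hdual) : Prop :=
  al != 0 /\ exists2 x, x != 0 & root_vector al x.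

Definition positive_system (pos : hdual -> Prop) : Prop :=
  [/\ forall al, pos al -> is_root al,
      forall al, is_root al -> pos al \/ pos (- al),
      forall al, ~ (pos al /\ pos (- al))
    & forall al be, pos al -> pos be -> is_root (al + be) -> pos (al + be)].

Definition in_nplus (pos : hdual -> Prop) (x : g) : Prop :=
  exists2 s : seq g,
    forall y, y \in s -> (exists2 al, pos al & root_vector al y)
    & x = \sum_(y <- s) y.

(* The form is normalized by (alpha, alpha) = 2 for the long roots alpha, where
   (alpha, alpha) = <t, t> for the t in H representing alpha. *)
Definition normalized_form (form : g -> g -> C) : Prop :=
  [/\ forall y, linear (fun x => form x y : C^o),
      forall x y, form x y = form y x,
      forall x y z, form [: x, y :] z = form x [: y, z :]
    & let represents (al : hdual) (t : subvs_of H) :=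
        forall h : subvs_of H, form (vsval t) (vsval h) = al h in
      (forall al t, is_root al -> represents al t ->
         form (vsval t) (vsval t) <= 2)
      /\ (exists al t, [/\ is_root al, represents al t
                         & form (vsval t) (vsval t) = 2])].

End LieTheory.

(** * The Virasoro-affine algebra and its highest weight modules *)

Section VirasoroAffine.
Variables (C : numFieldType) (g : lieAlgebra C) (H : {vspace g}).
Variables (pos : hdual H -> Prop) (form : g -> g -> C).

(* (x, b, e) stands for x + b k_1 + e d_1 *)
Definition fdot : lmodType C := (g * C^o * C^o)%type.
Definition fdot_in (x : g) : fdot := (x, 0, 0).
Definition fk1 : fdot := (0, 1, 0).
Definition fd1 : fdot := (0, 0, 1).
Definition fdot_lieb (x y : fdot) : fdot := fdot_in [: x.1.1, y.1.1 :].
Definition fdot_form (x y : fdot) : C :=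
  form x.1.1 y.1.1 + x.1.2 * y.2 + x.2 * y.1.2.

Record fmodule := FModule {
  fm_car :> lmodType C;
  fmL : int -> fm_car -> fm_car;
  fmX : fdot -> int -> fm_car -> fm_car;
  fmk0 : fm_car -> fm_car;
  fmkv : fm_car -> fm_car;
  fmL_linear : forall m, linear (fmL m);
  fmX_linear : forall x m, linear (fmX x m);
  fmX_linearl : forall m v, linear (fun x => fmX x m v);
  fmk0_linear : linear fmk0;
  fmkv_linear : linear fmkv;
  fmLL : forall m n v,
    fmL m (fmL n v) - fmL n (fmL m v) =
      (m - n)%:~R *: fmL (m + n) v
      + (if m + n == 0 then ((m ^+ 3 - m)%:~R / 12%:R) *: fmkv v else 0);
  fmXX : forall x y m n v,
    fmX x m (fmX y n v) - fmX y n (fmX x m v) =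
      fmX (fdot_lieb x y) (m + n) v
      + (if m + n == 0 then (m%:~R * fdot_form x y) *: fmk0 v else 0);
  fmLX : forall x m n v,
    fmL m (fmX x n v) - fmX x n (fmL m v) = - n%:~R *: fmX x (m + n) v;
  fmk0L : forall m v, fmk0 (fmL m v) = fmL m (fmk0 v);
  fmk0X : forall x m v, fmk0 (fmX x m v) = fmX x m (fmk0 v);
  fmkvL : forall m v, fmkv (fmL m v) = fmL m (fmkv v);
  fmkvX : forall x m v, fmkv (fmX x m v) = fmX x m (fmkv v);
  fmk0kv : forall v, fmk0 (fmkv v) = fmkv (fmk0 v)
}.

Inductive fgen := FL (m : int) | FX (x : fdot) (m : int) | Fk0 | Fkv.

Definition fact (V : fmodule) (s : fgen) : V -> V :=
  match s with
  | FL m => fmL m | FX x m => fmX x m | Fk0 => @fmk0 V | Fkv => @fmkv V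
  end.

(* (h, b, e) : hcar stands for h + b k_0 + e d_0; this is the space written
   \mathfrak h, so that [weight] is its dual *)
Definition hcar := (subvs_of H * C^o * C^o)%type.
Definition weight := 'Hom(hcar, C^o).
Definition wt_h (lam : weight) (h : subvs_of H) : C := lam (h, 0, 0).
Definition wt_k0 (lam : weight) : C := lam (0, 1, 0).
Definition wt_d0 (lam : weight) : C := lam (0, 0, 1).

(* (u, (b, e), v) : f0car stands for u + b k_1 + e d_1 + v k_v *)
Definition f0car := (hcar * (C^o * C^o) * C^o)%type.
Definition fweight := 'Hom(f0car, C^o).

(* The element of f0car acts through d_0 = - L(0) and x = x(0). *)
Definition f0act (V : fmodule) (u : f0car) (v : V) : V :=
  let: ((h, b0, e0), (b1, e1), bv) := u in
  fmX (vsval h, b1, e1) 0 v + (b0 : C) *: fmk0 v - (e0 : C) *: fmL 0 v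
  + (bv : C) *: fmkv v.

Definition highest_weight_vector (eta : fweight) (V : fmodule) (v : V) : Prop :=
  [/\ v != 0,
      forall m : int, 0 < m -> fmL m v = 0 /\ forall x, fmX x m v = 0,
      forall x, in_nplus pos x -> fmX (fdot_in x) 0 v = 0
    & forall u, f0act u v = (eta u : C) *: v].

Definition irreducible_highest_weight (eta : fweight) (V : fmodule) : Prop :=
  irreducible_submodule (@fact V) (fun _ => True)
  /\ exists v : V, highest_weight_vector eta v.

Definition wt_bar (mu : C) (lam : weight) : fweight :=
  linfun (fun u : f0car => lam u.1.1 + 24%:R * mu * wt_k0 lam * u.2 : C^o).

(** * Vertex operators *)

(* coefficient of z^s in (sum_(j >= 1) A_j z^j)^q *)
Fixpoint powcoef (V : lmodType C) (A : nat -> V -> V) (q s : nat) (v : V) : V :=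
  if q is q'.+1 then \sum_(1 <= j < s.+1) A j (powcoef A q' (s - j) v)
  else if s == 0%N then v else 0.

(* coefficient of z^s in exp (sum_(j >= 1) A_j z^j), the A_j commuting;
   the terms q > s of the exponential series do not contribute *)
Definition expcoef (V : lmodType C) (A : nat -> V -> V) (s : nat) (v : V) : V :=
  \sum_(q < s.+1) (q`!%:R)^-1 *: powcoef A q s v.

Section VertexOperators.
Variables (mu : C) (V : fmodule) (c : C).
Implicit Types (m n s p : int) (v : V).

(* All sums \sum_(_ \in _) below are sums with finitely many nonzero terms on
   a highest weight module; this is the meaning of the products of series. *)

(* coefficient of z^(-s) in E(n,z) *)
Definition Ecoef n s v : V :=
  \sum_(q \in [set q : nat | s <= q%:Z])
    expcoef (fun j => fun w => (n%:~R / (c * j%:R)) *: fmX fk1 (- j%:Z) w)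
      `|q%:Z - s|%N
      (expcoef (fun j => fun w => - (n%:~R / (c * j%:R)) *: fmX fk1 j%:Z w) q v).

(* coefficient of z^(-m-2) in :d_1(z) k_1(z): *)
Definition d1k1 m v : V :=
  \sum_(p \in [set: int])
    if p < 0 then fmX fd1 p (fmX fk1 (m - p) v)
    else fmX fk1 (m - p) (fmX fd1 p v).

Definition Lbar m v : V := fmL m v - c^-1 *: d1k1 m v.
Definition k1bar m v : V := (- m)%:~R *: fmX fk1 m v.
Definition d1bar m v : V := (- m)%:~R *: fmX fd1 m v.

(* the mode [m] of the product of sum_p F p z^(-p-h) with E(n,z) *)
Definition timesE (F : int -> V -> V) m n v : V :=
  \sum_(s \in [set: int]) F (m - s) (Ecoef n s v).

Definition k0_op m n v : V := c *: Ecoef n m v.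
Definition k1_op m n v : V := timesE (fmX fk1) m n v.
Definition x_op (x : g) m n v : V := timesE (fmX (fdot_in x)) m n v.
Definition Lbar_op m n v : V := timesE Lbar m n v.
Definition k1bar_op m n v : V := timesE k1bar m n v.
Definition d1bar_op m n v : V :=
  \sum_(s \in [set: int])
    if m - s < 0 then d1bar (m - s) (Ecoef n s v)
    else Ecoef n s (d1bar (m - s) v).
Definition dbar_op m n v : V :=
  n%:~R *: Lbar_op m n v + (n%:~R ^+ 2 * mu) *: k1bar_op m n v
  - d1bar_op m n v.

End VertexOperators.

(** * The modules *)

Section Modules.
Variables (mu : C) (V : fweight -> fmodule).
Variables (k : nat) (lam : 'I_k -> weight) (a : 'I_k -> C).

(* Spanning elements of g^(mu): t_0^m t_1^n (x) x, t_0^m t_1^n k_0,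
   t_0^m t_1^n k_1, d~(m,n) = d(m,n) + n mu t_0^m t_1^n k_0 and d_0. *)
Inductive ghat_gen :=
  | GX (m n : int) (x : g)
  | GK0 (m n : int)
  | GK1 (m n : int)
  | GDtilde (m n : int)
  | GD0.

(* Spanning elements of g~(mu) = g^(mu) + C d_1.  Subspaces stable under these
   are exactly the g~(mu)-submodules. *)
Inductive gtilde_gen := GHat (s : ghat_gen) | GD1.

(* the ad d_1 degree *)
Definition ghat_deg (s : ghat_gen) : int :=
  match s with
  | GX _ n _ | GK0 _ n | GK1 _ n | GDtilde _ n => n
  | GD0 => 0
  end.

Definition Vfactor (i : 'I_k) : fmodule := V (wt_bar mu (lam i)).
Definition Vhat : lmodType C := tensor (fun i => Vfactor i : lmodType C).
Definition Vtilde : lmodType C := tensor2 Vhat (laurent C).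

(* the operator sum_i w_i (1 (x) .. (x) F_i (x) .. (x) 1) *)
Definition slot_sum (w : 'I_k -> C) (F : forall i, Vfactor i -> Vfactor i) :
    Vhat -> Vhat :=
  tensor_lift (fun v : forall i, Vfactor i =>
    \sum_i w i *: (tens (dfwith v (F i (v i))) : Vhat)).

Definition ghat_act (s : ghat_gen) : Vhat -> Vhat :=
  let c i := wt_k0 (lam i) in
  match s with
  | GX m n x => slot_sum (fun i => a i ^ n) (fun i => @x_op (Vfactor i) (c i) x m n)
  | GK0 m n => slot_sum (fun i => a i ^ n) (fun i => @k0_op (Vfactor i) (c i) m n)
  | GK1 m n => slot_sum (fun i => a i ^ n) (fun i => @k1_op (Vfactor i) (c i) m n)
  | GDtilde m n =>
      slot_sum (fun i => a i ^ n) (fun i => @dbar_op mu (Vfactor i) (c i) m n)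
  | GD0 => slot_sum (fun=> 1) (fun i v => - fmL 0 v)
  end.

Definition gtilde_act (s : gtilde_gen) : Vtilde -> Vtilde :=
  match s with
  | GHat s => tensor2_lift (fun (v : Vhat) (p : laurent C) =>
                tens2 (ghat_act s v) (laurent_shift (ghat_deg s) p))
  | GD1 => tensor2_lift (fun (v : Vhat) (p : laurent C) =>
                tens2 v (laurent_diag (fun l => l%:~R) p))
  end.

(** ** The integer r *)

(* Spanning elements t_1^n (x) h, t_1^n k_0, t_1^n d_0, k_1 of \widehat{\mathcal H} *)
Inductive heis_gen :=
  | HX (n : int) (h : subvs_of H)
  | HK0 (n : int)
  | HD0 (n : int)
  | HK1.

Definition heis_deg (s : heis_gen) : int :=
  match s with HX n _ | HK0 n | HD0 n => n | HK1 => 0 end.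

Definition psi_hat (s : heis_gen) : C :=
  match s with
  | HX n h => \sum_i a i ^ n * wt_h (lam i) h
  | HK0 n => \sum_i a i ^ n * wt_k0 (lam i)
  | HD0 n => if n == 0 then \sum_i wt_d0 (lam i)
             else \sum_i a i ^ n * (wt_d0 (lam i) + mu * wt_k0 (lam i))
  | HK1 => 0
  end.

(* The elements of the enveloping algebra are represented by the noncommutative
   polynomials in the spanning elements, here as lists of weighted words. *)
Definition psi_tilde (u : seq (C * seq heis_gen)) : laurent C :=
  \sum_(w <- u) (w.1 * \prod_(s <- w.2) psi_hat s)
                *: lmonom C (\sum_(s <- w.2) heis_deg s).

Definition psi_image_is (r : nat) : Prop :=
  forall p : laurent C, (exists u, psi_tilde u = p) <-> in_laurent_pow r p.

(** ** The automorphism sigma *)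

(* Indices are numbered from 0: the index s r + j (1 <= j <= r) of the usual
   numbering 1, .., k is i = s r + j - 1 here, so s = i %/ r, j = (i %% r).+1. *)
Definition well_ordered (r : nat) (eps : C) (a0 : nat -> C) : Prop :=
  [/\ (r %| k)%N, r.-primitive_root eps,
      forall i j : 'I_k, (i %/ r = j %/ r)%N -> lam i = lam j
    & forall i : 'I_k, a i = eps ^+ (i %% r).+1 * a0 (i %/ r)%N].

Variables (r : nat) (eps : C).

Definition sig_nat (i : nat) : nat := (i %/ r * r + (i %% r).+1 %% r)%N.

Lemma sig_nat_div (i : nat) : (0 < r)%N -> (sig_nat i %/ r = i %/ r)%N.
Proof.
by move=> r0; rewrite /sig_nat divnMDl // (divn_small (ltn_pmod _ r0)) addn0.
Qed.

Lemma sig_nat_lt (i : 'I_k) : (0 < r)%N -> (r %| k)%N -> (sig_nat i < k)%N.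
Proof.
move=> r0 rk; have ki := ltn_ord i.
have h j : (j < k)%N = (j %/ r < k %/ r)%N by rewrite ltn_divLR// divnK.
by rewrite h sig_nat_div// -h.
Qed.

(* (1,2,..,r)(r+1,..,2r)..; the default value is never used when r divides k *)
Definition sig (i : 'I_k) : 'I_k := insubd i (sig_nat i).

Lemma well_ordered_sig a0 : well_ordered r eps a0 ->
  forall i, lam (sig i) = lam i.
Proof.
case=> rk pr hl _ i; apply: hl; have r0 := prim_order_gt0 pr.
by rewrite val_insubd sig_nat_lt// sig_nat_div.
Qed.

Hypothesis lam_sig : forall i, lam (sig i) = lam i.

Definition permute_factors (v : forall i, Vfactor i) : forall i, Vfactor i :=
  fun i => eq_rect (lam (sig i)) (fun l => V (wt_bar mu l) : Type)
             (v (sig i)) (lam i) (lam_sig i).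

Definition sigma_hat : Vhat -> Vhat :=
  tensor_lift (fun v : forall i, Vfactor i => tens (permute_factors v) : Vhat).

Definition sigma : Vtilde -> Vtilde :=
  tensor2_lift (fun (v : Vhat) (p : laurent C) =>
    tens2 (sigma_hat v) (laurent_diag (fun l => eps ^ (- l)) p)).

Definition Vtilde_eigen (i : nat) (v : Vtilde) : Prop :=
  sigma v = eps ^- i *: v.

End Modules.
End VirasoroAffine.

Arguments gtilde_act {C g H form} mu V {k} lam a s _.
Arguments Vtilde_eigen {C g H form} mu V {k lam r} eps lam_sig i _.

(* Main.v *)
Require Import Defs.
From HB Require Import structures.
From mathcomp Require Import all_boot all_order all_algebra.
From mathcomp Require Import spectral cyclic ring zify.
Set Implicit Arguments.
Unset Strict Implicit.
Unset Printing Implicit Defensive.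
Import Order.TTheory GRing.Theory Num.Theory.
Local Open Scope ring_scope.

(** A submodule [U] of the loop module is graded by the power of [t_1], because
    [d_1] acts diagonally; write [U_l] for the vectors [u] of the tensor product
    [Vhat] with [u] tensor [t_1 ^ l] in [U].  A generator with [t_1]-degree [n]
    maps [U_l] to [U_(l + n)] by [\sum_i a_i ^ n X(n)_i], where [X(n)_i] acts on
    the [i]-th tensor factor and depends polynomially on [n] on each vector,
    since [n] enters [E(n, z)] through exponentials of locally nilpotent
    operators ([rop_polyfun]).

    Applying several generators and letting their degrees vary while the total
    degree [N] is fixed gives sums of exponential polynomials in the degrees,
    whose bases are ratios of the distinct parameters [a_i].  Such functions can
    be separated ([exp_poly_separation]), and what remains is a sum over the
    permutations [s] of the indices with [a (s i) = z * a i] for some constant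
    [z]: a word whose letters act on prescribed factors belongs to [U] once it
    is summed, with weights [z ^ N], over its transforms by these [s]
    ([separation], [stable_family_start]).

    Words of total degree zero in a single factor are as good as the whole
    Virasoro-affine algebra: they contain the modes [x(m)] and, dividing by
    [n] and interpolating to [n = 0], the modes [L(m)] ([stable_L]).  Since an
    irreducible highest weight module determines its highest weight and its
    highest weight vector up to scalars ([hw_unique]), Jacobson density holds for
    these words on all the factors with different highest weights at once
    ([density]).  Hence they can send any nonzero vector of [Vhat] to any pure
    tensor, while killing the transforms by the [s] which do not preserve the
    highest weights.  The remaining [s] are the powers of one symmetry [s0] of
    order [r] and ratio [eps], and on an eigenspace of the corresponding
    automorphism their contributions are obtained from one another.  So one
    nonzero [U_l] contains the eigenvectors of every degree ([graded_full]),
    provided that some vector of [U_l] survives in degree [N], which is shown by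
    looking at the top mode of [E(N, z)] ([pivot]).  This makes the eigenspaces
    irreducible ([eigen_irreducible]); they decompose the module because the
    automorphism has order [r] ([eigen_direct_sum]).

    A generator of the finite cyclic group of all ratios [z] provides [s0]
    ([maximal_symmetry]).  For a given ordering, the permutation of the statement
    has this property: if there is a symmetry of ratio [z], then [psi] vanishes in
    the degrees [n] with [z ^ n] different from 1, so that [z ^ r = 1] if [t_1 ^ r]
    is in the image ([image_symmetry]).

    Highest weight theory asks two things of [g]: elements are sums of elements
    of [H] and of root vectors for roots or their opposites, and nonempty sums of
    positive roots are nonzero ([simple_lie_triangular]).  As [H] is only known
    to be nilpotent and self-normalizing, this includes that [H] is abelian and
    acts diagonalizably.  The Killing form is nondegenerate by Cartan's
    criterion; applying additive functions, such as complex conjugation, to the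
    spectrum of [ad x] gives derivations, which are then inner. *)

(** * Functions of the spectrum of a matrix *)

Section Interpolation.
Variable F : fieldType.

Lemma prodXsub_coprime (c : F) (rs : seq F) N : c \notin rs ->
  coprimep (('X - c%:P) ^+ N) (\prod_(d <- rs) ('X - d%:P) ^+ N).
Proof.
elim: rs => [|d rs IH]; first by rewrite big_nil coprimep1.
rewrite inE negb_or big_cons coprimepMr => /andP[cd /IH ->]; rewrite andbT.
apply: coprimep_expl; apply: coprimep_expr.
by rewrite coprimep_XsubC root_XsubC eq_sym.
Qed.

(** Chinese remaindering: the values [f c] are taken to order [N], so that on
    a generalized eigenspace the polynomial acts exactly as a scalar. *)
Lemma hermite_interpolation (rs : seq F) N (f : F -> F) : uniq rs ->
  exists p : {poly F},
    forall c, c \in rs -> ('X - c%:P) ^+ N %| p - (f c)%:P.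
Proof.
elim: rs => [|c rs IH] /=; first by exists 0.
case/andP=> cr /IH [p hp].
have /Bezout_eq1_coprimepP[[u v] /= uv1] := prodXsub_coprime N cr.
set q := \prod_(d <- rs) _ in uv1.
exists (p + v * q * ((f c)%:P - p)) => d; rewrite inE => /predU1P[->|dr].
  suff -> : p + v * q * ((f c)%:P - p) - (f c)%:P
           = (u * (p - (f c)%:P)) * ('X - c%:P) ^+ N by apply: dvdp_mull.
  have -> : v * q = 1 - u * ('X - c%:P) ^+ N by rewrite -uv1 addrAC subrr add0r.
  ring.
have qd : ('X - d%:P) ^+ N %| q.
  rewrite /q (big_rem d) //=; exact: dvdp_mulr.
rewrite addrAC dvdp_add ?hp //; apply: dvdp_mulr; exact: dvdp_mull.
Qed.

End Interpolation.

Section GeneralizedEigenvectors.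
Variables (C : numClosedFieldType) (n : nat).
Implicit Types (A : 'M[C]_n.+1) (v : 'rV[C]_n.+1) (c : C) (f : C -> C).

Definition gen_eigen A c v := exists k, v *m (A - c%:M) ^+ k = 0.

Lemma horner_XsubC_exp A c k :
  horner_mx A (('X - c%:P) ^+ k) = (A - c%:M) ^+ k.
Proof. by rewrite rmorphXn rmorphB /= horner_mx_X horner_mx_C. Qed.

Lemma char_poly_split A :
  exists rs : seq C, char_poly A = \prod_(z <- rs) ('X - z%:P).
Proof.
have [rs hrs] := closed_field_poly_normal (char_poly A).
by exists rs; rewrite hrs (monicP (char_poly_monic A)) scale1r.
Qed.

(** A polynomial in [A] that acts as the scalar [f c] on the whole generalized
    eigenspace of every eigenvalue [c]: this is how functions of the spectrum
    are applied to [A] without a Jordan normal form. *)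
Lemma spectral_function A f : exists p : {poly C},
  [/\ forall c v, gen_eigen A c v -> v *m horner_mx A p = f c *: v
    & forall c, root (char_poly A) c -> p.[c] = f c].
Proof.
have [rs hrs] := char_poly_split A.
have [p hp] := hermite_interpolation n.+2 f (undup_uniq rs).
have rootE c : root (char_poly A) c = (c \in undup rs).
  by rewrite hrs root_prod_XsubC mem_undup.
exists p; split=> [c v [k hk]|c]; last first.
  rewrite rootE => /hp /dvdpP[q hq]; apply/eqP; rewrite -subr_eq0.
  have := congr1 (fun r => r.[c]) hq.
  by rewrite hornerM horner_exp hornerXsubC subrr expr0n mulr0 hornerD hornerN hornerC => ->.
have [m [q qc chiE]] := multiplicity_XsubC (char_poly A) c.
have {}qc : ~~ root q c by rewrite -size_poly_eq0 size_char_poly /= in qc.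
have /Bezout_eq1_coprimepP[[u w] /= uw] : coprimep (('X - c%:P) ^+ k) q.
  by apply: coprimep_expl; rewrite coprimep_sym coprimep_XsubC.
have vm : v *m (A - c%:M) ^+ m = 0.
  have -> : v = v *m horner_mx A (u * ('X - c%:P) ^+ k + w * q).
    by rewrite uw rmorph1 mulmx1.
  rewrite rmorphD mulmxDr [u * _]mulrC !rmorphM /= -/(mulmx _ _) horner_XsubC_exp.
  rewrite -[_ ^+ k * _]/(_ ^+ k *m _) mulmxA hk mul0mx add0r -horner_XsubC_exp.
  rewrite -mulmxA -[X in _ *m X]/(_ * _ * _) -!rmorphM -mulrA -chiE rmorphM.
  by rewrite /= Cayley_Hamilton mulr0 mulmx0.
have mn : (m <= n.+1)%N.
  have q0 : q != 0 by apply: contraNneq qc => ->; rewrite root0.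
  have := size_char_poly A; rewrite -size_poly_gt0 in q0.
  rewrite chiE size_Mmonic ?monic_exp ?monicXsubC -?size_poly_gt0 //.
  by rewrite size_exp_XsubC; lia.
case: (posnP m) => [m0|m0].
  by rewrite m0 expr0 mulmx1 in vm; rewrite vm mul0mx scaler0.
have cr : c \in undup rs.
  by rewrite -rootE chiE rootM -(prednK m0) root_exp_XsubC eqxx orbT.
have /dvdpP[q' hq'] := hp _ cr.
apply/eqP; rewrite -subr_eq0 -mul_mx_scalar -mulmxBr.
rewrite -(horner_mx_C A) -rmorphB hq' mulrC rmorphM /= horner_XsubC_exp.
have mN : (m <= n.+2)%N by lia.
by rewrite -(subnKC mN) exprD -!mulrA -[X in _ *m X]/(_ *m _) mulmxA vm mul0mx.
Qed.

Lemma gen_eigen_span A v : exists s : seq (C * 'rV[C]_n.+1),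
  (forall x, x \in s -> root (char_poly A) x.1 /\ gen_eigen A x.1 x.2) /\
  v = \sum_(x <- s) x.2.
Proof.
have [rs hrs] := char_poly_split A; set N := size rs.
pose ind c d : C := (d == c)%:R.
have /choice[e he] c := hermite_interpolation N (ind c) (undup_uniq rs).
have chi_dvd q : (forall c, c \in undup rs -> ('X - c%:P) ^+ N %| q) ->
    horner_mx A q = 0.
  move=> hq; suff /dvdpP[r ->] : char_poly A %| q.
    by rewrite rmorphM /= Cayley_Hamilton mulr0.
  have {}hq : \prod_(c <- undup rs) ('X - c%:P) ^+ N %| q.
    elim: (undup rs) (undup_uniq rs) hq => [|c s IH] /=.
      by rewrite big_nil dvd1p.
    case/andP=> cs us hq; rewrite big_cons Gauss_dvdp ?prodXsub_coprime //.
    by rewrite hq ?mem_head // IH // => d ds; rewrite hq // inE ds orbT.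
  apply: dvdp_trans hq; rewrite hrs -prodr_undup_exp_count /=.
  rewrite big_seq [X in _ %| X]big_seq; apply: (big_rec2 (fun x y => x %| y)).
    exact: dvdpp.
  move=> c x y; rewrite mem_undup => cr xy; apply: dvdp_mul => //.
  by rewrite dvdp_exp2l // count_size.
exists [seq (c, v *m horner_mx A (e c)) | c <- undup rs]; split.
  move=> x /mapP[c cr ->] /=; split.
    by rewrite hrs root_prod_XsubC -mem_undup.
  exists N; rewrite -horner_XsubC_exp -mulmxA.
  rewrite -[X in _ *m X]/(_ * _) -rmorphM /= chi_dvd ?mulmx0 // => d dr.
  have [->|dc] := eqVneq d c; first exact: dvdp_mull.
  by apply: dvdp_mulr; have := he c d dr; rewrite /ind (negPf dc) subr0.
rewrite big_map /= -mulmx_sumr -rmorph_sum /=.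
apply/eqP; rewrite -[X in X == _](mulmx1 v) -subr_eq0 -mulmxBr.
rewrite -[X in X - _](rmorph1 (horner_mx A)) -rmorphB /= chi_dvd ?mulmx0 // => c cr.
rewrite (bigD1_seq c) ?undup_uniq //= opprD addrA dvdp_sub //.
  by rewrite -dvdpNr opprB; have := he c c cr; rewrite /ind eqxx.
rewrite big_seq_cond; apply: (big_ind (fun q => _ %| q)).
- exact: dvdp0.
- by move=> x y; exact: dvdp_add.
move=> d /andP[dr dc]; have := he d c cr; rewrite /ind.
by rewrite eq_sym (negPf dc) subr0.
Qed.

(** Read off a unitary triangularization of [A]. *)
Lemma trace_spectrum A : exists rs : seq C,
  [/\ size rs = n.+1, char_poly A = \prod_(z <- rs) ('X - z%:P)
    & forall p, \tr (A *m horner_mx A p) = \sum_(z <- rs) z * p.[z]].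
Proof.
have [P Pu hT] := Schur A (ltn0Sn n).
pose T : 'M[C]_n.+1 := P *m A *m invmx P.
have Ttr : is_trig_mx T.
  by move: hT; rewrite /similar_to mxred.conjumx ?unitarymx_unit.
have {hT}Pu : P \in unitmx by exact: unitarymx_unit.
have trigM (X Y : 'M[C]_n.+1) : is_trig_mx X -> is_trig_mx Y ->
    is_trig_mx (X *m Y) /\ forall i, (X *m Y) i i = X i i * Y i i.
  move=> /is_trig_mxP Xt /is_trig_mxP Yt; split=> [|i].
    apply/is_trig_mxP => i j ij; rewrite mxE big1 // => l _.
    case: (ltnP i l) => il; first by rewrite Xt ?mul0r.
    by rewrite Yt ?mulr0 // (leq_ltn_trans il ij).
  rewrite mxE (bigD1 i) //= big1 ?addr0 // => l li.
  case: (ltngtP i l) => [il|il|/val_inj il]; first by rewrite Xt ?mul0r.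
    by rewrite Yt ?mulr0.
  by rewrite il eqxx in li.
have trigH p : is_trig_mx (horner_mx T p) /\ forall i, horner_mx T p i i = p.[T i i].
  elim/poly_ind: p => [|p c [IH1 IH2]].
    rewrite rmorph0; split=> [|i]; last by rewrite mxE horner0.
    by apply/is_trig_mxP => i j _; rewrite mxE.
  rewrite rmorphD rmorphM /= horner_mx_X horner_mx_C.
  have [h1 h2] := trigM _ _ IH1 Ttr; split=> [|i].
    move/is_trig_mxP in h1; apply/is_trig_mxP => i j ij; rewrite mxE h1 // add0r mxE.
    by rewrite -val_eqE ltn_eqF.
  by rewrite mxE [X in X + _]h2 IH2 [X in _ + X]mxE eqxx mulr1n hornerMXaddC.
have AE : A = invmx P *m T *m P.
  by rewrite /T !mulmxA mulVmx // mul1mx mulmxKV.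
have HE (p : {poly C}) : horner_mx T p = P *m (horner_mx A p : 'M[C]_n.+1) *m invmx P :> 'M[C]_n.+1.
  by rewrite /T horner_mx_uconj.
exists [seq T i i | i <- enum 'I_n.+1]; split.
- by rewrite size_map size_enum_ord.
- have -> : char_poly A = char_poly T.
    have cE : char_poly_mx A = map_mx polyC (invmx P) *m char_poly_mx T *m map_mx polyC P.
      rewrite /char_poly_mx mulmxBr mulmxBl -!map_mxM -AE scalar_mxC.
      by rewrite -mulmxA -map_mxM mulVmx // map_mx1 mulmx1.
    rewrite /char_poly cE !det_mulmx mulrAC -det_mulmx -map_mxM mulVmx //.
    by rewrite map_mx1 det1 mul1r.
  by rewrite char_poly_trig // big_map big_enum.
move=> p; transitivity (\tr (T *m horner_mx T p)).
  have e : (T *m horner_mx T p : 'M[C]_n.+1) = P *m (A *m (horner_mx A p : 'M[C]_n.+1)) *m invmx P.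
    by rewrite HE /T !mulmxA mulmxKV.
  by rewrite e [RHS]mxtrace_mulC (mulKmx Pu).
have [h1 h2] := trigH p; have [_ h3] := trigM _ _ Ttr h1.
by rewrite big_map big_enum /=; apply: eq_bigr => i _; rewrite h3 h2.
Qed.

End GeneralizedEigenvectors.

(** * Adjoint matrices and derivations *)

Section LieBasics.
Variables (C : fieldType) (g : lieAlgebra C).
Implicit Types x y z : g.

Lemma lieDl x y z : [: x + y, z :] = [: x, z :] + [: y, z :].
Proof. by have := lieb_linearl z 1 x y; rewrite !scale1r. Qed.
Lemma lieDr x y z : [: x, y + z :] = [: x, y :] + [: x, z :].
Proof. by have := lieb_linearr x 1 y z; rewrite !scale1r. Qed.
Lemma lie0l x : [: 0, x :] = 0.
Proof. by apply: (addrI [: 0, x :]); rewrite -lieDl !addr0. Qed.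
Lemma lie0r x : [: x, 0 :] = 0.
Proof. by apply: (addrI [: x, 0 :]); rewrite -lieDr !addr0. Qed.
Lemma lieZl a x y : [: a *: x, y :] = a *: [: x, y :].
Proof. by have := lieb_linearl y a x 0; rewrite !addr0 lie0l addr0. Qed.
Lemma lieZr a x y : [: x, a *: y :] = a *: [: x, y :].
Proof. by have := lieb_linearr x a y 0; rewrite !addr0 lie0r addr0. Qed.
Lemma lieC x y : [: x, y :] = - [: y, x :].
Proof.
apply/eqP; rewrite -addr_eq0; have := liebxx (x + y).
by rewrite lieDl !lieDr !liebxx add0r addr0 => ->.
Qed.
Lemma lieNr x y : [: x, - y :] = - [: x, y :].
Proof. by rewrite -scaleN1r lieZr scaleN1r. Qed.
Lemma lieNl x y : [: - x, y :] = - [: x, y :].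
Proof. by rewrite -scaleN1r lieZl scaleN1r. Qed.
Lemma lieBr x y z : [: x, y - z :] = [: x, y :] - [: x, z :].
Proof. by rewrite lieDr lieNr. Qed.
Lemma lieBl x y z : [: x - y, z :] = [: x, z :] - [: y, z :].
Proof. by rewrite lieDl lieNl. Qed.
Lemma lie_suml (I : Type) (s : seq I) F y :
  [: \sum_(i <- s) F i, y :] = \sum_(i <- s) [: F i, y :].
Proof. exact: (big_morph (fun x => [: x, y :]) (fun u v => lieDl u v y) (lie0l y)). Qed.
Lemma lie_sumr (I : Type) (s : seq I) F y :
  [: y, \sum_(i <- s) F i :] = \sum_(i <- s) [: y, F i :].
Proof. exact: (big_morph (fun x => [: y, x :]) (lieDr y) (lie0r y)). Qed.
(** The Jacobi identity as the statement that [ad x] is a derivation. *)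
Lemma lie_leibniz x y z : [: x, [: y, z :] :] = [: [: x, y :], z :] + [: y, [: x, z :] :].
Proof.
have := lieb_jacobi x y z; rewrite [[: z, [: x, y :] :]]lieC [[: z, x :]]lieC lieNr.
by move/eqP; rewrite subr_eq0 subr_eq addrC => /eqP ->; rewrite addrC.
Qed.

End LieBasics.

Lemma mx_ext (C : fieldType) n m (A B : 'M[C]_(n, m)) :
  (forall u : 'rV_n, u *m A = u *m B) -> A = B.
Proof. by move=> h; apply/row_matrixP => i; rewrite !rowE. Qed.

Section Adjoint.
Variables (C : numClosedFieldType) (g : lieAlgebra C) (n : nat).
Variables (phi : {linear g -> 'rV[C]_n.+1}) (psi : 'rV[C]_n.+1 -> g).
Hypotheses (phiK : cancel phi psi) (psiK : cancel psi phi).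
Implicit Types (x y z h : g) (D : 'M[C]_n.+1).

Let psi_linear : linear psi.
Proof. by move=> a u v; apply: (can_inj phiK); rewrite psiK linearP !psiK. Qed.

Definition adf x (v : 'rV[C]_n.+1) : 'rV[C]_n.+1 := phi [: x, psi v :].
Fact adf_linear x : linear (adf x).
Proof. by move=> a u v; rewrite /adf psi_linear lieb_linearr linearP. Qed.
HB.instance Definition _ x := GRing.isLinear.Build C _ _ _ (adf x) (adf_linear x).
Definition ad x : 'M[C]_n.+1 := lin1_mx (adf x).

Lemma phi_lie x y : phi [: x, y :] = phi y *m ad x.
Proof. by rewrite /ad mul_rV_lin1 /= /adf phiK. Qed.

Lemma ad_ext D D' : (forall y, phi y *m D = phi y *m D') -> D = D'.
Proof. by move=> h; apply: mx_ext => u; rewrite -(psiK u). Qed.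

Lemma adP a x y : ad (a *: x + y) = a *: ad x + ad y.
Proof.
apply: ad_ext => z.
by rewrite -phi_lie lieb_linearl linearP mulmxDr -scalemxAr !phi_lie.
Qed.
Lemma ad0 : ad 0 = 0.
Proof. by apply: ad_ext => z; rewrite -phi_lie lie0l linear0 mulmx0. Qed.
Lemma adD x y : ad (x + y) = ad x + ad y.
Proof. by have := adP 1 x y; rewrite !scale1r. Qed.
Lemma adZ a x : ad (a *: x) = a *: ad x.
Proof. by have := adP a x 0; rewrite !addr0 ad0 addr0. Qed.
Lemma adN x : ad (- x) = - ad x.
Proof. by rewrite -scaleN1r adZ scaleN1r. Qed.
Lemma ad_lie x y : ad [: x, y :] = ad y *m ad x - ad x *m ad y.
Proof.
apply: ad_ext => z.
rewrite mulmxBr !mulmxA -!phi_lie lie_leibniz -linearB; congr (phi _).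
by rewrite addrK.
Qed.
Lemma ad_comm x y : [: x, y :] = 0 -> ad x *m ad y = ad y *m ad x.
Proof. by move=> h; have := ad_lie x y; rewrite h ad0 => /eqP; rewrite eq_sym subr_eq0 => /eqP. Qed.

Definition dact D y : g := psi (phi y *m D).
Definition is_derivation D :=
  forall y z, dact D [: y, z :] = [: dact D y, z :] + [: y, dact D z :].

Lemma phi_dact D y : phi (dact D y) = phi y *m D.
Proof. exact: psiK. Qed.
Lemma dact_ad x y : dact (ad x) y = [: x, y :].
Proof. by apply: (can_inj phiK); rewrite phi_dact phi_lie. Qed.

Lemma gen_eigen_lie x a b y z :
  gen_eigen (ad x) a (phi y) -> gen_eigen (ad x) b (phi z) ->
  gen_eigen (ad x) (a + b) (phi [: y, z :]).
Proof.
case=> k hk [l hl]; exists (k + l)%N.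
have [s] := ubnP (k + l); elim: s k l y z hk hl => // s IH [|k] [|l] y z hk hl.
- rewrite expr0 mulmx1 in hk.
  by rewrite (_ : y = 0) ?lie0l ?linear0 ?mul0mx //; apply: (can_inj phiK); rewrite hk linear0.
- rewrite expr0 mulmx1 in hk.
  by rewrite (_ : y = 0) ?lie0l ?linear0 ?mul0mx //; apply: (can_inj phiK); rewrite hk linear0.
- rewrite expr0 mulmx1 in hl.
  by rewrite (_ : z = 0) ?lie0r ?linear0 ?mul0mx //; apply: (can_inj phiK); rewrite hl linear0.
move=> kl.
pose y' := [: x, y :] - a *: y; pose z' := [: x, z :] - b *: z.
have hy' : phi y' = phi y *m (ad x - a%:M).
  by rewrite mulmxBr mul_mx_scalar -phi_lie linearB linearZ.
have hz' : phi z' = phi z *m (ad x - b%:M).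
  by rewrite mulmxBr mul_mx_scalar -phi_lie linearB linearZ.
have e : phi [: y, z :] *m (ad x - (a + b)%:M) = phi [: y', z :] + phi [: y, z' :].
  rewrite mulmxBr mul_mx_scalar -phi_lie -linearZ -linearB -linearD; congr (phi _).
  by rewrite lie_leibniz lieBl lieBr lieZl lieZr scalerDl opprD addrACA.
have stepE (w w' : 'rV[C]_n.+1) c m : w' = w *m (ad x - c%:M) ->
    w *m (ad x - c%:M) ^+ m.+1 = 0 -> w' *m (ad x - c%:M) ^+ m = 0.
  by move=> ->; rewrite -mulmxA exprS.
have h1 := IH k l.+1 y' z (stepE _ _ _ _ hy' hk) hl.
have h2 := IH k.+1 l y z' hk (stepE _ _ _ _ hz' hl).
rewrite addSn exprS -[_ * _]/(_ *m _) mulmxA e mulmxDl h1; last by lia.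
by rewrite -addSnnS h2 ?addr0 //; lia.
Qed.

(** Applying an additive function [f] to the spectrum of [ad x] gives a
    derivation, because the generalized eigenspaces multiply like their
    eigenvalues add. The identity yields the semisimple part of [ad x], and
    complex conjugation the partner used in the trace arguments below. *)
Lemma spectral_derivation x (f : C -> C) : {morph f : a b / a + b} ->
  exists D, [/\ is_derivation D, exists p, D = horner_mx (ad x) p,
    forall c v, gen_eigen (ad x) c v -> v *m D = f c *: v
   & exists rs : seq C, [/\ size rs = n.+1,
       char_poly (ad x) = \prod_(z <- rs) ('X - z%:P)
     & \tr (ad x *m D) = \sum_(z <- rs) z * f z]].
Proof.
move=> fD; have [p [hp proot]] := spectral_function (ad x) f.
exists (horner_mx (ad x) p); split; first 1 last.
- by exists p.
- exact: hp.
- have [rs [rs_size rsE rsT]] := trace_spectrum (ad x).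
  exists rs; split => //; rewrite rsT big_seq [RHS]big_seq.
  by apply: eq_bigr => z zr; rewrite proot // rsE root_prod_XsubC.
set D := horner_mx _ _ => y z.
apply: (can_inj phiK); rewrite linearD /= phi_dact.
have [sym_image [hy ey]] := gen_eigen_span (ad x) (phi y).
have [sz [hz ez]] := gen_eigen_span (ad x) (phi z).
have sumE (w : g) (s : seq (C * 'rV[C]_n.+1)) : phi w = \sum_(u <- s) u.2 -> w = \sum_(u <- s) psi u.2.
  move=> e; apply: (can_inj phiK); rewrite e linear_sum.
  by apply: eq_bigr => u _; rewrite /= psiK.
have dactE (w : g) (s : seq (C * 'rV[C]_n.+1)) : phi w = \sum_(u <- s) u.2 -> (forall u, u \in s -> root (char_poly (ad x)) u.1 /\ gen_eigen (ad x) u.1 u.2) ->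
    dact D w = \sum_(u <- s) f u.1 *: psi u.2.
  move=> e hs; apply: (can_inj phiK); rewrite phi_dact e linear_sum mulmx_suml.
  rewrite big_seq [RHS]big_seq; apply: eq_bigr => u us.
  by rewrite linearZ /= psiK (hp _ _ (proj2 (hs _ us))).
rewrite (dactE y sym_image) // (dactE z sz) //.
have {ey}ey := sumE _ _ ey; have {ez}ez := sumE _ _ ez; rewrite ey !lie_suml !linear_sum mulmx_suml.
set dz := \sum_(u <- sz) f u.1 *: psi u.2.
transitivity (\sum_(i <- sym_image) (phi [: f i.1 *: psi i.2, z :] + phi [: psi i.2, dz :])); last by rewrite big_split.
rewrite big_seq [RHS]big_seq; apply: eq_bigr => u us.
rewrite ez !lie_sumr !linear_sum mulmx_suml.
transitivity (\sum_(i <- sz) (phi [: f u.1 *: psi u.2, psi i.2 :] + phi [: psi u.2, f i.1 *: psi i.2 :])); last by rewrite big_split.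
rewrite big_seq [RHS]big_seq; apply: eq_bigr => w ws.
rewrite lieZl lieZr !linearZ -scalerDl -fD; apply: hp; apply: gen_eigen_lie; rewrite psiK.
  exact: (proj2 (hy _ us)).
exact: (proj2 (hz _ ws)).
Qed.

End Adjoint.

(** * The Killing form of a simple Lie algebra *)

Lemma span_linear_eq0 (C : fieldType) (V : vectType C) (U : lmodType C)
    (L : {linear V -> U}) (s : seq V) x :
  (forall y, y \in s -> L y = 0) -> x \in span s -> L x = 0.
Proof.
move=> h xs; rewrite (coord_span (X := in_tuple s) xs) linear_sum big1 // => i _.
by rewrite linearZ /= h ?scaler0 // mem_nth.
Qed.

Section Killing.
Variables (C : numClosedFieldType) (g : lieAlgebra C) (n : nat).
Variables (phi : {linear g -> 'rV[C]_n.+1}) (psi : 'rV[C]_n.+1 -> g).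
Hypotheses (phiK : cancel phi psi) (psiK : cancel psi phi).
Implicit Types (x y z h : g) (D : 'M[C]_n.+1).
Notation ad := (ad phi psi).
Notation is_derivation := (is_derivation phi psi).
Notation dact := (dact phi psi).

Definition killing_form x y := \tr (ad x *m ad y).

Lemma killingC x y : killing_form x y = killing_form y x.
Proof. exact: mxtrace_mulC. Qed.
Definition killing_l y x : C^o := killing_form x y.
Fact killing_l_linear y : linear (killing_l y).
Proof. by move=> a u v; rewrite /killing_l /killing_form (adP phiK psiK) mulmxDl -scalemxAl linearD linearZ. Qed.
HB.instance Definition _ y :=
  GRing.isLinear.Build C _ C^o _ (killing_l y) (killing_l_linear y).
Lemma killing_functional y : exists L : {linear g -> C^o}, forall x, L x = killing_form x y.
Proof. by exists (killing_l y). Qed.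
Lemma killingDl x y z : killing_form (x + y) z = killing_form x z + killing_form y z.
Proof. exact: (linearD (killing_l z)). Qed.
Lemma killingZl a x z : killing_form (a *: x) z = a * killing_form x z.
Proof. by rewrite -[LHS]/(killing_l z _) linearZ. Qed.
Lemma killing_suml (I : Type) (s : seq I) F y :
  killing_form (\sum_(i <- s) F i) y = \sum_(i <- s) killing_form (F i) y.
Proof. exact: (linear_sum (killing_l y)). Qed.
Lemma killing_sumr (I : Type) (s : seq I) F y :
  killing_form y (\sum_(i <- s) F i) = \sum_(i <- s) killing_form y (F i).
Proof. by rewrite killingC killing_suml; apply: eq_bigr => i _; rewrite killingC. Qed.
Lemma killingZr a x z : killing_form x (a *: z) = a * killing_form x z.
Proof. by rewrite killingC killingZl killingC. Qed.
Lemma killing0l y : killing_form 0 y = 0.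
Proof. by rewrite /killing_form (ad0 phiK psiK) mul0mx mxtrace0. Qed.

Lemma killing_inv x y z : killing_form [: x, y :] z = killing_form x [: y, z :].
Proof.
rewrite /killing_form !(ad_lie phiK psiK) mulmxBl mulmxBr !linearB /= -mulmxA mxtrace_mulC.
by rewrite -!mulmxA.
Qed.

Lemma nilpotent_trace0 (N : 'M[C]_n.+1) k : N ^+ k = 0 -> \tr N = 0.
Proof.
move=> Nk; have [rs [rs_size rsE rsT]] := trace_spectrum N.
have := rsT 1; rewrite rmorph1 mulmx1 => ->; rewrite big_seq big1 // => z zr.
have : root (char_poly N) z by rewrite rsE root_prod_XsubC.
rewrite -eigenvalue_root_char => /eigenvalueP[v vN v0].
have : v *m N ^+ k = z ^+ k *: v.
  elim: k {Nk} => [|k IH]; first by rewrite !expr0 mulmx1 scale1r.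
  by rewrite exprS -[_ * _]/(_ *m _) mulmxA vN -scalemxAl IH scalerA -exprS.
rewrite Nk mulmx0 => /esym/eqP; rewrite scaler_eq0 (negPf v0) orbF expf_eq0.
by case/andP => _ /eqP ->; rewrite mul0r.
Qed.

(** The product of two commuting operators is nilpotent if one of them is. *)
Lemma killing_nilp x y k : ad x ^+ k = 0 -> [: x, y :] = 0 -> killing_form x y = 0.
Proof.
move=> xk xy; apply: (@nilpotent_trace0 _ k).
rewrite -[ad x *m _]/(_ * _) exprMn_comm ?xk ?mul0r //.
exact: (ad_comm phiK psiK).
Qed.

Lemma ad_dact D z : is_derivation D -> ad (dact D z) = ad z *m D - D *m ad z.
Proof.
move=> hD; apply: (ad_ext psiK) => w; rewrite mulmxBr !mulmxA.
rewrite -!(phi_lie phiK psiK) -!(phi_dact psiK D) -!(phi_lie phiK psiK) -linearB.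
by congr (phi _); rewrite hD addrK.
Qed.

Lemma trace_lie_der y z D : is_derivation D ->
  \tr (ad [: y, z :] *m D) = - killing_form y (dact D z).
Proof.
move=> hD; rewrite /killing_form ad_dact // (ad_lie phiK psiK) mulmxBl mulmxBr !linearB /=.
by rewrite opprB -!mulmxA [\tr (ad z *m _)]mxtrace_mulC !mulmxA.
Qed.

(** With [D] the conjugate of the semisimple part of [ad x], the trace of
    [ad x * D] is the sum of the squared moduli of the eigenvalues of [ad x]. *)
Lemma trace_criterion x :
  (forall D, is_derivation D -> (exists p, D = horner_mx (ad x) p) ->
     (forall c v, gen_eigen (ad x) c v -> v *m D = c^* *: v) ->
     \tr (ad x *m D) = 0) ->
  ad x ^+ n.+1 = 0.
Proof.
move=> hx.
have [D [Dder Dp hD [rs [rs_size rsE rsT]]]] :=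
  spectral_derivation phiK psiK x (fun a b => rmorphD (@Num.conj C) a b).
have /eqP := hx D Dder Dp hD; rewrite rsT psumr_eq0; last by move=> i _; exact: mul_conjC_ge0.
move=> /allP rs0; have {rs0 rsE}chiE : char_poly (ad x) = 'X ^+ n.+1.
  rewrite rsE -rs_size (_ : rs = nseq (size rs) 0).
    by rewrite size_nseq; elim: (size rs) => [|m IH]; rewrite ?big_nil //= big_cons IH subr0 exprS.
  by apply/all_pred1P/allP => z /rs0 /=; rewrite mul_conjC_eq0.
by have := Cayley_Hamilton (ad x); rewrite chiE rmorphXn /= horner_mx_X.
Qed.

Hypothesis g_simple : simple_lie g.

Lemma simple_center0 x : (forall y, [: x, y :] = 0) -> x = 0.
Proof.
move=> hx; have [[y [z yz]] hJ] := g_simple.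
have [] := hJ <[x]>%VS.
- move=> u v /vlineP[c ->]; rewrite lieZr lieC hx oppr0 scaler0; exact: mem0v.
- by move=> x0; apply/eqP; rewrite -memv0 -x0 memv_line.
move=> xT; have lin (u : g) : exists c, u = c *: x.
  by apply/vlineP; rewrite xT memvf.
have [c yE] := lin y; have [d zE] := lin z.
by move: yz; rewrite yE lieZl hx scaler0 eqxx.
Qed.

Lemma simple_perfect (L : {linear g -> C^o}) :
  (forall y z, L [: y, z :] = 0) -> forall x, L x = 0.
Proof.
move=> hL x; have [[y [z yz]] hJ] := g_simple.
pose J := lie_comm (fullv : {vspace g}) fullv.
have inJ u v : [: u, v :] \in J.
  rewrite (coord_vbasis (memvf u)) (coord_vbasis (memvf v)) lie_suml.
  apply: memv_suml => i _; rewrite lie_sumr; apply: memv_suml => j _.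
  rewrite lieZl lieZr; do 2!apply: memvZ; apply: memv_span.
  by apply: allpairs_f; apply: mem_nth; rewrite size_tuple ltn_ord.
have [J0|JT] := hJ J (fun u v _ => inJ u v).
  by have := inJ y z; rewrite J0 memv0 (negPf yz).
apply: (span_linear_eq0 (s := [seq [: u, v :] | u <- vbasis fullv, v <- vbasis (fullv : {vspace g})])).
  by move=> w /allpairsP[[u v] [_ _ ->]]; exact: hL.
by move: (memvf x); rewrite -[in X in X -> _]JT; apply.
Qed.

Hypothesis eigen2 : exists t e : g, e != 0 /\ [: t, e :] = 2%:R *: e.

(** If the Killing form vanished, the trace of [ad x * D] would vanish for
    every derivation [D] on brackets [x], hence everywhere, and [trace_criterion]
    would make every element ad-nilpotent; but [ad t] has the eigenvalue 2. *)
Lemma killing_neq0 : exists x y, killing_form x y <> 0.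
Proof.
apply: contrapT => h0.
have {}h0 x y : killing_form x y = 0.
  by apply: contrapT => hxy; apply: h0; exists x, y.
have [t [e [e0 te]]] := eigen2.
have tn : ad t ^+ n.+1 = 0.
  apply: trace_criterion => D Dder _ _.
  have lin : linear (fun x => \tr (ad x *m D) : C^o).
    by move=> a u v; rewrite (adP phiK psiK) mulmxDl -scalemxAl linearD linearZ.
  pose L := GRing.isLinear.Build C _ C^o _ _ lin.
  apply: (@simple_perfect (HB.pack (fun x => \tr (ad x *m D) : C^o) L)) => y z /=.
  by rewrite trace_lie_der // h0 oppr0.
have te' k : phi e *m ad t ^+ k = 2%:R ^+ k *: phi e.
  elim: k => [|k IH]; first by rewrite !expr0 mulmx1 scale1r.
  rewrite exprS -[_ * _]/(_ *m _) mulmxA -(phi_lie phiK psiK) te linearZ -scalemxAl IH.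
  by rewrite scalerA -exprS.
have := te' n.+1; rewrite tn mulmx0 => /esym/eqP; rewrite scaler_eq0.
rewrite expf_eq0 pnatr_eq0 /= => /eqP pe; move: e0.
by rewrite -(phiK e) pe -(linear0 phi) phiK eqxx.
Qed.

Definition kf x : 'rV[C]_n.+1 := \row_j killing_form x (psi (delta_mx 0 j)).
Fact kf_linear : linear kf.
Proof. by move=> a u v; apply/rowP => j; rewrite !mxE killingDl killingZl. Qed.
HB.instance Definition _ := GRing.isLinear.Build C _ _ _ kf kf_linear.

Lemma killing_kf x y : killing_form x y = \sum_j phi y 0 j * kf x 0 j.
Proof.
have -> : y = \sum_j phi y 0 j *: psi (delta_mx 0 j).
  apply: (can_inj phiK); rewrite linear_sum {1}[phi y]row_sum_delta.
  by apply: eq_bigr => j _; rewrite linearZ /= psiK.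
rewrite killing_sumr; apply: eq_bigr => j _; rewrite killingZr !mxE; congr (_ * _).
rewrite linear_sum summxE (bigD1 j) //= linearZ /= psiK !mxE !eqxx mulr1.
rewrite big1 ?addr0 // => i ij.
by rewrite linearZ /= psiK !mxE !eqxx eq_sym (negPf ij) mulr0.
Qed.

(** The radical of the Killing form is an ideal. *)
Lemma killing_nondeg x : (forall y, killing_form x y = 0) -> x = 0.
Proof.
move=> hx; pose J := lker (linfun kf).
have inJ u : u \in J <-> forall y, killing_form u y = 0.
  rewrite memv_ker lfunE /=; split=> [/eqP h y|h].
    by rewrite killing_kf h big1 // => j _; rewrite mxE mulr0.
  by apply/eqP/rowP => j; rewrite !mxE.
have [_ hJ] := g_simple.
have [|J0|JT] := hJ J.
- move=> u v /inJ hv; apply/inJ => y.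
  by rewrite lieC -scaleN1r killingZl killing_inv hv mulr0.
- by apply/eqP; rewrite -memv0 -J0; apply/inJ.
have [u [v []]] := killing_neq0; move: v; apply/inJ; by rewrite JT memvf.
Qed.

Lemma killing_represent (L : {linear g -> C^o}) :
  exists u, forall y, killing_form u y = L y.
Proof.
have psi_lin : linear psi.
  by move=> a u v; apply: (can_inj phiK); rewrite psiK linearP !psiK.
have kl : linear (kf \o psi) by move=> a u v; rewrite /= psi_lin linearP.
pose kl' := GRing.isLinear.Build C _ _ _ _ kl.
pose kL : {linear _ -> _} := HB.pack (kf \o psi) kl'.
have Funit : lin1_mx kL \in unitmx.
  rewrite -row_free_unit -kermx_eq0; apply/eqP/row_matrixP => i.
  rewrite row0; have := row_sub i (kermx (lin1_mx kL)) => /sub_kermxP.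
  set r := row i _; rewrite mul_rV_lin1 /= => hr; rewrite -(psiK r).
  suff -> : psi r = 0 by rewrite linear0.
  apply: killing_nondeg => y; rewrite killing_kf hr big1 // => j _.
  by rewrite mxE mulr0.
pose r : 'rV[C]_n.+1 := \row_j L (psi (delta_mx 0 j)).
exists (psi (r *m invmx (lin1_mx kL))) => y; rewrite killing_kf.
have -> : kf (psi (r *m invmx (lin1_mx kL))) = r.
  by rewrite -[LHS](mul_rV_lin1 kL) mulmxKV.
rewrite -{2}(phiK y) [phi y]row_sum_delta.
have -> : psi (\sum_j phi y 0 j *: delta_mx 0 j) = \sum_j phi y 0 j *: psi (delta_mx 0 j).
  apply: (can_inj phiK); rewrite psiK linear_sum.
  by apply: eq_bigr => j _; rewrite linearZ /= psiK.
rewrite linear_sum; apply: eq_bigr => j _; rewrite -row_sum_delta !mxE linearZ //.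
Qed.

(** Represent the functional [y |-> tr (D ad y)] by [u].  The derivation
    [D - ad u] is orthogonal to all [ad y], and so its values are orthogonal to
    [g] for the Killing form. *)
Lemma derivation_inner D : is_derivation D -> exists u, D = ad u.
Proof.
move=> Dder.
have lin : linear (fun y => \tr (D *m ad y) : C^o).
  by move=> a u v; rewrite (adP phiK psiK) mulmxDr -scalemxAr linearD linearZ.
pose L := GRing.isLinear.Build C _ C^o _ _ lin.
have [u hu] := killing_represent (HB.pack (fun y => \tr (D *m ad y) : C^o) L).
exists u; pose E := D - ad u.
have hE y : \tr (E *m ad y) = 0.
  by rewrite mulmxBl linearB /= -[X in _ - X]/(killing_form u y) hu subrr.
have Eder : is_derivation E.
  move=> y z; apply: (can_inj phiK); rewrite linearD /= (phi_dact psiK) mulmxBr.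
  rewrite -!(phi_dact psiK) Dder (dact_ad phiK psiK) lie_leibniz.
  rewrite -!linearD -linearB; congr (phi _).
  have dE w : dact E w = dact D w - [: u, w :].
    by apply: (can_inj phiK); rewrite linearB /= !(phi_dact psiK) (phi_lie phiK psiK) mulmxBr.
  by rewrite !dE lieBl lieBr; rewrite opprD addrACA.
suff E0 : E = 0 by apply/eqP; rewrite -subr_eq0 -/E E0.
apply: (ad_ext psiK) => x; rewrite mulmx0 -(phi_dact psiK).
suff -> : dact E x = 0 by rewrite linear0.
apply: killing_nondeg => y; rewrite /killing_form ad_dact // mulmxBl linearB /=.
rewrite -!mulmxA mxtrace_mulC -mulmxA -linearB -mulmxBr -(ad_lie phiK psiK); exact: hE.
Qed.

End Killing.

(** * Cartan subalgebras and the root decomposition *)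

Lemma locally_nilpotent (C : fieldType) n (N : 'M[C]_n.+1) :
  (forall v : 'rV_n.+1, exists k, v *m N ^+ k = 0) -> exists k, N ^+ k = 0.
Proof.
move=> h; have /choice[k hk] (i : 'I_n.+1) := h (delta_mx 0 i).
exists (\sum_i k i)%N; apply/row_matrixP => i; rewrite rowE row0.
by rewrite (bigD1 i) //= exprD -[_ * _]/(_ *m _) mulmxA hk mul0mx.
Qed.

Section LowerCentral.
Variables (C : numFieldType) (g : lieAlgebra C).
Implicit Types (U V : {vspace g}) (x y z : g).

Lemma mem_lie_comm U V x y : x \in U -> y \in V -> [: x, y :] \in lie_comm U V.
Proof.
move=> xU yV; rewrite (coord_vbasis xU) (coord_vbasis yV) lie_suml.
apply: memv_suml => i _; rewrite lie_sumr; apply: memv_suml => j _.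
rewrite lieZl lieZr; do 2!apply: memvZ; apply: memv_span.
by apply: allpairs_f; apply: mem_nth; rewrite size_tuple ltn_ord.
Qed.

Lemma lie_comm_linear_eq0 U V (W : lmodType C) (L : {linear g -> W}) z :
  (forall x y, x \in U -> y \in V -> L [: x, y :] = 0) ->
  z \in lie_comm U V -> L z = 0.
Proof.
move=> h; apply: span_linear_eq0 => _ /allpairsP[[x y] [/= xU yV ->]].
by apply: h; apply: vbasis_mem.
Qed.

Lemma lie_comm_sub U V (W : {vspace g}) : (forall x y, x \in U -> y \in V -> [: x, y :] \in W) ->
  (lie_comm U V <= W)%VS.
Proof.
move=> h; apply/span_subvP => _ /allpairsP[[x y] [/= xU yV ->]].
by apply: h; apply: vbasis_mem.
Qed.

End LowerCentral.

Section Cartan.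
Variables (C : numClosedFieldType) (g : lieAlgebra C) (n : nat).
Variables (phi : {linear g -> 'rV[C]_n.+1}) (psi : 'rV[C]_n.+1 -> g).
Hypotheses (phiK : cancel phi psi) (psiK : cancel psi phi).
Hypothesis g_simple : simple_lie g.
Hypothesis eigen2 : exists t e : g, e != 0 /\ [: t, e :] = 2%:R *: e.
Variable H : {vspace g}.
Hypothesis H_cartan : cartan_subalgebra H.
Implicit Types (x y z h u : g) (D : 'M[C]_n.+1).
Notation ad := (ad phi psi).
Notation is_derivation := (is_derivation phi psi).
Notation killing := (killing_form phi psi).

Let adD := adD phiK psiK.
Let adN := adN phiK psiK.
Let phi_lie := phi_lie phiK psiK.

Lemma cartan_lie x y : x \in H -> y \in H -> [: x, y :] \in H.
Proof. by case: H_cartan => h _ _; exact: h. Qed.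

Lemma cartan_normalizer x : (forall y, y \in H -> [: x, y :] \in H) -> x \in H.
Proof. by case: H_cartan => _ _; apply. Qed.

Lemma lower_central_sub j : (lower_central H j <= H)%VS.
Proof.
elim: j => [|j IH]; first exact: subvv.
apply: lie_comm_sub => x y xH yj; apply: cartan_lie => //.
exact: subvP IH _ yj.
Qed.

Lemma phi_iter z p x : phi (iter p (lieb z) x) = phi x *m ad z ^+ p.
Proof.
elim: p => [|p IH]; first by rewrite expr0 mulmx1.
by rewrite iterS phi_lie IH -mulmxA exprSr.
Qed.

(** This is the nilpotency of [H]. *)
Lemma cartan_gen_eigen0 h y : h \in H -> y \in H -> gen_eigen (ad h) 0 (phi y).
Proof.
move=> hH yH; case: H_cartan => _ [s Hs0] _; exists s.
rewrite raddf0 subr0 -phi_iter.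
suff : iter s (lieb h) y \in lower_central H s.
  by rewrite Hs0 memv0 => /eqP ->; rewrite linear0.
by elim: s {Hs0} => [|j IH] //=; exact: mem_lie_comm.
Qed.

(** The derivation attached to [f] is inner.  It kills [H], which lies in the
    generalized eigenspace 0, because [f 0 = 0]; so the element giving it
    centralizes [H], and belongs to [H]. *)
Lemma cartan_spectral h (f : C -> C) : {morph f : a b / a + b} -> h \in H ->
  exists u, [/\ u \in H, forall y, y \in H -> [: u, y :] = 0 &
    forall c v, gen_eigen (ad h) c v -> v *m ad u = f c *: v].
Proof.
move=> fD hH; have f0 : f 0 = 0 by apply: (addrI (f 0)); rewrite -fD !addr0.
have [D [Dder _ hD _]] := spectral_derivation phiK psiK h fD.
have [u Du] := derivation_inner phiK psiK g_simple eigen2 Dder.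
have uH y : y \in H -> [: u, y :] = 0.
  move=> yH; apply: (can_inj phiK); rewrite phi_lie -Du linear0.
  by rewrite (hD 0) ?f0 ?scale0r //; exact: cartan_gen_eigen0.
exists u; split=> // [|c v]; last by rewrite -Du; exact: hD.
by apply: cartan_normalizer => y /uH ->; exact: mem0v.
Qed.

(** The semisimple part of [ad h] comes from an element of [H]: take [f] to
    be the identity in [cartan_spectral]. *)
Lemma cartan_jordan h : h \in H ->
  exists u, [/\ u \in H, forall y, y \in H -> [: u, y :] = 0,
    exists2 rs : seq C, uniq rs & mxminpoly (ad u) %| \prod_(x <- rs) ('X - x%:P)
    & exists k, ad (h - u) ^+ k = 0].
Proof.
move=> hH; have [u [uH uc hu]] := cartan_spectral (f := id) (fun a b => erefl) hH.
exists u; split=> //.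
  have [rs hrs] := char_poly_split (ad h).
  exists (undup rs); first exact: undup_uniq.
  apply: mxminpoly_min; apply: mx_ext => v; rewrite mulmx0.
  have [s [hs ->]] := gen_eigen_span (ad h) v.
  rewrite mulmx_suml big_seq big1 // => x /hs [xr /hu xu].
  have hq q : x.2 *m horner_mx (ad u) q = q.[x.1] *: x.2.
    elim/poly_ind: q => [|q c IH]; first by rewrite rmorph0 mulmx0 horner0 scale0r.
    rewrite rmorphD rmorphM /= horner_mx_X horner_mx_C mulmxDr mulmxA IH.
    by rewrite -scalemxAl xu scalerA mul_mx_scalar -scalerDl hornerMXaddC.
  rewrite hq; suff /eqP -> : root (\prod_(c <- undup rs) ('X - c%:P)) x.1 by rewrite scale0r.
  by rewrite root_prod_XsubC mem_undup -root_prod_XsubC -hrs.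
apply: locally_nilpotent => v.
have [s [hs ->]] := gen_eigen_span (ad h) v.
have key c k (w : 'rV[C]_n.+1) : w *m (ad h - c%:M) ^+ k = 0 -> w *m ad (h - u) ^+ k = 0.
  elim: k w => [|k IH] w; first by rewrite !expr0.
  move=> hw; rewrite exprS -[_ * _]/(_ *m _) mulmxA.
  have -> : w *m ad (h - u) = w *m (ad h - c%:M).
    rewrite adD adN !mulmxBr mul_mx_scalar (hu c) //; exists k.+1; exact: hw.
  by apply: (IH (w *m (ad h - c%:M))); rewrite -mulmxA -[_ *m _ ^+ _]/(_ * _) -exprS.
elim: s hs => [|x s IH] hs; first by exists 0%N; rewrite big_nil mul0mx.
have [|k1 h1] := IH; first by move=> y ys; apply: hs; rewrite inE ys orbT.
have [_ [k2 /key h2]] := hs x (mem_head _ _).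
exists (k1 + k2)%N; rewrite big_cons mulmxDl {1}addnC !exprD.
by rewrite -![_ * _]/(_ *m _) !mulmxA h1 h2 !mul0mx addr0.
Qed.

(** Going up the lower central series of [H], from its zero term to [H], an
    element of [M] outside [H] is replaced by another one whose brackets with the
    current term lie in [H]: for each basis vector in turn, take its last iterated
    bracket outside [H].  At the end [H] is normalized by an element outside [H]. *)
Lemma engel_cartan s (M : g -> Prop) : lower_central H s = 0%VS ->
  (forall z x, z \in H -> M x -> M [: z, x :]) ->
  (forall j z x, (j < s)%N -> z \in vbasis (lower_central H j) -> M x ->
     exists p, iter p (lieb z) x = 0) ->
  forall x, M x -> x \in H.
Proof.
move=> Hs0 Mlie Mnil x0 Mx0; apply: contrapT => /negP x0H.
suff : exists x, [/\ M x, x \notin H & forall y, y \in lower_central H 0 -> [: y, x :] \in H].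
  case=> x [_ /negP xH hx]; apply: xH; apply: cartan_normalizer => y yH.
  by rewrite lieC memvN; exact: hx.
suff key j : (j <= s)%N -> exists x, [/\ M x, x \notin H &
    forall y, y \in lower_central H (s - j) -> [: y, x :] \in H].
  by have := key s (leqnn s); rewrite subnn.
elim: j => [_|j IH js].
  exists x0; split=> // y; rewrite subn0 Hs0 memv0 => /eqP ->.
  by rewrite lie0l mem0v.
have {IH} := IH (ltnW js); set i := (s - j.+1)%N.
have -> : (s - j = i.+1)%N by rewrite /i; lia.
have is_ : (i < s)%N by rewrite /i; lia.
move=> [x1 [Mx1 x1H hx1]].
suff [x [Mx xH hx hz]] : exists x, [/\ M x, x \notin H,
    forall y, y \in lower_central H i.+1 -> [: y, x :] \in H &
    forall z, z \in (vbasis (lower_central H i) : seq g) -> [: z, x :] \in H].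
  exists x; split=> // y yi; rewrite (coord_vbasis yi) lie_suml.
  apply: memv_suml => l _; rewrite lieZl; apply: memvZ; apply: hz.
  by apply: mem_nth; rewrite size_tuple.
have : {subset (vbasis (lower_central H i) : seq g) <= (vbasis (lower_central H i) : seq g)} by [].
elim: {1 3}(vbasis (lower_central H i) : seq g) => [|z zs IH] sub.
  by exists x1.
have [|x [Mx xH hx hzs]] := IH; first by move=> w ws; apply: sub; rewrite inE ws orbT.
have zi := sub z (mem_head _ _).
have ziH : z \in lower_central H i by exact: vbasis_mem.
have zH := subvP (lower_central_sub i) _ ziH.
pose Q w := [/\ M w, forall y, y \in lower_central H i.+1 -> [: y, w :] \in H &
    forall z, z \in zs -> [: z, w :] \in H].
have Qz w : Q w -> Q [: z, w :].
  case=> Mw h1 h2; split; first exact: Mlie.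
    move=> y yi; rewrite lie_leibniz; apply: memvD; last by apply: cartan_lie => //; exact: h1.
    by apply: h1; apply: mem_lie_comm => //; exact: subvP (lower_central_sub i.+1) _ yi.
  move=> y yzs; rewrite lie_leibniz; apply: memvD; last by apply: cartan_lie => //; exact: h2.
  have yi : y \in (vbasis (lower_central H i) : seq g) by apply: sub; rewrite inE yzs orbT.
  apply: h1; apply: mem_lie_comm => //.
  by apply: subvP (lower_central_sub i) _ _; exact: vbasis_mem.
have Qp p : Q (iter p (lieb z) x) by elim: p => [|p IHp] //=; exact: Qz.
have : exists p, iter p (lieb z) x \in H.
  by have [p hp] := Mnil _ _ _ is_ zi Mx; exists p; rewrite hp mem0v.
case/ex_minnP => -[|p]; first by rewrite /= (negPf xH).
move=> hp pmin; have [Mp h1 h2] := Qp p.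
exists (iter p (lieb z) x); split=> //.
  by apply/negP => /pmin; rewrite ltnn.
by move=> w; rewrite inE => /predU1P[->|/h2].
Qed.

(** Take the semisimple parts of bases of the lower central series.  On their
    common centralizer each basis vector acts like its nilpotent part, so that
    Engel's theorem puts this centralizer inside [H]. *)
Lemma cartan_toral : exists us : seq g,
  (forall u, u \in us -> [/\ u \in H, forall y, y \in H -> [: u, y :] = 0 &
     exists2 rs : seq C, uniq rs & mxminpoly (ad u) %| \prod_(x <- rs) ('X - x%:P)]) /\
  (forall x, (forall u, u \in us -> [: u, x :] = 0) -> x \in H).
Proof.
have [_ [s Hs0] _] := H_cartan.
have /choice[U hU] : forall z, exists u, z \in H -> [/\ u \in H, forall y, y \in H -> [: u, y :] = 0,
    exists2 rs : seq C, uniq rs & mxminpoly (ad u) %| \prod_(x <- rs) ('X - x%:P)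
    & exists k, ad (z - u) ^+ k = 0].
  move=> z; case: (boolP (z \in H)) => [/cartan_jordan[u hu]|_]; last by exists 0.
  by exists u.
pose zs := flatten [seq (vbasis (lower_central H j) : seq g) | j <- iota 0 s].
have zsH z : z \in zs -> z \in H.
  case/flattenP => _ /mapP[j _ ->] /vbasis_mem; exact: subvP (lower_central_sub j) _.
exists [seq U z | z <- zs]; split=> [_ /mapP[z /zsH zH ->]|].
  by have [] := hU z zH.
apply: (engel_cartan Hs0) => [z x zH Mx u us|j z x js zj Mx].
  have /mapP[w /zsH wH uE] := us; have [_ uc _ _] := hU w wH.
  by rewrite lie_leibniz uE uc // lie0l add0r -uE Mx // lie0r.
have zzs : z \in zs.
  apply/flattenP; exists (vbasis (lower_central H j) : seq g) => //.
  by apply/mapP; exists j => //; rewrite mem_iota.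
have [_ uc _ [k hk]] := hU z (zsH z zzs); exists k.
suff -> : iter k (lieb z) x = iter k (lieb (z - U z)) x.
  by apply: (can_inj phiK); rewrite phi_iter hk mulmx0 linear0.
have Uz0 p : [: U z, iter p (lieb z) x :] = 0.
  elim: p => [|p IHp]; first by apply: Mx; apply/mapP; exists z.
  by rewrite iterS lie_leibniz uc ?zsH // lie0l IHp lie0r addr0.
elim: k {hk} => [|k IHk] //; by rewrite !iterS -IHk lieBl Uz0 subr0.
Qed.

Lemma joint_eigenbasis (us : seq g) :
  (forall u v, u \in us -> v \in us -> [: u, v :] = 0) ->
  (forall u, u \in us ->
     exists2 rs : seq C, uniq rs & mxminpoly (ad u) %| \prod_(x <- rs) ('X - x%:P)) ->
  exists2 P : 'M[C]_n.+1, P \in unitmx &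
    forall u, u \in us -> exists d, P *m ad u = diag_mx d *m P.
Proof.
move=> uc ud; have [|P Pu /allP hP] := (mxpoly.codiagonalizableP [seq ad u | u <- us]).1.
  split=> [_ _ /mapP[u us1 ->] /mapP[v us2 ->]|_ /mapP[u us1 ->]].
    by rewrite /comm_mx; apply: (ad_comm phiK psiK); exact: uc.
  by apply/mxpoly.diagonalizableP; exact: ud.
exists P => // u us1; have /hP /= : ad u \in [seq ad u | u <- us] by apply/mapP; exists u.
by case/mxpoly.diagonalizable_forPex => d /(mxpoly.simmxP Pu) hd; exists d.
Qed.

Lemma row_basis_span (P : 'M[C]_n.+1) y : P \in unitmx ->
  y = \sum_i (phi y *m invmx P) 0 i *: psi (row i P).
Proof.
move=> Pu; apply: (can_inj phiK); rewrite -{1}(mulmxKV Pu (phi y)) mulmx_sum_row linear_sum.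
by apply: eq_bigr => i _; rewrite linearZ /= psiK.
Qed.

Lemma row_basis_eigen (P : 'M[C]_n.+1) u d i : P *m ad u = diag_mx d *m P ->
  [: u, psi (row i P) :] = d 0 i *: psi (row i P).
Proof.
move=> h; apply: (can_inj phiK).
rewrite phi_lie linearZ /= !psiK -row_mul h mul_diag_mx.
by apply/rowP => j; rewrite !mxE.
Qed.

(** Such an element is orthogonal to a joint eigenbasis of the elements of
    [cartan_toral]: to the eigenvectors in [H] since it commutes with them and is
    ad-nilpotent, to the others by invariance. *)
Lemma cartan_nilpotent_center0 z k : z \in H -> (forall y, y \in H -> [: z, y :] = 0) ->
  ad z ^+ k = 0 -> z = 0.
Proof.
move=> zH zc zk; have [us [hus usH]] := cartan_toral.
have [||P Pu hP] := @joint_eigenbasis us.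
- by move=> u v /hus[_ uc _] /hus[vH _ _]; exact: uc.
- by move=> u /hus[].
apply: (killing_nondeg phiK psiK g_simple eigen2) => y.
rewrite (row_basis_span y Pu) (killing_sumr phiK psiK) big1 // => i _.
rewrite (killingZr phiK psiK); set w := psi _.
suff -> : killing z w = 0 by rewrite mulr0.
case: (pselect (forall u, u \in us -> [: u, w :] = 0)) => [/usH wH|].
  by apply: (killing_nilp phiK psiK zk); exact: zc.
move/existsNP => [u /not_implyP[us1 uw]]; have [d /row_basis_eigen -/(_ i) hd] := hP u us1.
have d0 : d 0 i != 0 by apply/eqP => d0; apply: uw; rewrite hd d0 scale0r.
apply: (mulfI d0); rewrite mulr0 -(killingZr phiK psiK) -hd -(killing_inv phiK psiK).
by have [uH _ _] := hus u us1; rewrite zc // (killing0l phiK psiK).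
Qed.

(** An element [z] of the last nonzero term of the lower central series, if
    this is not [H] itself, is central in [H].  The conjugate derivation of [ad z]
    is [ad u] with [u] centralizing [H], and [killing z u = 0] because [z] is a
    sum of brackets of [H].  By [trace_criterion], [z] is ad-nilpotent, hence 0. *)
Lemma cartan_abelian x y : x \in H -> y \in H -> [: x, y :] = 0.
Proof.
move=> xH yH; have [_ [s Hs0] _] := H_cartan.
suff H1 : lower_central H 1 = 0%VS.
  by apply/eqP; rewrite -memv0 -H1; exact: mem_lie_comm.
have key j : lower_central H j.+2 = 0%VS -> lower_central H j.+1 = 0%VS.
  move=> Hj; apply/eqP; rewrite -subv0; apply/subvP => z zj; rewrite memv0; apply/eqP.
  have zH := subvP (lower_central_sub _) _ zj.
  have zc w : w \in H -> [: z, w :] = 0.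
    move=> wH; apply/eqP; rewrite -memv0 -Hj lieC memvN; exact: mem_lie_comm.
  apply: (cartan_nilpotent_center0 zH zc (k := n.+1)).
  apply: (trace_criterion phiK psiK) => D Dder _ hD.
  have [u Du] := derivation_inner phiK psiK g_simple eigen2 Dder.
  have uc w : w \in H -> [: u, w :] = 0.
    move=> wH; apply: (can_inj phiK); rewrite phi_lie -Du linear0.
    by rewrite (hD 0) ?conjC0 ?scale0r //; exact: cartan_gen_eigen0.
  have [L LE] := killing_functional phiK psiK u.
  rewrite Du -[LHS]/(killing z u) -LE.
  apply: (@lie_comm_linear_eq0 C g H (lower_central H j) C^o L z _ zj) => a b aH bj; rewrite LE.
  rewrite (killing_inv phiK psiK) lieC uc; last exact: subvP (lower_central_sub j) _ bj.
  by rewrite oppr0 killingC (killing0l phiK psiK).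
have {key}key j : lower_central H (j + 1) = 0%VS -> lower_central H 1 = 0%VS.
  by elim: j => [//|j IH] h; apply: IH; rewrite addn1; apply: key; rewrite addn1 in h.
apply: (key s); rewrite addn1 /= Hs0; apply/eqP; rewrite -subv0.
apply: lie_comm_sub => a b _; rewrite memv0 => /eqP ->; by rewrite lie0r mem0v.
Qed.

Lemma cartan_diagonalizable h : h \in H ->
  exists2 rs : seq C, uniq rs & mxminpoly (ad h) %| \prod_(x <- rs) ('X - x%:P).
Proof.
move=> hH; have [u [uH uc ud [k hk]]] := cartan_jordan hH.
suff -> : h = u by [].
apply/eqP; rewrite -subr_eq0; apply/eqP; apply: (cartan_nilpotent_center0 _ _ hk).
  by rewrite memvB.
by move=> y yH; rewrite cartan_abelian // memvB.
Qed.

(** Commuting diagonalizable operators have a joint eigenbasis; the Killing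
    form on [H] is computed in it, as a sum over the roots with multiplicity. *)
Lemma root_decomposition : exists (y : 'I_n.+1 -> g) (al : 'I_n.+1 -> hdual H),
  [/\ forall i, y i != 0, forall i, root_vector (al i) (y i),
      forall x, exists c : 'I_n.+1 -> C, x = \sum_i c i *: y i,
      forall i, al i = 0 -> y i \in H
    & forall h h' : subvs_of H, killing (vsval h) (vsval h') = \sum_i (al i h : C) * al i h'].
Proof.
have [||P Pu hP] := @joint_eigenbasis (vbasis H).
- by move=> u v /vbasis_mem uH /vbasis_mem vH; exact: cartan_abelian.
- by move=> u /vbasis_mem; exact: cartan_diagonalizable.
have hPH h : h \in H -> exists d, P *m ad h = diag_mx d *m P.
  move=> hH; have /choice[d hd] (i : 'I_(\dim H)) : exists d, P *m ad (vbasis H)`_i = diag_mx d *m P.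
    by apply: hP; apply: mem_nth; rewrite size_tuple.
  exists (\sum_i coord (vbasis H) i h *: d i).
  rewrite {1}(coord_vbasis hH) linear_sum mulmx_suml.
  rewrite (big_morph ad (@adD) (ad0 phiK psiK)) mulmx_sumr; apply: eq_bigr => i _.
  by rewrite (adZ phiK psiK) -scalemxAr hd linearZ /= scalemxAl.
pose f i (h : subvs_of H) : C^o := (P *m ad (vsval h) *m invmx P) i i.
have fl i : linear (f i).
  move=> a u v; rewrite /f linearP (adP phiK psiK) mulmxDr mulmxDl -scalemxAr -scalemxAl.
  by rewrite !mxE.
pose fL i : {linear subvs_of H -> C^o} := HB.pack (f i) (GRing.isLinear.Build C _ C^o _ _ (fl i)).
pose al i : hdual H := linfun (fL i).
have alE i (h : subvs_of H) : al i h = f i h by rewrite lfunE.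
have hal (h : subvs_of H) : exists d : 'rV[C]_n.+1,
    P *m ad (vsval h) = diag_mx d *m P /\ forall i, al i h = d 0 i.
  have [d hd] := hPH _ (subvsP h); exists d; split=> // i.
  by rewrite alE /f hd mulmxK // mxE eqxx.
exists (fun i => psi (row i P)), al; split.
- move=> i; apply/eqP => h.
  have : row i P *m invmx P = 0 by rewrite -(psiK (row i P)) h linear0 mul0mx.
  rewrite -row_mul mulmxV // => /rowP /(_ i); rewrite !mxE eqxx => /eqP.
  by rewrite oner_eq0.
- move=> i h; have [d [hd ->]] := hal h; exact: row_basis_eigen.
- by move=> x; exists (fun i => (phi x *m invmx P) 0 i); exact: row_basis_span.
- move=> i ali; apply: cartan_normalizer => w wH.
  have [d [hd /(_ i) adE]] := hal (vsproj H w); rewrite vsprojK // in hd.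
  rewrite lieC (row_basis_eigen i hd) -adE ali lfunE /= scale0r oppr0; exact: mem0v.
move=> h h'; have [d [hd adE]] := hal h; have [d' [hd' adE']] := hal h'.
have e (k : g) dk : P *m ad k = diag_mx dk *m P -> ad k = invmx P *m diag_mx dk *m P.
  by move=> e; rewrite -mulmxA -e mulKmx.
rewrite /killing_form (e _ _ hd) (e _ _ hd') !mulmxA mulmxK // mxtrace_mulC !mulmxA.
rewrite mulmxV // mul1mx mulmx_diag mxtrace_diag.
by apply: eq_bigr => i _; rewrite !mxE adE adE'.
Qed.

End Cartan.

(** * Root triples and sums of positive roots *)

Section RootVectors.
Variables (C : numFieldType) (g : lieAlgebra C) (H : {vspace g}).

Definition triangular_decomposable (pos : hdual H -> Prop) : Prop :=
  forall x : g, exists s : seq g,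
    (forall y, y \in s -> y \in H \/
       exists2 al, pos al & root_vector al y \/ root_vector (- al) y)
    /\ x = \sum_(y <- s) y.

Definition no_null_positive_sum (pos : hdual H -> Prop) : Prop :=
  forall s : seq (hdual H), s != nil ->
    (forall al, al \in s -> pos al) -> \sum_(al <- s) al != 0.

Implicit Types (al be : hdual H) (x y : g).

Lemma root_vector_lie al be x y : root_vector al x -> root_vector be y ->
  root_vector (al + be) [: x, y :].
Proof.
move=> hx hy h; rewrite lie_leibniz hx hy lieZl lieZr -scalerDl.
by rewrite lfunE.
Qed.

Lemma root_vector_scale al x (c : C) : root_vector al x -> root_vector al (c *: x).
Proof. by move=> hx h; rewrite lieZr hx !scalerA mulrC. Qed.

End RootVectors.

Section RootStrings.
Variables (C : numClosedFieldType) (g : lieAlgebra C) (n : nat).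
Variables (phi : {linear g -> 'rV[C]_n.+1}) (psi : 'rV[C]_n.+1 -> g).
Hypotheses (phiK : cancel phi psi) (psiK : cancel psi phi).
Hypothesis g_simple : simple_lie g.
Hypothesis eigen2 : exists t e : g, e != 0 /\ [: t, e :] = 2%:R *: e.
Variable H : {vspace g}.
Hypothesis H_cartan : cartan_subalgebra H.
Implicit Types (al be ga de : hdual H) (x y e f v : g).
Notation ad := (ad phi psi).
Notation killing := (killing_form phi psi).

(** The iterates would have infinitely many eigenvalues under [H]. *)
Lemma root_string_finite de ga e v : de != 0 -> root_vector de e ->
  root_vector ga v -> exists p, iter p (lieb e) v = 0.
Proof.
move=> de0 he hv; apply: contrapT => /forallNP hp.
have [h0 dh] : exists h0, de h0 != 0.
  apply: contrapT => /forallNP h; move/eqP: de0; apply; apply/lfunP => h1.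
  by rewrite lfunE /=; apply/eqP; apply: contrapT => /negP; exact: h.
have hpv p : root_vector (ga + de *+ p) (iter p (lieb e) v).
  elim: p => [|p IH]; first by rewrite addr0.
  by rewrite mulrS addrCA; exact: root_vector_lie.
pose rs := [seq (ga h0 : C) + de h0 *+ p | p <- iota 0 n.+2].
have inj : uniq rs.
  rewrite map_inj_uniq ?iota_uniq // => p q /addrI /eqP.
  by rewrite -subr_eq0 -[X in X - _]mulr_natr -[X in _ - X]mulr_natr -mulrBr mulf_eq0 (negPf dh) /= subr_eq0 eqr_nat => /eqP.
have rts : all (root (char_poly (ad (vsval h0)))) rs.
  apply/allP => _ /mapP[p _ ->]; rewrite -eigenvalue_root_char; apply/eigenvalueP.
  exists (phi (iter p (lieb e) v)).
    rewrite -(phi_lie phiK psiK) hpv linearZ; congr (_ *: _).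
    by rewrite lfunE /=; congr (_ + _); elim: p => [|p IH]; rewrite ?lfunE // !mulrS lfunE /= IH.
  apply/eqP => h; apply: (hp p); apply: (can_inj phiK); by rewrite h linear0.
have := max_poly_roots (monic_neq0 (char_poly_monic _)) rts inj.
by rewrite size_char_poly size_map size_iota ltnn.
Qed.

Section Triple.
Variables (be : hdual H) (e f : g) (T : subvs_of H).
Hypotheses (be0 : be != 0) (he : root_vector be e) (hf : root_vector (- be) f).
Hypothesis hT : vsval T = [: e, f :].

(** The representation theory of sl_2, reduced to one computation: [e] applied
    to the powers of [f] on a vector killed by [e], up to the first power which
    vanishes. *)
Lemma primitive_weight ga v : v != 0 -> root_vector ga v -> [: e, v :] = 0 ->
  exists m : nat, (ga T : C) = be T * (m%:R / 2%:R).
Proof.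
move=> v0 hv ev.
pose K p : C := p%:R * ga T - be T * ((p%:R * (p%:R - 1)) / 2%:R).
have hpv p : root_vector (ga - be *+ p) (iter p (lieb f) v).
  elim: p => [|p IH]; first by rewrite subr0.
  by rewrite mulrS opprD addrCA; exact: root_vector_lie.
have tv p : [: vsval T, iter p (lieb f) v :] = ((ga T : C) - p%:R * be T) *: iter p (lieb f) v.
  rewrite hpv; congr (_ *: _); rewrite lfunE /= lfunE /=; congr (_ - _).
  by rewrite mulr_natl; elim: p => [|p IH]; rewrite ?lfunE // !mulrS lfunE /= IH.
have hK p : [: e, iter p.+1 (lieb f) v :] = K p.+1 *: iter p (lieb f) v.
  have step q : [: e, iter q.+1 (lieb f) v :] =
      [: vsval T, iter q (lieb f) v :] + [: f, [: e, iter q (lieb f) v :] :].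
    by rewrite hT iterS lie_leibniz.
  elim: p => [|p IH]; rewrite step tv.
    by rewrite /= ev lie0r addr0 /K; congr (_ *: _); rewrite mul1r subrr mulr0 mul0r !mulr0 mul0r.
  rewrite IH lieZr -iterS -scalerDl; congr (_ *: _); rewrite /K -!natr1.
  by field.
have be0' : - be != 0 by rewrite oppr_eq0.
have : exists p, iter p (lieb f) v == 0.
  by have [p hp] := root_string_finite be0' hf hv; exists p; rewrite hp.
case/ex_minnP => -[|p]; first by rewrite /= (negPf v0).
move=> /eqP vp pmin; have := hK p; rewrite vp lie0r => /esym/eqP.
rewrite scaler_eq0 orbC => /orP[/pmin|]; first by rewrite ltnn.
have p0 : (p.+1%:R : C) != 0 by rewrite pnatr_eq0.
rewrite /K subr_eq0 => /eqP h; exists p; apply: (mulfI p0); rewrite h -natr1.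
by field.
Qed.

(** The last nonzero iterate of [e] on [v] is killed by [e]. *)
Lemma weight_rational ga v : v != 0 -> root_vector ga v ->
  exists2 q : C, q \is Num.real & (ga T : C) = be T * q.
Proof.
move=> v0 hv; have : exists p, iter p (lieb e) v == 0.
  by have [p hp] := root_string_finite be0 he hv; exists p; rewrite hp.
case/ex_minnP => -[|p]; first by rewrite /= (negPf v0).
move=> /eqP vp pmin.
have hpv : root_vector (ga + be *+ p) (iter p (lieb e) v).
  elim: p {vp pmin} => [|p IH]; first by rewrite addr0.
  by rewrite mulrS addrCA; exact: root_vector_lie.
have [||m hm] := primitive_weight _ hpv.
- by apply/eqP => /eqP /pmin; rewrite ltnn.
- by rewrite -iterS.
exists (m%:R / 2%:R - p%:R); first by rewrite rpredB ?realM ?realV ?realn.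
have -> : (ga T : C) = (ga + be *+ p : hdual H) T - p%:R * be T.
  rewrite lfunE /= mulr_natl; suff -> : (be *+ p : hdual H) T = be T *+ p by rewrite addrK.
  by elim: (p) => [|q IH]; rewrite ?lfunE // !mulrS lfunE /= IH.
by rewrite hm mulrBr [p%:R * _]mulrC.
Qed.

End Triple.

(** Normalize [f] by [killing e f = 1], so that [T] represents [be].  Then
    [be T] is the sum of the squares of the [al T], which are real multiples of
    [be T], so that its inverse is a sum of squares. *)
Lemma root_triple be e : e != 0 -> be != 0 -> root_vector be e ->
  exists f T, [/\ root_vector (- be) f, vsval T = [: e, f :] & 0 < (be T : C)].
Proof.
move=> e0 be0 he.
have [y [al [y0 hy ysp y_H killE]]] := root_decomposition phiK psiK g_simple eigen2 H_cartan.
have [i hi] : exists i, killing e (y i) != 0.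
  apply: contrapT => /forallNP hall; move/eqP: e0; apply.
  apply: (killing_nondeg phiK psiK g_simple eigen2) => w; have [c ->] := ysp w.
  rewrite (killing_sumr phiK psiK) big1 // => i _; rewrite (killingZr phiK psiK).
  by have /negP := hall i; rewrite negbK => /eqP ->; rewrite mulr0.
have ali : al i = - be.
  apply/lfunP => h; rewrite !lfunE /=; apply: (mulIf hi).
  have := killing_inv phiK psiK e (vsval h) (y i).
  rewrite hy lieC he -scaleNr (killingZr phiK psiK) => <-.
  by rewrite (killingZl phiK psiK).
pose f := (killing e (y i))^-1 *: y i.
have hf : root_vector (- be) f by apply: root_vector_scale; rewrite -ali.
have kef : killing e f = 1 by rewrite (killingZr phiK psiK) mulVf.
have tH : [: e, f :] \in H.
  apply: (cartan_normalizer H_cartan) => h hH.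
  have := root_vector_lie he hf; rewrite subrr => /(_ (vsproj H h)).
  by rewrite vsprojK // lfunE /= scale0r => h0; rewrite lieC h0 oppr0 mem0v.
pose T := vsproj H [: e, f :].
have hT : vsval T = [: e, f :] by rewrite vsprojK.
have kT (h : subvs_of H) : killing (vsval T) (vsval h) = be h.
  rewrite hT (killing_inv phiK psiK) lieC hf -scaleNr lfunE /= opprK.
  by rewrite (killingZr phiK psiK) kef mulr1.
exists f, T; split=> //.
have /choice[q hq] j : exists q : C, q \is Num.real /\ (al j T : C) = be T * q.
  by have [q q1 q2] := weight_rational be0 he hf hT (y0 j) (hy j); exists q.
(* [killing T T] computed in a basis of root vectors, in two ways. *)
have bE : (be T : C) = be T * (be T * \sum_j q j ^+ 2).
  rewrite -{1}kT killE !mulr_sumr; apply: eq_bigr => j _.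
  by have [_ ->] := hq j; rewrite expr2; ring.
have b0 : (be T : C) != 0.
  apply/eqP => b0; move/eqP: be0; apply; apply/lfunP => h; rewrite lfunE /= -kT.
  suff -> : vsval T = 0 by rewrite (killing0l phiK psiK).
  apply: (simple_center0 g_simple) => w; have [c ->] := ysp w.
  rewrite lie_sumr big1 // => j _; rewrite lieZr hy; have [_ ->] := hq j.
  by rewrite b0 mul0r scale0r scaler0.
have Q1 : be T * \sum_j q j ^+ 2 = 1 by apply: (mulfI b0); rewrite -bE mulr1.
have Q0 : 0 <= \sum_j q j ^+ 2.
  by apply: sumr_ge0 => j _; apply: real_exprn_even_ge0 => //; have [] := hq j.
have Qn0 : \sum_j q j ^+ 2 != 0 by apply/eqP => h; move: Q1; rewrite h mulr0 => /esym/eqP; rewrite oner_eq0.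
have -> : (be T : C) = (\sum_j q j ^+ 2)^-1 by apply: (mulIf Qn0); rewrite Q1 mulVf.
by rewrite invr_gt0 lt_def Qn0.
Qed.

Variable pos : hdual H -> Prop.
Hypothesis pos_system : positive_system pos.

(** If positive roots sum to zero, pairing with the first shows that it has a
    negative inner product with another one, and the sum of these two is again a
    positive root: the list can be shortened forever. *)
Lemma positive_sum_neq0 : no_null_positive_sum pos.
Proof.
move=> s; have [pos_root _ pos_anti pos_add] := pos_system.
have [m] := ubnP (size s); elim: m s => // m IH [|be s] //= sm _ hs.
apply/eqP => s0; have pbe := hs be (mem_head _ _).
have [be0 [e e0 he]] := pos_root be pbe.
have [f [T [hf hT bT]]] := root_triple e0 be0 he.
have [ga [gs gT]] : exists ga, ga \in s /\ ~~ (0 <= (ga T : C)).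
  apply: contrapT => /forallNP h; have : (\sum_(al <- be :: s) al : hdual H) T = 0 :> C.
    by rewrite s0 lfunE.
  have -> : (\sum_(al <- be :: s) al : hdual H) T = \sum_(al <- be :: s) (al T : C).
    by elim: (be :: s) => [|x r IHr]; rewrite ?big_nil ?big_cons lfunE //= IHr.
  rewrite big_cons => /eqP; apply/negP; rewrite gt_eqF // ltr_wpDr //.
  rewrite big_seq; apply: sumr_ge0 => ga gs; apply: contrapT => /negP gT.
  by apply: (h ga).
have pga : pos ga by apply: hs; rewrite inE gs orbT.
have [ga0 [v v0 hv]] := pos_root ga pga.
have ev : [: e, v :] != 0.
  apply/eqP => ev; have [k hk] := primitive_weight be0 hf hT v0 hv ev.
  by move/negP: gT; apply; rewrite hk mulr_ge0 ?divr_ge0 ?ler0n // ltW.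
have bg : pos (be + ga).
  apply: pos_add => //; split; last by exists [: e, v :] => //; exact: root_vector_lie.
  apply/eqP => h; apply: (pos_anti be); split=> //.
  by rewrite (_ : - be = ga) //; apply/eqP; rewrite eq_sym -addr_eq0 addrC h.
have := IH (be + ga :: rem ga s); rewrite big_cons.
have -> : be + ga + \sum_(al <- rem ga s) al = 0.
  by move: s0; rewrite big_cons (big_rem ga gs) /= addrA.
rewrite eqxx => h; suff : false by []; apply: h => //.
  by rewrite /= size_rem // prednK //; case: (s) gs.
move=> al; rewrite inE => /predU1P[-> //|/mem_rem als].
by apply: hs; rewrite inE als orbT.
Qed.

Lemma triangular_decomposition : triangular_decomposable pos.
Proof.
move=> x.
have [_ pos_total _ _] := pos_system.
have [y [al [y0 hy ysp y_H killE]]] := root_decomposition phiK psiK g_simple eigen2 H_cartan.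
have [c xE] := ysp x; exists [seq c i *: y i | i <- enum 'I_n.+1]; split; last first.
  by rewrite big_map big_enum.
move=> _ /mapP[i _ ->]; have [ai|ai] := eqVneq (al i) 0.
  by left; apply: memvZ; exact: y_H.
right; have [|p|p] := pos_total (al i).
- by split=> //; exists (y i).
- by exists (al i) => //; left; exact: root_vector_scale.
by exists (- al i) => //; right; rewrite opprK; exact: root_vector_scale.
Qed.

End RootStrings.

(** A root vector of the normalizing long root and the element representing
    this root supply the eigenvalue 2 on which the nonvanishing of the Killing
    form rests. *)
Theorem simple_lie_triangular (C : numClosedFieldType) (g : lieAlgebra C)
    (H : {vspace g}) (pos : hdual H -> Prop) (form : g -> g -> C) :
  simple_lie g -> cartan_subalgebra H -> positive_system pos ->
  normalized_form H form -> triangular_decomposable pos /\ no_null_positive_sum pos.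
Proof.
move=> g_simple H_cartan pos_system [_ _ _ [_ [al [t [al_root al_t tt]]]]].
have eigen2 : exists t e : g, e != 0 /\ [: t, e :] = 2%:R *: e.
  have [_ [e e0 he]] := al_root; exists (vsval t), e; split=> //.
  by rewrite he -al_t tt.
have : exists n (phi : {linear g -> 'rV[C]_n}) (psi : 'rV[C]_n -> g), cancel phi psi /\ cancel psi phi.
  have [f fl [f' fK f'K]] := VectorInternalTheory.v2r_subproof g.
  pose F : {linear g -> 'rV[C]_(dim g)} := HB.pack f (GRing.isSemilinear.Build C g _ _ f fl).
  by exists (dim g), F, f'.
case=> -[|n] [phi [psi [phiK psiK]]].
  have [t' [e [e0 _]]] := eigen2; move/eqP: e0; case.
  by apply: (can_inj phiK); apply/rowP => -[].
split; first exact: (triangular_decomposition phiK psiK g_simple eigen2 H_cartan pos_system).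
exact: (positive_sum_neq0 phiK psiK g_simple eigen2 H_cartan pos_system).
Qed.

(** * Highest weight modules of the Virasoro-affine algebra *)

(** The operators of a module are bare functions with a proof of linearity;
    these are the usual consequences in that form. *)
Section BareLinear.
Variables (C : pzRingType) (U W : lmodType C) (f : U -> W).
Hypothesis fl : linear f.
Lemma blinD u v : f (u + v) = f u + f v.
Proof. by have := fl 1 u v; rewrite !scale1r. Qed.
Lemma blin0 : f 0 = 0.
Proof. by apply: (addrI (f 0)); rewrite -blinD !addr0. Qed.
Lemma blinZ a u : f (a *: u) = a *: f u.
Proof. by have := fl a u 0; rewrite !addr0 blin0 addr0. Qed.
Lemma blinB u v : f (u - v) = f u - f v.
Proof. by rewrite -scaleN1r blinD blinZ scaleN1r. Qed.
Lemma blin_sum (I : Type) (s : seq I) (P : pred I) F :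
  f (\sum_(i <- s | P i) F i) = \sum_(i <- s | P i) f (F i).
Proof. exact: (big_morph f blinD blin0). Qed.
End BareLinear.

(** Induction on [s]: for the weight [xi] of its first member, with [xi i]
    different from [chi i], the operator [op i - xi i] kills this member and
    multiplies [v] by a nonzero scalar. *)
Lemma distinct_weights (C : fieldType) (W : lmodType C) (I : Type) (op : I -> W -> W)
    (chi : I -> C) (s : seq W) v :
  (forall i, linear (op i)) -> (forall i, op i v = chi i *: v) ->
  (forall x, x \in s -> exists xi : I -> C,
     (forall i, op i x = xi i *: x) /\ exists i, xi i <> chi i) ->
  v = \sum_(x <- s) x -> v = 0.
Proof.
move=> opl; have [m] := ubnP (size s).
elim: m s v => // m IH [|y s] v /= sm hv hs; first by rewrite big_nil.
rewrite big_cons => vE; have [xi [hxi [i xi_chi]]] := hs y (mem_head _ _).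
have d0 : chi i - xi i != 0 by rewrite subr_eq0; apply/eqP => h; apply: xi_chi.
suff : (chi i - xi i) *: v = 0.
  by move/eqP; rewrite scaler_eq0 (negPf d0) => /eqP.
have opE x z : op i x = z *: x -> op i x - xi i *: x = (z - xi i) *: x.
  by move=> ->; rewrite scalerBl.
pose s' := [seq op i x - xi i *: x | x <- s].
have hs' x : x \in s -> exists ki : I -> C,
    [/\ forall j, op j x = ki j *: x & exists j, ki j <> chi j].
  by move=> xs; have [ki [h1 h2]] := hs x (mem_behead (s := y :: s) xs); exists ki.
apply: (IH s'); first by rewrite size_map.
- by move=> j; rewrite (blinZ (opl j)) hv !scalerA mulrC.
- move=> _ /mapP[x /hs' [ki [kE kne]] ->]; exists ki; split=> // j.
  by rewrite (opE _ _ (kE i)) (blinZ (opl j)) kE !scalerA mulrC.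
rewrite -(opE v _ (hv i)) {1 2}vE (blinD (opl i)) hxi scalerDr opprD addrACA subrr add0r.
by rewrite big_map sumrB -scaler_sumr (blin_sum (opl i)).
Qed.

Section Modes.
Variables (C : numFieldType) (g : lieAlgebra C) (form : g -> g -> C) (V : fmodule form).
Implicit Types (v : V) (m n : int).

Definition letter := (option (fdot g) * int)%type.
Definition mop (l : letter) : V -> V :=
  match l.1 with None => fmL l.2 | Some x => fmX x l.2 end.
Definition wop (w : seq letter) v : V := foldr mop v w.
Definition wdeg (w : seq letter) : int := \sum_(l <- w) l.2.

Lemma mop_linear l : linear (mop l).
Proof. by case: l => [[x|] m] /=; [exact: fmX_linear|exact: fmL_linear]. Qed.
Lemma wop_linear w : linear (wop w).
Proof. by elim: w => [//|l w IH] a u v /=; rewrite IH mop_linear. Qed.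
Lemma wop_cat w1 w2 v : wop (w1 ++ w2) v = wop w1 (wop w2 v).
Proof. exact: foldr_cat. Qed.
Lemma wdeg_cat w1 w2 : wdeg (w1 ++ w2) = wdeg w1 + wdeg w2.
Proof. exact: big_cat. Qed.
Lemma wdeg_cons l w : wdeg (l :: w) = l.2 + wdeg w.
Proof. exact: big_cons. Qed.
Lemma wdeg_nil : wdeg nil = 0.
Proof. exact: big_nil. Qed.

Lemma mop_k0 l v : fmk0 (mop l v) = mop l (fmk0 v).
Proof. by case: l => [[x|] m]; [exact: fmk0X|exact: fmk0L]. Qed.
Lemma mop_kv l v : fmkv (mop l v) = mop l (fmkv v).
Proof. by case: l => [[x|] m]; [exact: fmkvX|exact: fmkvL]. Qed.
Lemma wop_k0 w v : fmk0 (wop w v) = wop w (fmk0 v).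
Proof. by elim: w => [//|l w IH] /=; rewrite mop_k0 IH. Qed.
Lemma wop_kv w v : fmkv (wop w v) = wop w (fmkv v).
Proof. by elim: w => [//|l w IH] /=; rewrite mop_kv IH. Qed.

Lemma fmX0 m v : fmX (0 : fdot g) m v = 0.
Proof. exact: (blin0 (fmX_linearl m v)). Qed.

(** The shape of all the brackets at once: one mode of the total degree, and
    a central term in degree zero. *)
Lemma mop_comm l l' : exists (a : C) y (b d : C), forall v,
  mop l (mop l' v) = mop l' (mop l v) + a *: mop (y, l.2 + l'.2) v
    + (if l.2 + l'.2 == 0 then b *: fmk0 v + d *: fmkv v else 0).
Proof.
case: l l' => [[x|] m] [[y|] n] /=.
- exists 1, (Some (fdot_lieb x y)), (m%:~R * fdot_form form x y), 0 => v.
  by rewrite scale1r scale0r addr0 -addrA -fmXX addrC subrK.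
- exists m%:~R, (Some x), 0, 0 => v; rewrite !scale0r !addr0 if_same addr0.
  by rewrite /mop /= -[m%:~R]opprK scaleNr [m + n]addrC -fmLX opprB addrCA subrr addr0.
- exists (- n%:~R), (Some y), 0, 0 => v; rewrite !scale0r !addr0 if_same addr0.
  by rewrite -fmLX addrC subrK.
exists (m - n)%:~R, None, 0, ((m ^+ 3 - m)%:~R / 12%:R) => v.
by rewrite scale0r add0r -addrA -fmLL addrC subrK.
Qed.

(** The finiteness behind all vertex operators: an infinite sum of words of
    modes is finite on a vector killed by the words of large degree. *)
Definition bd (B : int) v := forall w, B < wdeg w -> wop w v = 0.

Lemma bd_mop B l v : bd B v -> bd (B - l.2) (mop l v).
Proof.
move=> h w hw; have := h (rcons w l); rewrite -cats1 wop_cat wdeg_cat wdeg_cons wdeg_nil.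
by apply; rewrite addr0 -ltrBlDr.
Qed.
Lemma bd_le B B' v : B <= B' -> bd B v -> bd B' v.
Proof. by move=> BB h w hw; apply: h; exact: le_lt_trans hw. Qed.
Lemma bd_lin B a u v : bd B u -> bd B v -> bd B (a *: u + v).
Proof. by move=> hu hv w hw; rewrite wop_linear hu // hv // scaler0 addr0. Qed.
Lemma bd0 B : bd B 0.
Proof. by move=> w _; rewrite (blin0 (wop_linear w)). Qed.
Lemma bd_scale B a v : bd B v -> bd B (a *: v).
Proof. by move=> h; rewrite -[a *: v]addr0; apply: bd_lin => //; exact: bd0. Qed.
Lemma bd_sum B (I : Type) (s : seq I) (P : pred I) F :
  (forall i, P i -> bd B (F i)) -> bd B (\sum_(i <- s | P i) F i).
Proof.
move=> h; apply: (big_ind (bd B)) => //; first exact: bd0.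
by move=> u v hu hv; rewrite -[u]scale1r; exact: bd_lin.
Qed.
Lemma bd_lt0 B v : B < 0 -> bd B v -> v = 0.
Proof. by move=> B0 h; apply: (h nil); rewrite wdeg_nil. Qed.

(** A letter of positive degree is moved to the right end of the word, where
    it kills [v]; the commutators give shorter words of the same degree. *)
Lemma hw_bounded v (c : C) (d : C) : fmk0 v = c *: v -> fmkv v = d *: v ->
  (forall l : letter, 0 < l.2 -> mop l v = 0) -> bd 0 v.
Proof.
move=> hk0 hkv hpos w; have [p] := ubnP (size w); elim: p w => // p IH w wp w0.
have key w1 : forall u l, 0 < l.2 -> (size u + size w1 < p)%N -> 0 < wdeg (u ++ l :: w1) ->
    wop (u ++ l :: w1) v = 0.
  elim: w1 => [|l1 w2 IHw] u l l0 sz dg.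
    by rewrite wop_cat /= hpos // (blin0 (wop_linear u)).
  have [a [y [b [d' hc]]]] := mop_comm l l1.
  rewrite wop_cat /= hc !(blinD (wop_linear u)) (blinZ (wop_linear u)).
  have := IHw (rcons u l1) l l0; rewrite -cats1 -catA !wop_cat /= => ->; first 1 last.
  - by move: sz; rewrite size_cat /=; lia.
  - by move: dg; rewrite !wdeg_cat !wdeg_cons [l.2 + (l1.2 + _)]addrCA.
  have := IH (u ++ (y, l.2 + l1.2) :: w2); rewrite wop_cat /= => ->; first 1 last.
  - by rewrite size_cat.
  - by move: dg; rewrite !wdeg_cat !wdeg_cons /= ?addrA.
  rewrite scaler0 !add0r; case: eqP => [e|_]; last exact: (blin0 (wop_linear u)).
  rewrite wop_k0 wop_kv hk0 hkv !(blinZ (wop_linear w2)) !scalerA -scalerDl.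
  rewrite (blinZ (wop_linear u)) -wop_cat IH ?scaler0 //.
  - by rewrite size_cat (leq_trans _ sz) //= addnS ltnS leqnSn.
  - by move: dg; rewrite !wdeg_cat !wdeg_cons /= [l.2 + (l1.2 + _)]addrA e add0r.
case: w wp w0 => [|l w] wp w0; first by rewrite wdeg_nil in w0.
have [w'0|w'0] := ltP 0 (wdeg w).
  by rewrite /= IH // (blin0 (mop_linear l)).
apply: (key w nil) => //; by rewrite ltNge; apply/negP => l0; move: w0; rewrite wdeg_cons ltNge; apply/negP; rewrite negbK -[0]addr0 lerD.
Qed.

Definition fstable (W : V -> Prop) := submodule (@fact _ _ _ V) W.

Lemma fstable_letters (W : V -> Prop) : subspace W ->
  (forall l v, W v -> W (mop l v)) -> (forall v, W v -> W (fmk0 v)) ->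
  (forall v, W v -> W (fmkv v)) -> fstable W.
Proof.
move=> Ws Wl Wk0 Wkv; split=> // t v Wv; case: t => [m|x m||] /=.
- exact: (Wl (None, m)).
- exact: (Wl (Some x, m)).
- exact: Wk0.
- exact: Wkv.
Qed.

Hypothesis V_irr : irreducible_submodule (@fact _ _ _ V) (fun _ => True).

Lemma irr_full (W : V -> Prop) v : fstable W -> W v -> v <> 0 -> forall u, W u.
Proof.
move=> Wst Wv v0 u; have [_ _ /(_ W Wst (fun _ _ => I))[h|h]] := V_irr.
  by case: v0; exact: h.
exact: h.
Qed.

(** Schur's lemma: the eigenspace of [z] containing [v] is a submodule. *)
Lemma irr_scalar (z : V -> V) (a : C) v : linear z ->
  (forall l u, z (mop l u) = mop l (z u)) -> (forall u, z (fmk0 u) = fmk0 (z u)) ->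
  (forall u, z (fmkv u) = fmkv (z u)) ->
  v <> 0 -> z v = a *: v -> forall u, z u = a *: u.
Proof.
move=> zl zmop zk0 zkv v0 zv; apply: (irr_full _ zv v0).
apply: fstable_letters.
- split=> [|b u w hu hw]; first by rewrite (blin0 zl) scaler0.
  by rewrite zl hu hw scalerDr !scalerA mulrC.
- by move=> l u hu; rewrite zmop hu (blinZ (mop_linear l)).
- by move=> u hu; rewrite zk0 hu (blinZ (@fmk0_linear _ _ _ V)).
- by move=> u hu; rewrite zkv hu (blinZ (@fmkv_linear _ _ _ V)).
Qed.

End Modes.

Section HighestWeight.
Variables (C : numFieldType) (g : lieAlgebra C) (H : {vspace g}).
Variables (pos : hdual H -> Prop) (form : g -> g -> C).
Hypothesis triangular : triangular_decomposable pos.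
Hypothesis pos_sum : no_null_positive_sum pos.

Section Vector.
Variables (V : fmodule form) (eta : fweight H) (Om : V).
Hypothesis V_irr : irreducible_submodule (@fact _ _ _ V) (fun _ => True).
Hypothesis Om_hw : highest_weight_vector pos eta Om.
Implicit Types (v : V).

Lemma f0act_linear (u : f0car H) : linear (@f0act _ _ _ _ V u).
Proof.
case: u => [[[[h b0] e0] [b1 e1]] bv] a v w.
rewrite /f0act fmX_linear fmk0_linear fmkv_linear fmL_linear !scalerDr.
rewrite [RHS]addrACA; congr (_ + _); last by rewrite !scalerA mulrC.
rewrite [RHS]addrACA; congr (_ + _); last by rewrite opprD scalerN !scalerA mulrC.
by rewrite [RHS]addrACA !scalerA [a * b0]mulrC.
Qed.

Lemma hw_neq0 : Om <> 0. Proof. by case: Om_hw => /eqP. Qed.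
Lemma hw_f0 (u : f0car H) : f0act u Om = (eta u : C) *: Om. Proof. by case: Om_hw. Qed.

Lemma hw_pos (l : letter g) : 0 < l.2 -> mop l Om = 0.
Proof.
by case: Om_hw => _ h _ _; case: l => [[x|] m] /= m0; have [h1 h2] := h m m0; rewrite /mop /=.
Qed.

Lemma f0_X x b e v : f0act (((x, 0, 0), (b, e), 0) : f0car H) v = fmX (vsval x, b, e) 0 v.
Proof. by rewrite /f0act !scale0r addr0 subr0 addr0. Qed.
Lemma f0_L v : f0act (((0, 0, - 1), (0, 0), 0) : f0car H) v = fmL 0 v.
Proof.
rewrite /f0act !scale0r !addr0 scaleN1r opprK -[RHS]add0r; congr (_ + _).
by rewrite linear0; exact: fmX0.
Qed.
Lemma f0_k0 v : f0act (((0, 1, 0), (0, 0), 0) : f0car H) v = fmk0 v.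
Proof.
rewrite /f0act !scale0r subr0 !addr0 scale1r -[RHS]add0r; congr (_ + _).
by rewrite linear0; exact: fmX0.
Qed.
Lemma f0_kv v : f0act (((0, 0, 0), (0, 0), 1) : f0car H) v = fmkv v.
Proof.
rewrite /f0act !scale0r subr0 !addr0 scale1r -[RHS]add0r; congr (_ + _).
by rewrite linear0; exact: fmX0.
Qed.

Lemma hw_k0 v : fmk0 v = (eta ((0, 1, 0), (0, 0), 0) : C) *: v.
Proof.
apply: (irr_scalar V_irr (fmk0_linear (f := V)) _ _ _ hw_neq0) => [l u|u|u|].
- exact: mop_k0.
- by [].
- exact: fmk0kv.
by rewrite -f0_k0 hw_f0.
Qed.

Lemma hw_kv v : fmkv v = (eta ((0, 0, 0), (0, 0), 1) : C) *: v.
Proof.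
apply: (irr_scalar V_irr (fmkv_linear (f := V)) _ _ _ hw_neq0) => [l u|u|u|].
- exact: mop_kv.
- by rewrite fmk0kv.
- by [].
by rewrite -f0_kv hw_f0.
Qed.

Lemma hw_center (b e : C) v : fmX ((0, b, e) : fdot g) 0 v = (eta ((0, 0, 0), (b, e), 0) : C) *: v.
Proof.
apply: (irr_scalar V_irr (fmX_linear _ 0) _ _ _ hw_neq0) => [[[x|] m] u|u|u|].
- rewrite /mop /=; apply/eqP; rewrite -subr_eq0 fmXX add0r mul0r scale0r if_same addr0.
  apply/eqP; rewrite (_ : fdot_lieb _ _ = 0) ?fmX0 //.
  by rewrite /fdot_lieb /fdot_in /= (blin0 (lieb_linearl _)).
- by rewrite /mop /=; apply/eqP; rewrite eq_sym -subr_eq0 fmLX oppr0 scale0r.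
- by rewrite fmk0X.
- by rewrite fmkvX.
by rewrite -hw_f0 f0_X linear0.
Qed.

Lemma hw_bd v : exists B, bd B v.
Proof.
move: v; apply: (irr_full V_irr (v := Om)); last exact: hw_neq0.
  apply: fstable_letters.
  - split=> [|a u v [B hB] [B' hB']]; first by exists 0; exact: bd0.
    by exists (Num.max B B'); apply: bd_lin; [apply: bd_le hB|apply: bd_le hB']; rewrite le_max lexx ?orbT.
  - by move=> l v [B hB]; exists (B - l.2); exact: bd_mop.
  - by move=> v [B hB]; exists B => w hw; rewrite -wop_k0 hB // (blin0 (@fmk0_linear _ _ _ V)).
  - by move=> v [B hB]; exists B => w hw; rewrite -wop_kv hB // (blin0 (@fmkv_linear _ _ _ V)).
exists 0; apply: hw_bounded; [exact: hw_k0|exact: hw_kv|exact: hw_pos].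
Qed.

(** The generators of the negative part of the triangular decomposition. *)
Definition negl (l : letter g) := l.2 < 0 \/
  exists2 al, pos al & exists2 x, root_vector (- al) x & l = (Some (fdot_in x), 0).

Definition negw (w : seq (letter g)) := forall l, l \in w -> negl l.

Inductive wspan : V -> Prop :=
  | wspan0 : wspan 0
  | wspan_add (c : C) w u : negw w -> wspan u -> wspan (c *: wop w Om + u).

Lemma wspanD u v : wspan u -> wspan v -> wspan (u + v).
Proof.
by move=> hu hv; elim: hu => [|c w u' hw _ IH]; rewrite ?add0r // -addrA; exact: wspan_add.
Qed.
Lemma wspanZ a v : wspan v -> wspan (a *: v).
Proof.
elim=> [|c w u hw _ IH]; first by rewrite scaler0; exact: wspan0.
by rewrite scalerDr scalerA; exact: wspan_add.
Qed.
Lemma wspan_wop w : negw w -> wspan (wop w Om).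
Proof. by move=> hw; rewrite -[wop w Om]addr0 -[wop w Om]scale1r; apply: wspan_add => //; exact: wspan0. Qed.
Lemma wspan_negl l v : negl l -> wspan v -> wspan (mop l v).
Proof.
move=> hl; elim=> [|c w u hw _ IH]; first by rewrite (blin0 (@mop_linear _ _ _ V l)); exact: wspan0.
rewrite (@mop_linear _ _ _ V l); apply: (wspan_add c (w := l :: w)) IH => l'.
by rewrite inE => /predU1P[->|/hw].
Qed.

Lemma wspan_Om_letter l : wspan (mop l Om).
Proof.
have Om_span c : wspan (c *: Om) by apply: wspanZ; exact: (wspan_wop (w := nil)).
case: (ltgtP l.2 0) => [l0|l0|l0].
- by apply: (wspan_wop (w := l :: nil)) => l'; rewrite inE => /eqP ->; left.
- by rewrite hw_pos //; exact: wspan0.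
case: l l0 => [[x|] m] /= ->; last by rewrite /mop /= -f0_L hw_f0; exact: Om_span.
case: x => [[x b] e]; rewrite /mop /=.
have -> : fmX ((x, b, e) : fdot g) 0 Om = fmX (fdot_in x) 0 Om + fmX ((0, b, e) : fdot g) 0 Om.
  have := fmX_linearl 0 Om 1 (fdot_in x) ((0, b, e) : fdot g); rewrite !scale1r => <-.
  congr (fmX _ _ _); rewrite /fdot_in; congr (_, _, _); by rewrite ?addr0 ?add0r.
apply: wspanD; last by rewrite hw_center; exact: Om_span.
have [s [hs ->]] := triangular x.
have -> : fmX (fdot_in (\sum_(y <- s) y)) 0 Om = \sum_(y <- s) fmX (fdot_in y) 0 Om.
  elim: s {hs} => [|y s IH]; first by rewrite !big_nil; exact: fmX0.
  rewrite !big_cons -IH.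
  have := fmX_linearl 0 Om 1 (fdot_in y) (fdot_in (\sum_(y <- s) y)); rewrite !scale1r => <-.
  by congr (fmX _ _ _); rewrite /fdot_in; congr (_, _, _); rewrite ?addr0.
rewrite big_seq; apply: (big_ind wspan); [exact: wspan0|exact: wspanD|].
move=> y /hs[yH|[al pal [hy|hy]]].
- by have := hw_f0 ((vsproj H y, 0, 0), (0, 0), 0); rewrite f0_X vsprojK // => ->; exact: Om_span.
- case: Om_hw => _ _ h _; have -> : fmX (fdot_in y) 0 Om = 0; last exact: wspan0.
  apply: h; exists (y :: nil); last by rewrite big_seq1.
  by move=> z; rewrite inE => /eqP ->; exists al.
apply: (wspan_negl (l := (Some (fdot_in y), 0))).
  by right; exists al => //; exists y.
exact: (wspan_wop (w := nil)).
Qed.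

(** Any letter is moved to the right until it reaches [Om]; the commutators
    are single letters acting on shorter words. *)
Lemma wspan_letter l v : wspan v -> wspan (mop l v).
Proof.
elim=> [|c w u hw _ IH]; first by rewrite (blin0 (@mop_linear _ _ _ V l)); exact: wspan0.
rewrite (@mop_linear _ _ _ V l); apply: wspanD => //; apply: wspanZ => {u IH c}.
elim: w l hw => [|l1 w IH] l hw; first exact: wspan_Om_letter.
have hw' : negw w by move=> l' lw; apply: hw; rewrite inE lw orbT.
have [a [y [b [d hc]]]] := @mop_comm _ _ _ V l l1.
rewrite /= hc; apply: wspanD; first apply: wspanD.
- by apply: wspan_negl; [apply: hw; rewrite mem_head|exact: IH].
- by apply: wspanZ; exact: IH.
case: eqP => _; last exact: wspan0.
by rewrite hw_k0 hw_kv !scalerA -scalerDl; apply: wspanZ; exact: wspan_wop.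
Qed.

Lemma hw_wspan v : wspan v.
Proof.
move: v; apply: (irr_full V_irr (v := Om)); last exact: hw_neq0.
  apply: fstable_letters.
  - split=> [|a u v hu hv]; first exact: wspan0.
    by apply: wspanD => //; exact: wspanZ.
  - exact: wspan_letter.
  - by move=> v hv; rewrite hw_k0; exact: wspanZ.
  - by move=> v hv; rewrite hw_kv; exact: wspanZ.
exact: (wspan_wop (w := nil)).
Qed.

(** The image of the negative part, a complement of the line of [Om]. *)
Inductive nspan : V -> Prop :=
  | nspan0 : nspan 0
  | nspan_add l v u : negl l -> nspan u -> nspan (mop l v + u).

Lemma nspanD u v : nspan u -> nspan v -> nspan (u + v).
Proof.
by move=> hu hv; elim: hu => [|l w u' hl _ IH]; rewrite ?add0r // -addrA; exact: nspan_add.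
Qed.
Lemma nspan_mop l v : negl l -> nspan (mop l v).
Proof. by move=> hl; rewrite -[mop l v]addr0; apply: nspan_add => //; exact: nspan0. Qed.
Lemma nspanZ a v : nspan v -> nspan (a *: v).
Proof.
elim=> [|l w u hl _ IH]; first by rewrite scaler0; exact: nspan0.
by rewrite scalerDr -(blinZ (@mop_linear _ _ _ V l)); exact: nspan_add.
Qed.

Lemma hw_split v : exists t n, nspan n /\ v = t *: Om + n.
Proof.
elim: (hw_wspan v) => [|c w u hw _ [t [n [hn ->]]]].
  by exists 0, 0; rewrite scale0r addr0; split=> //; exact: nspan0.
case: w hw => [|l w] hw.
  by exists (c + t), n; rewrite scalerDl addrA.
exists t, (c *: wop (l :: w) Om + n); rewrite addrCA; split=> //.
by apply: nspanD => //; apply: nspanZ; apply: nspan_mop; apply: hw; rewrite mem_head.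
Qed.

(** A negative word of degree zero consists of root vectors for opposites of
    positive roots, so that [H] acts on it by a weight lower by their sum. *)
Lemma negw_deg w : negw w -> wdeg w <= 0 /\ (wdeg w = 0 ->
  exists s : seq (hdual H), [/\ size s = size w, forall al, al \in s -> pos al &
    forall h : subvs_of H, fmX (fdot_in (vsval h)) 0 (wop w Om) =
      ((eta ((h, 0, 0), (0, 0), 0) : C) - (\sum_(al <- s) al : hdual H) h) *: wop w Om]).
Proof.
elim: w => [|l w IH] hw.
  rewrite wdeg_nil; split=> // _; exists nil; split=> // h.
  by rewrite big_nil lfunE /= subr0 -hw_f0 f0_X.
have {IH}[|d0 IH] := IH; first by move=> l' lw; apply: hw; rewrite inE lw orbT.
rewrite wdeg_cons; have [l0|[al pal [x hx ->]]] := hw l (mem_head _ _).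
  by split; lia.
rewrite /= add0r; split=> // /IH [s [ssz sp sE]]; exists (al :: s); split=> [|be|h].
- by rewrite /= ssz.
- by rewrite inE => /predU1P[->|/sp].
have /eqP := fmXX (fdot_in (vsval h)) (fdot_in x) 0 0 (wop w Om).
rewrite subr_eq add0r eqxx mul0r scale0r addr0 => /eqP; rewrite /mop /= => ->; rewrite sE.
rewrite (blinZ (fmX_linear (fdot_in x) 0)) big_cons.
have -> : fdot_lieb (fdot_in (vsval h)) (fdot_in x) = - (al h : C) *: fdot_in x.
  rewrite /fdot_lieb /= hx lfunE /=; congr (_, _, _); by rewrite scaler0.
rewrite (blinZ (fmX_linearl 0 _)) -scalerDl; congr (_ *: _).
by rewrite lfunE /= opprD addrCA.
Qed.

Lemma L0_letter l v (e : C) : fmL 0 v = e *: v -> fmL 0 (mop l v) = (e - l.2%:~R) *: mop l v.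
Proof.
move=> hv; case: l => [[x|] m] /=; rewrite /mop /=.
  have /eqP := fmLX x 0 m v; rewrite subr_eq add0r hv => /eqP ->.
  by rewrite (blinZ (fmX_linear x m)) -scalerDl addrC.
have /eqP := fmLL 0 m v; rewrite subr_eq add0r hv => /eqP ->.
rewrite sub0r rmorphN /= (blinZ (fmL_linear m)) oppr0 mul0r scale0r if_same addr0.
by rewrite add0r -scalerDl addrC.
Qed.

Lemma L0_word w : fmL 0 (wop w Om) =
  ((eta ((0, 0, - 1), (0, 0), 0) : C) - (wdeg w)%:~R) *: wop w Om.
Proof.
elim: w => [|l w IH]; first by rewrite wdeg_nil subr0 -hw_f0 f0_L.
by rewrite /= (L0_letter _ IH) wdeg_cons rmorphD opprD addrA addrAC.
Qed.

(** Compare weights in an expression of [Om] by nonempty negative words: those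
    of negative degree differ from [Om] in the eigenvalue of [L(0)], those of
    degree zero in the weight under [H], by a nonempty sum of positive roots. *)
Lemma Om_notin_nspan : ~ nspan Om.
Proof.
move=> hN.
have [s [hs sE]] : exists s : seq (C * seq (letter g)),
    (forall p, p \in s -> negw p.2 /\ p.2 <> nil) /\ Om = \sum_(p <- s) p.1 *: wop p.2 Om.
  move: {1 2}Om hN => n; elim=> [|l v u hl _ [s [hs ->]]]; first by exists nil; rewrite big_nil.
  have [r [hr ->]] : exists r : seq (C * seq (letter g)),
      (forall p, p \in r -> negw p.2 /\ p.2 <> nil) /\ mop l v = \sum_(p <- r) p.1 *: wop p.2 Om.
    elim: (hw_wspan v) => [|c w u' hw _ [r [hr rE]]].
      by exists nil; rewrite big_nil (blin0 (@mop_linear _ _ _ V l)).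
    exists ((c, l :: w) :: r); split; last by rewrite big_cons (@mop_linear _ _ _ V l) rE.
    move=> p; rewrite inE => /predU1P[->|/hr //] /=; split=> // l'.
    by rewrite inE => /predU1P[->|/hw].
  exists (r ++ s); split; last by rewrite big_cat.
  by move=> p; rewrite mem_cat => /orP[/hr|/hs].
pose s0 := [seq p <- s | wdeg p.2 == 0]; pose s1 := [seq p <- s | wdeg p.2 != 0].
have sE' : Om = \sum_(p <- s0) p.1 *: wop p.2 Om + \sum_(p <- s1) p.1 *: wop p.2 Om.
  by rewrite {1}sE !big_filter [LHS](bigID (fun p => wdeg p.2 == 0)).
have d1 : Om - \sum_(p <- s0) p.1 *: wop p.2 Om = 0.
  apply: (@distinct_weights C V unit (fun=> fmL 0) (fun=> eta ((0, 0, - 1), (0, 0), 0))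
            [seq p.1 *: wop p.2 Om | p <- s1]).
  - by move=> _; exact: fmL_linear.
  - move=> _; rewrite (blinB (fmL_linear 0)) (blin_sum (fmL_linear 0)).
    rewrite -f0_L hw_f0 scalerBr; congr (_ - _); rewrite scaler_sumr big_seq [RHS]big_seq.
    apply: eq_bigr => p; rewrite mem_filter => /andP[/eqP p0 _].
    by rewrite (blinZ (fmL_linear 0)) L0_word p0 subr0 !scalerA mulrC.
  - move=> _ /mapP[p + ->]; rewrite mem_filter => /andP[p0 ps].
    exists (fun=> (eta ((0, 0, - 1), (0, 0), 0) : C) - (wdeg p.2)%:~R); split=> [_|].
      by rewrite (blinZ (fmL_linear 0)) L0_word !scalerA mulrC.
    exists tt => /eqP; rewrite subr_eq -[X in X == _]addr0 (inj_eq (addrI _)) eq_sym intr_eq0.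
    by rewrite (negPf p0).
  by rewrite big_map {1}sE' addrAC subrr add0r.
apply: hw_neq0.
apply: (@distinct_weights C V (subvs_of H) (fun h => fmX (fdot_in (vsval h)) 0)
          (fun h => eta ((h, 0, 0), (0, 0), 0)) [seq p.1 *: wop p.2 Om | p <- s0]).
- by move=> h; exact: fmX_linear.
- by move=> h; rewrite -hw_f0 f0_X.
- move=> _ /mapP[p + ->]; rewrite mem_filter => /andP[/eqP p0 /hs[pn pnil]].
  have [_ /(_ p0)[r [rsz rp rE]]] := negw_deg pn.
  exists (fun h => (eta ((h, 0, 0), (0, 0), 0) : C) - (\sum_(al <- r) al : hdual H) h).
  split=> [h|].
    by rewrite (blinZ (fmX_linear _ 0)) rE !scalerA mulrC.
  have /eqP r0 : \sum_(al <- r) al != 0.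
    by apply: pos_sum => //; apply/eqP => r0; apply: pnil; apply: size0nil; rewrite -rsz r0.
  apply: contrapT => /forallNP hh; apply: r0; apply/lfunP => h; rewrite [RHS]lfunE /=.
  have /contrapT/eqP := hh h; rewrite subr_eq -[X in X == _]addr0 (inj_eq (addrI _)).
  by rewrite eq_sym => /eqP.
by rewrite big_map; apply/eqP; rewrite -subr_eq0 d1.
Qed.

Lemma nspan_f0 (u : f0car H) n : nspan n -> nspan (f0act u n).
Proof.
have key x b e v l : x \in H -> negl l -> nspan (fmX ((x, b, e) : fdot g) 0 (mop l v)).
  move=> xH [l0|[al pal [y hy ->]]].
    have [a [z [b' [d' hc]]]] := @mop_comm _ _ _ V (Some ((x, b, e) : fdot g), 0) l.
    rewrite -[fmX _ _ _]/(mop (Some ((x, b, e) : fdot g), 0) (mop l v)) hc /=.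
    rewrite add0r lt_eqF //= addr0; apply: nspanD; last apply: nspanZ.
      by apply: nspan_mop; left.
    by apply: nspan_mop; left.
  have /eqP := fmXX ((x, b, e) : fdot g) (fdot_in y) 0 0 v.
  rewrite subr_eq add0r eqxx mul0r scale0r addr0 => /eqP; rewrite /mop /= => ->.
  have nl : negl (Some (fdot_in y), 0) by right; exists al => //; exists y.
  apply: nspanD; last exact: (nspan_mop _ nl).
  have -> : fdot_lieb ((x, b, e) : fdot g) (fdot_in y) = - (al (vsproj H x) : C) *: fdot_in y.
    rewrite /fdot_lieb /=; have := hy (vsproj H x); rewrite vsprojK // => ->.
    rewrite lfunE /=; congr (_, _, _); by rewrite scaler0.
  rewrite (blinZ (fmX_linearl 0 _)); apply: nspanZ; exact: (nspan_mop _ nl).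
have keyL v l : negl l -> nspan (fmL 0 (mop l v)).
  move=> nl; have [l0|[al pal [y hy le]]] := nl.
    have [a [z [b' [d' hc]]]] := @mop_comm _ _ _ V (None, 0) l.
    rewrite -[fmL _ _]/(mop (None, 0) (mop l v)) hc /=.
    rewrite add0r lt_eqF //= addr0; apply: nspanD; last apply: nspanZ.
      exact: nspan_mop.
    by apply: nspan_mop; left.
  have /eqP := fmLX (fdot_in y) 0 0 v; rewrite oppr0 scale0r subr_eq0 le /mop /= => /eqP ->.
  by apply: (nspan_mop (l := (Some (fdot_in y), 0))); rewrite -le.
elim=> [|l v w hl _ IH]; first by rewrite (blin0 (f0act_linear u)); exact: nspan0.
rewrite (blinD (f0act_linear u)); apply: nspanD => // {IH}.
case: u => [[[[h b0] e0] [b1 e1]] bv]; rewrite /f0act.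
apply: nspanD; last by rewrite hw_kv scalerA; apply: nspanZ; exact: nspan_mop.
apply: nspanD; last by rewrite -scaleNr; apply: nspanZ; exact: keyL.
apply: nspanD; last by rewrite hw_k0 scalerA; apply: nspanZ; exact: nspan_mop.
by apply: key => //; exact: subvsP.
Qed.

(** The coefficient of [Om], which [Om_notin_nspan] makes well defined. *)
Lemma vacuum_functional : exists phi : V -> C^o,
  [/\ linear phi, phi Om = 1, forall l v, negl l -> phi (mop l v) = 0
    & forall (u : f0car H) v, phi (f0act u v) = (eta u : C) * phi v].
Proof.
have /choice[phi /choice[nn hphi]] := hw_split.
have uniq v (t : C) n : nspan n -> v = t *: Om + n -> phi v = t.
  move=> hn vE; have [hnn E] := hphi v.
  have e : (phi v - t) *: Om = n - nn v.
    have p1 := canRL (addrK _) (esym E); have t1 := canRL (addrK _) (esym vE).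
    by rewrite scalerBl p1 t1 opprB addrC addrA subrK.
  apply/eqP; rewrite -subr_eq0; apply: contrapT => /negP d0; apply: Om_notin_nspan.
  have -> : Om = (phi v - t)^-1 *: (n - nn v) by rewrite -e scalerA mulVf // scale1r.
  by apply: nspanZ; apply: nspanD => //; rewrite -scaleN1r; exact: nspanZ.
exists phi; split.
- move=> a u v; have [hu uE] := hphi u; have [hv vE] := hphi v.
  apply: (uniq _ _ (a *: nn u + nn v)); first by apply: nspanD => //; exact: nspanZ.
  by rewrite {1}uE {1}vE scalerDr addrACA scalerA -scalerDl.
- by apply: (uniq _ _ 0); [exact: nspan0|rewrite scale1r addr0].
- by move=> l v hl; apply: (uniq _ _ (mop l v)); [exact: nspan_mop|rewrite scale0r add0r].
move=> u v; have [hv vE] := hphi v; apply: (uniq _ _ (f0act u (nn v))).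
  exact: nspan_f0.
by rewrite {1}vE (blinD (f0act_linear u)) (blinZ (f0act_linear u)) hw_f0 scalerA mulrC.
Qed.

End Vector.

(** The vacuum functional does not vanish on any highest weight vector [w]: as
    [V] is spanned by negative words on [w], it would vanish on [V].  Hence it
    detects both the weight and the multiple of [Om]. *)
Lemma hw_unique (V : fmodule form) (eta eta' : fweight H) (Om Om' : V) :
  irreducible_submodule (@fact _ _ _ V) (fun _ => True) ->
  highest_weight_vector pos eta Om -> highest_weight_vector pos eta' Om' ->
  eta = eta' /\ exists t : C, Om' = t *: Om.
Proof.
move=> V_irr hOm hOm'; have [phi [phil phi1 phin phi0]] := vacuum_functional V_irr hOm.
have key ta w : highest_weight_vector pos ta w -> phi w <> 0.
  move=> hw pw; have [t [n [hn OmE]]] := hw_split V_irr hw Om.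
  suff : phi Om = 0 by rewrite phi1 => /eqP; rewrite oner_eq0.
  rewrite OmE phil pw scaler0 add0r; elim: hn => [|l v u hl _ IH].
    exact: (blin0 phil).
  by rewrite (blinD phil) phin // IH addr0.
have pOm' := key _ _ hOm'.
have etaE : eta = eta'.
  apply/lfunP => u; apply: (mulIf (x := phi Om')); first by apply/eqP.
  by rewrite -phi0 (hw_f0 hOm') (blinZ phil).
split=> //; exists (phi Om'); apply/eqP; rewrite -subr_eq0; apply: contrapT => /negP w0.
apply: (key eta (Om' - phi Om' *: Om)); last by rewrite (blinB phil) (blinZ phil) phi1 -[_ *: 1]/(_ * 1) mulr1 subrr.
have [_ p1 n1 _] := hOm; have [_ p2 n2 _] := hOm'.
split=> //.
- move=> m m0; have [l1 x1] := p1 m m0; have [l2 x2] := p2 m m0; split=> [|x].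
    by rewrite (blinB (fmL_linear m)) (blinZ (fmL_linear m)) l1 l2 scaler0 subr0.
  by rewrite (blinB (fmX_linear x m)) (blinZ (fmX_linear x m)) x1 x2 scaler0 subr0.
- move=> x hx; rewrite (blinB (fmX_linear _ 0)) (blinZ (fmX_linear _ 0)) n1 // n2 //.
  by rewrite scaler0 subr0.
move=> u; rewrite (blinB (f0act_linear u)) (blinZ (f0act_linear u)) (hw_f0 hOm) (hw_f0 hOm') -etaE.
by rewrite scalerBr !scalerA mulrC.
Qed.

End HighestWeight.

(** * Polynomial dependence on the power of t_1, and the modes of E(n, z) *)

Definition rangeZ (K : nat) : seq int := [seq i%:Z - K%:Z | i <- iota 0 (K + K).+1].

Lemma mem_rangeZ K (s : int) : (s \in rangeZ K) = (`|s| <= K)%N.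
Proof.
apply/mapP/idP => [|h].
  by case=> i; rewrite mem_iota => /andP[_] + ->; lia.
exists (absz (s + K%:Z)); rewrite ?mem_iota; lia.
Qed.

Lemma rangeZ_uniq K : uniq (rangeZ K).
Proof. by rewrite map_inj_uniq ?iota_uniq // => i j /addIr []. Qed.

Lemma fsumZ (W : nmodType) (F : int -> W) K :
  (forall s, (K < `|s|)%N -> F s = 0) ->
  \sum_(s \in [set: int]%classic) F s = \sum_(s <- rangeZ K) F s.
Proof.
move=> h; rewrite (fsbigE (rangeZ K)) ?rangeZ_uniq //.
  by apply: eq_bigl => s; exact: mem_set.
by move=> s _; rewrite mem_rangeZ -ltnNge => /h.
Qed.

Lemma fsumN (W : nmodType) (F : nat -> W) (s : int) K :
  (forall q, (K <= q)%N -> F q = 0) ->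
  \sum_(q \in [set q : nat | s <= q%:Z]%classic) F q = \sum_(q <- iota 0 K | s <= q%:Z) F q.
Proof.
move=> h.
have -> : [set q : nat | s <= q%:Z]%classic = [set` [pred q : nat | s <= q%:Z]]%classic.
  by apply/seteqP; split=> q; rewrite /= inE.
rewrite -(@bigfs _ _ _ _ (iota 0 K)) ?iota_uniq //.
by move=> q _; rewrite mem_iota /= add0n -leqNgt => /h.
Qed.

Section PolynomialFunctions.
Variables (C : numFieldType).

Definition polyfun (W : lmodType C) (f : int -> W) :=
  exists D (c : nat -> W), forall n, f n = \sum_(q < D) n%:~R ^+ q *: c q.

Lemma polyfun_ext (W : lmodType C) (f h : int -> W) : f =1 h -> polyfun h -> polyfun f.
Proof. by move=> e [D [c hc]]; exists D, c => n; rewrite e. Qed.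

Lemma polyfun_mono (W : lmodType C) k (w : W) : polyfun (fun n => n%:~R ^+ k *: w).
Proof.
exists k.+1, (fun q => if q == k then w else 0) => n.
rewrite big_ord_recr /= eqxx big1 ?add0r // => i _.
by rewrite ltn_eqF // scaler0.
Qed.

Lemma polyfun_cst (W : lmodType C) (w : W) : polyfun (fun=> w).
Proof. by apply: polyfun_ext (polyfun_mono 0 w) => n; rewrite expr0 scale1r. Qed.

Lemma polyfunD (W : lmodType C) (f h : int -> W) :
  polyfun f -> polyfun h -> polyfun (fun n => f n + h n).
Proof.
move=> [D [c hc]] [D' [c' hc']].
exists (D + D')%N, (fun q => (if (q < D)%N then c q else 0) + (if (q < D')%N then c' q else 0)) => n.
have ext E (b : nat -> W) E' : (E <= E')%N ->
    \sum_(q < E) n%:~R ^+ q *: b q = \sum_(q < E') n%:~R ^+ q *: (if (q < E)%N then b q else 0).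
  move=> EE; rewrite (big_ord_widen E' (fun q => n%:~R ^+ q *: b q)) // big_mkcond.
  by apply: eq_bigr => q _; case: ifP; rewrite ?scaler0.
rewrite hc hc' (ext D c (D + D')%N) ?leq_addr // (ext D' c' (D + D')%N) ?leq_addl //.
by rewrite -big_split; apply: eq_bigr => q _; rewrite scalerDr.
Qed.

Lemma polyfun_sum (W : lmodType C) (I : Type) (s : seq I) (P : pred I) (F : I -> int -> W) :
  (forall i, P i -> polyfun (F i)) -> polyfun (fun n => \sum_(i <- s | P i) F i n).
Proof.
move=> h; elim: s => [|i s IH].
  by apply: polyfun_ext (polyfun_cst 0) => n; rewrite big_nil.
case Pi : (P i).
  by apply: polyfun_ext (polyfunD (h i Pi) IH) => n; rewrite big_cons Pi.
by apply: polyfun_ext IH => n; rewrite big_cons Pi.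
Qed.

Lemma polyfunZ (W : lmodType C) k (a : C) (f : int -> W) :
  polyfun f -> polyfun (fun n => (n%:~R ^+ k * a) *: f n).
Proof.
case=> D [c hc].
have hs : polyfun (fun n => \sum_(q < D) n%:~R ^+ (k + q) *: (a *: c q)).
  by apply: polyfun_sum => q _; exact: polyfun_mono.
apply: polyfun_ext hs => n.
by rewrite hc scaler_sumr; apply: eq_bigr => q _; rewrite !scalerA exprD mulrAC.
Qed.

(** The degree of the operators in [n] may grow with the vector: only the
    finitely many coefficients of [f] enter. *)
Lemma polyfun_op (U W : lmodType C) (Y : int -> U -> W) (f : int -> U) :
  (forall n, linear (Y n)) -> (forall v, polyfun (Y^~ v)) ->
  polyfun f -> polyfun (fun n => Y n (f n)).
Proof.
move=> Yl Yp [D [c hc]].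
have hs : polyfun (fun n => \sum_(q < D) (n%:~R ^+ q * 1) *: Y n (c q)).
  by apply: polyfun_sum => q _; exact: polyfunZ.
apply: polyfun_ext hs => n.
by rewrite hc (blin_sum (Yl n)); apply: eq_bigr => q _; rewrite (blinZ (Yl n)) mulr1.
Qed.

Lemma polyfun_lin (U W : lmodType C) (Y : U -> W) (f : int -> U) :
  linear Y -> polyfun f -> polyfun (fun n => Y (f n)).
Proof. by move=> Yl; apply: (polyfun_op (Y := fun=> Y)) => // v; exact: polyfun_cst. Qed.

Lemma polyfun_affine (W : lmodType C) (f : int -> W) a b :
  polyfun f -> polyfun (fun n => f (a + b * n)).
Proof.
case=> D [c hc].
have hs : polyfun (fun n => \sum_(q < D) (a + b * n)%:~R ^+ q *: c q); first apply: polyfun_sum => q _; last first.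
  by apply: polyfun_ext hs => n; rewrite hc.
elim: (val q) (c q) => [|k IH] w.
  by apply: polyfun_ext (polyfun_cst w) => n; rewrite expr0 scale1r.
apply: polyfun_ext (polyfunD (polyfunZ 0 a%:~R (IH w)) (polyfunZ 1 b%:~R (IH w))) => n /=.
rewrite -scalerDl scalerA exprS expr0 expr1 mul1r; congr (_ *: _).
by rewrite rmorphD rmorphM /= [b%:~R * _]mulrC.
Qed.

End PolynomialFunctions.

Section ExpCoef.
Variables (C : numFieldType).

Lemma powcoef_linear (V : lmodType C) (A : nat -> V -> V) q s :
  (forall j, linear (A j)) -> linear (powcoef A q s).
Proof.
move=> Al; elim: q s => [|q IH] s a u v /=; first by case: ifP; rewrite ?scaler0 ?addr0.
by rewrite scaler_sumr -big_split; apply: eq_bigr => j _; rewrite IH Al.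
Qed.

Lemma powcoef_nat (V W : lmodType C) (A : nat -> V -> V) (B : nat -> W -> W) (th : V -> W) q s v :
  linear th -> (forall j w, th (A j w) = B j (th w)) ->
  th (powcoef A q s v) = powcoef B q s (th v).
Proof.
move=> thl AB; elim: q s => [|q IH] s /=; first by case: ifP => // _; exact: blin0.
by rewrite (blin_sum thl); apply: eq_bigr => j _; rewrite AB IH.
Qed.

Lemma powcoef_scale (V : lmodType C) (A B : nat -> V -> V) (a : C) q s v :
  (forall j, linear (B j)) -> (forall j w, A j w = a *: B j w) ->
  powcoef A q s v = a ^+ q *: powcoef B q s v.
Proof.
move=> Bl AB; elim: q s => [|q IH] s /=.
  by rewrite expr0 scale1r.
rewrite scaler_sumr; apply: eq_bigr => j _.
by rewrite AB IH (blinZ (Bl j)) scalerA -exprS.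
Qed.

Lemma expcoef_linear (V : lmodType C) (A : nat -> V -> V) s :
  (forall j, linear (A j)) -> linear (expcoef A s).
Proof.
move=> Al a u v; rewrite /expcoef scaler_sumr -big_split; apply: eq_bigr => q _.
by rewrite (powcoef_linear q s Al) scalerDr !scalerA mulrC.
Qed.

Lemma expcoef_nat (V W : lmodType C) (A : nat -> V -> V) (B : nat -> W -> W) (th : V -> W) s v :
  linear th -> (forall j w, th (A j w) = B j (th w)) ->
  th (expcoef A s v) = expcoef B s (th v).
Proof.
move=> thl AB; rewrite /expcoef (blin_sum thl); apply: eq_bigr => q _.
by rewrite (blinZ thl) (powcoef_nat _ _ _ thl AB).
Qed.

(** The exponential is used through its terms, which are homogeneous in the
    exponent; this is where polynomial dependence on [n] comes from. *)
Lemma expcoef_scale (V : lmodType C) (A B : nat -> V -> V) (a : C) s v :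
  (forall j, linear (B j)) -> (forall j w, A j w = a *: B j w) ->
  expcoef A s v = \sum_(q < s.+1) (a ^+ q * (q`!%:R)^-1) *: powcoef B q s v.
Proof.
move=> Bl AB; apply: eq_bigr => q _.
by rewrite (powcoef_scale q s v Bl AB) scalerA mulrC.
Qed.

Lemma expcoef0 (V : lmodType C) (A : nat -> V -> V) s v :
  (forall j, linear (A j)) -> (forall j w, A j w = 0) ->
  expcoef A s v = if s == 0%N then v else 0.
Proof.
move=> Al A0; rewrite (expcoef_scale (A := A) (B := A) (a := 0)) // => [|j w]; last by rewrite A0 scaler0.
rewrite big_ord_recl big1 ?addr0 => [|q _]; first by rewrite expr0 mul1r fact0 invr1 scale1r.
by rewrite exprS mul0r mul0r scale0r.
Qed.

End ExpCoef.

Section ModeOperators.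
Variables (C : numFieldType) (g : lieAlgebra C) (form : g -> g -> C).
Hypothesis form0r : forall x, form x 0 = 0.
Notation fk1 := (@fk1 C g).
Notation fd1 := (@fd1 C g).

Section Brackets.
Variable V : fmodule form.
Implicit Types (v w : V) (m n : int) (x y : fdot g).

Lemma bd_leN (K K' : nat) v : (K <= K')%N -> bd K%:Z v -> bd K'%:Z v.
Proof. by move=> h; apply: bd_le. Qed.
Lemma bd_X (B : int) x m v : bd B v -> bd (B - m) (fmX x m v).
Proof. exact: (bd_mop (l := (Some x, m))). Qed.
Lemma bd_L (B : int) m v : bd B v -> bd (B - m) (fmL m v).
Proof. exact: (bd_mop (l := (None, m))). Qed.
Lemma bd_X0 (B : int) x m v : bd B v -> B < m -> fmX x m v = 0.
Proof. by move=> h Bm; apply: (bd_lt0 (B := B - m)); rewrite ?subr_lt0 //; exact: bd_X. Qed.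
Lemma k1_comm x m n v : x.2 = 0 -> fmX x m (fmX fk1 n v) = fmX fk1 n (fmX x m v).
Proof.
move=> x2; apply/eqP; rewrite -subr_eq0 fmXX /fdot_form /= form0r x2 mulr0 mul0r !addr0.
rewrite mulr0 scale0r if_same addr0 (_ : fdot_lieb _ _ = 0) ?fmX0 //.
by rewrite /fdot_lieb /fdot_in /= (blin0 (lieb_linearr _)).
Qed.

Lemma d1_k1_comm m n v : fmX fd1 m (fmX fk1 n v) =
  fmX fk1 n (fmX fd1 m v) + (if m + n == 0 then m%:~R *: fmk0 v else 0).
Proof.
apply/eqP; rewrite addrC -subr_eq fmXX /fdot_form /= form0r mul0r !add0r !mulr1.
rewrite (_ : fdot_lieb _ _ = 0) ?fmX0 ?add0r //.
by rewrite /fdot_lieb /fdot_in /= (blin0 (lieb_linearr _)).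
Qed.

End Brackets.

Section ExpModes.
Variables (V : fmodule form) (c : C).
Implicit Types (v w : V) (m n s p : int).

(** The terms of the two exponents in [E(n, z)], creating and annihilating. *)
Definition Am n (j : nat) w : V := (n%:~R / (c * j%:R)) *: fmX fk1 (- j%:Z) w.
Definition Ap n (j : nat) w : V := - (n%:~R / (c * j%:R)) *: fmX fk1 j%:Z w.

Lemma Am_linear n j : linear (Am n j).
Proof. by move=> a u v; rewrite /Am fmX_linear scalerDr !scalerA mulrC. Qed.
Lemma Ap_linear n j : linear (Ap n j).
Proof. by move=> a u v; rewrite /Ap fmX_linear scalerDr !scalerA mulrC. Qed.

(** The modes of the two exponential factors of [E(n, z)]. *)
Definition em n (q : nat) : V -> V := expcoef (Am n) q.
Definition ep n (q : nat) : V -> V := expcoef (Ap n) q.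

Lemma em_linear n q : linear (em n q).
Proof. by apply: expcoef_linear => j; exact: Am_linear. Qed.
Lemma ep_linear n q : linear (ep n q).
Proof. by apply: expcoef_linear => j; exact: Ap_linear. Qed.

Lemma expcoef_bd (A : nat -> V -> V) (e : int) (B : int) q v :
  (forall (B : int) j w, bd B w -> bd (B - e * j%:Z) (A j w)) ->
  bd B v -> bd (B - e * q%:Z) (expcoef A q v).
Proof.
move=> hA hv; rewrite /expcoef; apply: bd_sum => i _; apply: bd_scale.
move: (val i) => k {i}; elim: k q => [|k IH] q /=.
  by case: eqP => [->|_]; [by rewrite mulr0 subr0|exact: bd0].
rewrite big_nat; apply: bd_sum => j /andP[j1 jq].
have := hA _ j _ (IH (q - j)%N); congr bd.
rewrite -subzn; last by lia.
by ring.
Qed.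

Lemma em_bd n B q v : bd B v -> bd (B + q%:Z) (em n q v).
Proof.
move=> hv; have -> : B + q%:Z = B - (-1) * q%:Z by rewrite mulN1r opprK.
apply: expcoef_bd hv => B' j w hw; apply: bd_scale; rewrite mulN1r; exact: bd_X.
Qed.
Lemma ep_bd n B q v : bd B v -> bd (B - q%:Z) (ep n q v).
Proof.
move=> hv; rewrite -[q%:Z]mul1r.
by apply: expcoef_bd hv => B' j w hw; apply: bd_scale; rewrite mul1r; exact: bd_X.
Qed.

Lemma ep_eq0 n (K q : nat) v : bd K%:Z v -> (K < q)%N -> ep n q v = 0.
Proof. by move=> hK Kq; apply: (bd_lt0 (B := K%:Z - q%:Z)); [lia|exact: ep_bd]. Qed.

Lemma Ecoef_fin n s (K : nat) v : bd K%:Z v ->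
  Ecoef c n s v = \sum_(q <- iota 0 K.+1 | s <= q%:Z) em n (absz (q%:Z - s)) (ep n q v).
Proof.
move=> hv; rewrite /Ecoef (@fsumN _ _ s K.+1) // => q Kq.
by rewrite -[expcoef _ q v]/(ep n q v) (ep_eq0 n hv) // -[LHS]/(em n _ 0) (blin0 (em_linear _ _)).
Qed.

Lemma Ecoef_bd n s B (K : nat) v : bd K%:Z v -> bd B v -> bd (B - s) (Ecoef c n s v).
Proof.
move=> hK hB; rewrite (Ecoef_fin _ _ hK); apply: bd_sum => q sq.
have : bd (B - q%:Z + (absz (q%:Z - s))%:Z) (em n (absz (q%:Z - s)) (ep n q v)) by apply: em_bd; exact: ep_bd.
congr bd.
by rewrite gez0_abs ?subr_ge0 // addrA subrK.
Qed.

Lemma Ecoef_eq0 n s (K : nat) v : bd K%:Z v -> K%:Z < s -> Ecoef c n s v = 0.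
Proof. by move=> hK Ks; apply: (bd_lt0 (B := K%:Z - s)); rewrite ?subr_lt0 //; exact: (Ecoef_bd n hK hK). Qed.

Lemma Ecoef_0 s (K : nat) v : bd K%:Z v -> Ecoef c 0 s v = if s == 0 then v else 0.
Proof.
move=> hK; have A0 j w : Am 0 j w = 0 by rewrite /Am mul0r scale0r.
have B0 j w : Ap 0 j w = 0 by rewrite /Ap mul0r oppr0 scale0r.
have eE q w : em 0 q w = if q == 0%N then w else 0.
  by apply: expcoef0 => // j; exact: Am_linear.
have pE q w : ep 0 q w = if q == 0%N then w else 0.
  by apply: expcoef0 => // j; exact: Ap_linear.
rewrite (Ecoef_fin _ _ hK) /= big_cons big1_seq => [|q /andP[_]]; last first.
  rewrite mem_iota => /andP[q0 _]; rewrite pE gtn_eqF // eE; by case: ifP.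
rewrite addr0 pE eqxx eE sub0r abszN absz_eq0.
by case: (ltgtP s 0) => // s0; rewrite ?if_same.
Qed.

Lemma em_polyfun q v : polyfun (fun n => em n q v).
Proof.
pose w (i : 'I_q.+1) := (i`!%:R)^-1 *: powcoef (Am 1) i q v.
have hs : polyfun (fun n => \sum_(i < q.+1) n%:~R ^+ i *: w i).
  by apply: polyfun_sum => i _; exact: polyfun_mono.
apply: polyfun_ext hs => n; rewrite /em (expcoef_scale (B := Am 1) (a := n%:~R)) //.
- by apply: eq_bigr => i _; rewrite scalerA.
- by move=> j; exact: Am_linear.
by move=> j u; rewrite /Am scalerA mulrA mulr1.
Qed.

Lemma ep_polyfun q v : polyfun (fun n => ep n q v).
Proof.
pose w (i : 'I_q.+1) := (i`!%:R)^-1 *: powcoef (Ap 1) i q v.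
have hs : polyfun (fun n => \sum_(i < q.+1) n%:~R ^+ i *: w i).
  by apply: polyfun_sum => i _; exact: polyfun_mono.
apply: polyfun_ext hs => n; rewrite /ep (expcoef_scale (B := Ap 1) (a := n%:~R)) //.
- by apply: eq_bigr => i _; rewrite scalerA.
- by move=> j; exact: Ap_linear.
by move=> j u; rewrite /Ap scalerA mulrN mulrA mulr1.
Qed.

Lemma Ecoef_polyfun s (K : nat) v : bd K%:Z v -> polyfun (fun n => Ecoef c n s v).
Proof.
move=> hK.
have hs : polyfun (fun n => \sum_(q <- iota 0 K.+1 | s <= q%:Z) em n (absz (q%:Z - s)) (ep n q v)).
  apply: polyfun_sum => q _; apply: (polyfun_op (Y := fun n => em n (absz (q%:Z - s)))) => [n|w|]; [exact: em_linear|exact: em_polyfun|exact: ep_polyfun].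
by apply: polyfun_ext hs => n; exact: Ecoef_fin.
Qed.

End ExpModes.

Section Naturality.
Variables (V W : fmodule form) (c : C) (th : V -> W).
Hypothesis thl : linear th.
Hypothesis th_k1 : forall j v, th (fmX fk1 j v) = fmX fk1 j (th v).

Lemma Ecoef_nat n s (K : nat) v : bd K%:Z v -> bd K%:Z (th v) ->
  th (Ecoef c n s v) = Ecoef c n s (th v).
Proof.
move=> hv hw; rewrite (Ecoef_fin _ _ _ hv) (Ecoef_fin _ _ _ hw) (blin_sum thl).
apply: eq_bigr => q _.
rewrite /em (expcoef_nat (B := @Am W c n) _ _ thl); last first.
  by move=> j w; rewrite /Am (blinZ thl) th_k1.
congr expcoef; rewrite /ep (expcoef_nat (B := @Ap W c n) _ _ thl) //.
by move=> j w; rewrite /Ap (blinZ thl) th_k1.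
Qed.

End Naturality.

End ModeOperators.

(** * Separation of exponential polynomials *)

Section Subspace.
Variables (C : fieldType) (W : lmodType C) (U : W -> Prop).
Hypothesis Us : subspace U.
Lemma subspace0 : U 0. Proof. by case: Us. Qed.
Lemma subspaceP a u v : U u -> U v -> U (a *: u + v). Proof. by case: Us => _; apply. Qed.
Lemma subspaceD u v : U u -> U v -> U (u + v).
Proof. by move=> hu hv; rewrite -[u]scale1r; exact: subspaceP. Qed.
Lemma subspaceZ a u : U u -> U (a *: u).
Proof. by move=> hu; rewrite -[_ *: _]addr0; apply: subspaceP => //; exact: subspace0. Qed.
Lemma subspaceB u v : U u -> U v -> U (u - v).
Proof. by move=> hu hv; rewrite -scaleN1r; apply: subspaceD => //; exact: subspaceZ. Qed.
Lemma subspace_sum (I : Type) (s : seq I) (P : pred I) F :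
  (forall i, P i -> U (F i)) -> U (\sum_(i <- s | P i) F i).
Proof. by move=> h; apply: (big_ind U) => //; [exact: subspace0|exact: subspaceD]. Qed.
Lemma subspace_scaleP a u : a != 0 -> U (a *: u) -> U u.
Proof. by move=> a0 h; rewrite -[u](scalerK a0); exact: subspaceZ. Qed.
Lemma subspace_addl u v : U u -> U (u + v) -> U v.
Proof. by move=> hu h; rewrite -[v](addKr u) addrC; exact: subspaceB. Qed.
End Subspace.

Section Shift.
Variables (C : numFieldType) (W : lmodType C).
Implicit Types (f : int -> W) (k : {poly C}) (x : int).

(** The polynomial [k] in the shift operator [f |-> f (x + 1)]. *)
Definition shiftop k f x : W := \sum_(t < size k) k`_t *: f (x + t%:Z).

Lemma shiftopE N k f x : (size k <= N)%N -> shiftop k f x = \sum_(t < N) k`_t *: f (x + t%:Z).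
Proof.
move=> h; rewrite /shiftop (big_ord_widen N (fun t => k`_t *: f (x + t%:Z))) // big_mkcond.
apply: eq_bigr => t _; case: ltnP => // kt.
by rewrite nth_default // scale0r.
Qed.

Lemma shiftopD k l f x : shiftop (k + l) f x = shiftop k f x + shiftop l f x.
Proof.
pose N := maxn (size k) (size l).
rewrite (@shiftopE N k) ?leq_maxl // (@shiftopE N l) ?leq_maxr //.
rewrite (@shiftopE N) ?(leq_trans (size_polyD _ _)) // -big_split.
by apply: eq_bigr => t _; rewrite coefD scalerDl.
Qed.

Lemma shiftopC a f x : shiftop a%:P f x = a *: f x.
Proof.
rewrite (@shiftopE 1) ?size_polyC_leq1 // big_ord_recl big_ord0 addr0.
by rewrite coefC /= addr0.
Qed.

Lemma shiftop_MX k f x : shiftop (k * 'X) f x = shiftop k (fun y => f (y + 1)) x.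
Proof.
have [->|k0] := eqVneq k 0; first by rewrite mul0r /shiftop size_poly0 !big_ord0.
rewrite (@shiftopE (size k).+1) ?size_mulX // big_ord_recl coefMX eqxx scale0r add0r.
apply: eq_bigr => t _; rewrite coefMX /=; congr (_ *: f _).
by rewrite -addrA intS [1 + _]addrC.
Qed.

Lemma shiftopZ k a f x : shiftop (k * a%:P) f x = a *: shiftop k f x.
Proof.
rewrite (@shiftopE (size k)); last first.
  by rewrite mulrC mul_polyC size_scale_leq.
rewrite scaler_sumr; apply: eq_bigr => t _.
by rewrite mulrC coefCM scalerA.
Qed.

Lemma shiftop_MXsubC k b f x :
  shiftop (k * ('X - b%:P)) f x = shiftop k (fun y => f (y + 1) - b *: f y) x.
Proof.
rewrite mulrBr -mulrN -polyCN shiftopD shiftop_MX shiftopZ.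
rewrite scaler_sumr -big_split; apply: eq_bigr => t _ /=.
by rewrite scaleNr scalerBr; congr (_ - _); rewrite !scalerA mulrC.
Qed.

(** Unlike [polyfun], with an explicit bound for the degree, to be traded
    against the order of vanishing of a polynomial in the shift. *)
Definition polydeg D f := exists c : nat -> W, forall n, f n = \sum_(q < D) n%:~R ^+ q *: c q.

Lemma polydegD D f h : polydeg D f -> polydeg D h -> polydeg D (fun n => f n + h n).
Proof.
move=> [c hc] [c' hc']; exists (fun q => c q + c' q) => n.
by rewrite hc hc' -big_split; apply: eq_bigr => q _; rewrite scalerDr.
Qed.

Lemma polydeg_diff_mono q (w : W) :
  polydeg q (fun n => (n + 1)%:~R ^+ q *: w - n%:~R ^+ q *: w).
Proof.
exists (fun j => 'C(q, j)%:R *: w) => n.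
rewrite -scalerBl rmorphD /= [n%:~R + _]addrC exprDn big_ord_recr /= subnn expr0 mul1r binn mulr1n addrK.
rewrite scaler_suml; apply: eq_bigr => j _.
by rewrite expr1n mul1r scalerA mulr_natr.
Qed.

Lemma polydeg_diff D f : polydeg D.+1 f -> polydeg D (fun n => f (n + 1) - f n).
Proof.
case=> c hc.
have hs : polydeg D (fun n => \sum_(q < D.+1) ((n + 1)%:~R ^+ q *: c q - n%:~R ^+ q *: c q)).
  have wid q E h : (q <= E)%N -> polydeg q h -> polydeg E h.
    move=> qE [b hb]; exists (fun j => if (j < q)%N then b j else 0) => n; rewrite hb.
    rewrite (big_ord_widen E (fun j => n%:~R ^+ j *: b j)) // big_mkcond.
    by apply: eq_bigr => j _; case: ifP; rewrite ?scaler0.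
  have {hc} : forall E, (E <= D.+1)%N ->
      polydeg D (fun n => \sum_(q < E) ((n + 1)%:~R ^+ q *: c q - n%:~R ^+ q *: c q)).
    elim=> [_|E IH ED].
      by exists (fun=> 0) => n; rewrite big_ord0 big1 // => q _; rewrite scaler0.
    have [b hb] := polydegD (IH (ltnW ED)) (wid E D _ ED (polydeg_diff_mono E (c E))).
    by exists b => n; rewrite big_ord_recr -hb.
  exact.
case: hs => b hb; exists b => n; rewrite -hb !hc -sumrB; exact: eq_bigr.
Qed.

(** The operator shift minus [b] lowers the degree of the polynomial factor of
    [b ^ y * p y]. *)
Lemma shiftop_kill D b p k x : polydeg D p -> b != 0 ->
  shiftop (k * ('X - b%:P) ^+ D) (fun y => b ^ y *: p y) x = 0.
Proof.
move=> + b0; elim: D p k => [|D IH] p k hp.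
  have [c hc] := hp; rewrite /shiftop big1 // => t _.
  by rewrite hc big_ord0 !scaler0.
rewrite exprSr mulrA shiftop_MXsubC.
transitivity (shiftop (k * ('X - b%:P) ^+ D) (fun y => b ^ y *: (b *: (p (y + 1) - p y))) x).
  apply: eq_bigr => t _; congr (_ *: _).
  by rewrite expfzDr // expr1z -scalerA scalerBr scalerBr !scalerA [b * _]mulrC.
apply: IH; have [c hc] := polydeg_diff hp; exists (fun q => b *: c q) => n.
by rewrite hc scaler_sumr; apply: eq_bigr => q _; rewrite !scalerA mulrC.
Qed.

End Shift.

(** Functions [x |-> b ^ x p(x)] with distinct bases [b] are separated by
    polynomials in the shift operator, found by Hermite interpolation; the
    interpolation at [0] lets only positive arguments enter. *)
Lemma exp_poly_separation (C : numFieldType) (W : lmodType C) (U : W -> Prop)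
    (I : Type) (s : seq I) (b : I -> C) (p : I -> int -> W) :
  subspace U -> (forall i, b i != 0) -> (forall i, polyfun (p i)) ->
  (forall x : int, 0 < x -> U (\sum_(i <- s) b i ^ x *: p i x)) ->
  forall (beta : C) x, U (\sum_(i <- s | b i == beta) p i x).
Proof.
move=> Us b0 hp hU beta x.
have [-> | beta0] := eqVneq beta 0.
  by rewrite big_pred0 => [|i]; [exact: subspace0|exact: negbTE].
have [D hD] : exists D, forall i, List.In i s -> polydeg D (p i).
  elim: s {hU} => [|i s [D hD]]; first by exists 0%N.
  have [E [c hc]] := hp i; exists (D + E)%N => j /= [<-|/hD [c' hc']].
    exists (fun q => if (q < E)%N then c q else 0) => n; rewrite hc.
    rewrite (big_ord_widen (D + E) (fun q => n%:~R ^+ q *: c q)) ?leq_addl // big_mkcond.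
    by apply: eq_bigr => q _; case: ifP; rewrite ?scaler0.
  exists (fun q => if (q < D)%N then c' q else 0) => n; rewrite hc'.
  rewrite (big_ord_widen (D + E) (fun q => n%:~R ^+ q *: c' q)) ?leq_addr // big_mkcond.
  by apply: eq_bigr => q _; case: ifP; rewrite ?scaler0.
(* The interpolating polynomial is made divisible by ['X ^+ M], so that the
   shift by it evaluates only at arguments [x + t] with [t] at least [M], which
   are positive. *)
pose M := (absz x).+1.
pose rs := undup (0 :: [seq b i | i <- s]).
have [k hk] := hermite_interpolation (D + M) (fun z => (z == beta)%:R) (undup_uniq (0 :: [seq b i | i <- s])).
have k_low t : (t < M)%N -> k`_t = 0.
  have /dvdpP[l ->] : 'X ^+ (D + M) %| k.
    have := hk 0; rewrite mem_undup mem_head eq_sym (negPf beta0) !subr0; exact.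
  by move=> tM; rewrite coefMXn ifT //; lia.
have bs i : List.In i s -> b i \in undup (0 :: [seq b i | i <- s]).
  move=> ins; rewrite mem_undup inE; apply/orP; right.
  by elim: (s) ins => //= j r IH [->|/IH h]; rewrite inE ?eqxx ?h ?orbT.
have key i : List.In i s ->
    shiftop k (fun y => b i ^ y *: p i y) x = (b i == beta)%:R *: (b i ^ x *: p i x).
  move=> ins; have /dvdpP[l hl] := hk _ (bs i ins).
  have -> : k = l * ('X - (b i)%:P) ^+ M * ('X - (b i)%:P) ^+ D + (b i == beta)%:R%:P.
    by rewrite -mulrA -exprD addnC -hl subrK.
  by rewrite shiftopD shiftopC (shiftop_kill _ _ (hD i ins)) // add0r.
have sumE : \sum_(i <- s) shiftop k (fun y => b i ^ y *: p i y) x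
     = beta ^ x *: \sum_(i <- s | b i == beta) p i x.
  rewrite scaler_sumr; elim: (s) key => [|i r IH] key; first by rewrite !big_nil.
  rewrite !big_cons IH => [|j jr]; last by apply: key; right.
  rewrite key; last by left.
  by case: eqP => [->|_]; rewrite ?scale1r // scale0r add0r.
apply: (subspace_scaleP Us (a := beta ^ x)); first by rewrite expfz_neq0.
rewrite -sumE /shiftop exchange_big; apply: subspace_sum => // t _.
rewrite -scaler_sumr; have [tM|tM] := ltnP t M.
  by rewrite k_low // scale0r; exact: subspace0.
by apply: subspaceZ => //; apply: hU; lia.
Qed.

(** Separation with a single base, 1: a polynomial is a combination of its
    values at positive integers. *)
Lemma polyfun_extend (C : numFieldType) (W : lmodType C) (U : W -> Prop) (f : int -> W) :
  subspace U -> polyfun f -> (forall x : int, 0 < x -> U (f x)) -> forall x, U (f x).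
Proof.
move=> Us fp hU x.
have := @exp_poly_separation C W U unit (tt :: nil) (fun=> 1) (fun=> f) Us _ _ _ 1 x.
rewrite big_cons big_nil eqxx addr0; apply=> //; first by move=> _; exact: oner_neq0.
by move=> y y0; rewrite big_cons big_nil addr0 exp1rz scale1r; exact: hU.
Qed.

(** * Products of fields with E(n, z) *)

Section VertexModes.
Variables (C : numFieldType) (g : lieAlgebra C) (form : g -> g -> C).
Hypothesis form0r : forall x, form x 0 = 0.
Notation fk1 := (@fk1 C g).
Notation fd1 := (@fd1 C g).

(** The fields that can be multiplied with [E(n, z)]: homogeneous, and
    commuting with the modes of [k_1]. *)
Record tame (V : fmodule form) (F : int -> V -> V) : Prop := Tame {
  tame_lin : forall p, linear (F p);
  tame_bd : forall (B : int) p v, bd B v -> bd (B - p) (F p v);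
  tame_k1 : forall p j v, F p (fmX fk1 j v) = fmX fk1 j (F p v)
}.

Section OneModule.
Variables (V : fmodule form) (c : C).
Implicit Types (v w : V) (m n s p : int) (F : int -> V -> V).
Hypothesis V_bd : forall v, exists K : nat, bd K%:Z v.

Lemma bd_pair v w : exists K : nat, bd K%:Z v /\ bd K%:Z w.
Proof.
have [K hK] := V_bd v; have [K' hK'] := V_bd w; exists (K + K')%N.
by split; [apply: bd_leN hK; rewrite leq_addr|apply: bd_leN hK'; rewrite leq_addl].
Qed.

Lemma Ecoef_linear n s : linear (@Ecoef _ _ _ V c n s).
Proof.
move=> a v w; have [K [hv hw]] := bd_pair v w.
have hvw : bd K%:Z (a *: v + w) by exact: bd_lin.
rewrite (Ecoef_fin c n s hv) (Ecoef_fin c n s hw) (Ecoef_fin c n s hvw).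
rewrite scaler_sumr -big_split; apply: eq_bigr => q _ /=.
by rewrite ep_linear em_linear.
Qed.

Lemma tame_eq0 F p (K : nat) v : tame F -> bd K%:Z v -> K%:Z < p -> F p v = 0.
Proof.
move=> tF hK Kp; apply: (bd_lt0 (B := K%:Z - p)); first by rewrite subr_lt0.
exact: (tame_bd tF).
Qed.

Lemma timesE_fin F m n (K K' : nat) v : tame F -> bd K%:Z v -> (K + absz m <= K')%N ->
  timesE c F m n v = \sum_(s <- rangeZ K') F (m - s) (Ecoef c n s v).
Proof.
move=> tF hK KK; rewrite /timesE (@fsumZ _ _ K') // => s Ks.
have [s0|s0] := ltP s 0; last first.
  by rewrite (Ecoef_eq0 c n hK) ?(blin0 (tame_lin tF _)) //; lia.
have F0 : F (m - s) v = 0 by apply: (tame_eq0 tF hK); lia.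
rewrite (Ecoef_nat c (tame_lin tF (m - s)) _ n s hK) ?F0 //.
- by rewrite (blin0 (Ecoef_linear n s)).
- by move=> j w; rewrite (tame_k1 tF).
exact: bd0.
Qed.

Lemma timesE_linear F m n : tame F -> linear (timesE c F m n).
Proof.
move=> tF a v w; have [K [hv hw]] := bd_pair v w.
have hvw : bd K%:Z (a *: v + w) by exact: bd_lin.
rewrite (timesE_fin n tF hv (leqnn _)) (timesE_fin n tF hw (leqnn _)) (timesE_fin n tF hvw (leqnn _)).
rewrite scaler_sumr -big_split; apply: eq_bigr => s _ /=.
by rewrite Ecoef_linear (tame_lin tF).
Qed.

Lemma timesE_polyfun F m v : tame F -> polyfun (fun n => timesE c F m n v).
Proof.
move=> tF; have [K hK] := V_bd v.
have hs : polyfun (fun n => \sum_(s <- rangeZ (K + absz m)) F (m - s) (Ecoef c n s v)).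
  by apply: polyfun_sum => s _; apply: polyfun_lin; [exact: (tame_lin tF)|exact: (Ecoef_polyfun c s hK)].
by apply: polyfun_ext hs => n; rewrite (timesE_fin n tF hK (leqnn _)).
Qed.

Lemma timesE_0 F m v : tame F -> timesE c F m 0 v = F m v.
Proof.
move=> tF; have [K hK] := V_bd v; rewrite (timesE_fin 0 tF hK (leqnn _)).
rewrite (bigD1_seq 0) ?rangeZ_uniq ?mem_rangeZ //= (Ecoef_0 c 0 hK) eqxx subr0.
rewrite big1 ?addr0 // => s s0.
by rewrite (Ecoef_0 c s hK) (negPf s0) (blin0 (tame_lin tF _)).
Qed.

Lemma tame_fmX x : x.2 = 0 -> @tame V (fmX x).
Proof.
move=> x2; split=> [p|B p v|p j v]; [exact: fmX_linear|exact: bd_X|exact: k1_comm].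
Qed.

Lemma tame_k1bar : @tame V (@k1bar _ _ _ V).
Proof.
split=> [p a v w|B p v hv|p j v].
- by rewrite /k1bar fmX_linear scalerDr !scalerA mulrC.
- by apply: bd_scale; exact: bd_X.
by rewrite /k1bar (blinZ (fmX_linear _ _)) k1_comm.
Qed.

Definition dkterm m p v : V :=
  if p < 0 then fmX fd1 p (fmX fk1 (m - p) v) else fmX fk1 (m - p) (fmX fd1 p v).

Lemma dkterm_linear m p : linear (dkterm m p).
Proof. by move=> a v w; rewrite /dkterm; case: ifP => _; rewrite !fmX_linear. Qed.

Lemma d1k1_fin m (K K' : nat) v : bd K%:Z v -> (K + absz m <= K')%N ->
  d1k1 m v = \sum_(p <- rangeZ K') dkterm m p v.
Proof.
move=> hK KK; rewrite /d1k1 (@fsumZ _ _ K') // => p Kp.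
case: ltP => p0.
  by rewrite (bd_X0 _ hK) ?(blin0 (fmX_linear _ _)) //; lia.
by rewrite [X in fmX _ _ X](bd_X0 _ hK) ?(blin0 (fmX_linear _ _)) //; lia.
Qed.

Lemma d1k1_linear m : linear (@d1k1 _ _ _ V m).
Proof.
move=> a v w; have [K [hv hw]] := bd_pair v w.
have hvw : bd K%:Z (a *: v + w) by exact: bd_lin.
rewrite (d1k1_fin hv (leqnn _)) (d1k1_fin hw (leqnn _)) (d1k1_fin hvw (leqnn _)).
by rewrite scaler_sumr -big_split; apply: eq_bigr => s _ /=; rewrite dkterm_linear.
Qed.

Lemma d1k1_bd m (B : int) v : bd B v -> bd (B - m) (d1k1 m v).
Proof.
move=> hB; have [K hK] := V_bd v; rewrite (d1k1_fin hK (leqnn _)).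
apply: bd_sum => p _; rewrite /dkterm; case: ifP => _.
  have : bd (B - (m - p) - p) (fmX fd1 p (fmX fk1 (m - p) v)) by do 2!apply: bd_X.
  by congr bd; ring.
have : bd (B - p - (m - p)) (fmX fk1 (m - p) (fmX fd1 p v)) by do 2!apply: bd_X.
by congr bd; ring.
Qed.

Hypothesis c0 : c != 0.
Hypothesis V_k0 : forall v, fmk0 v = c *: v.

(** In the normally ordered sum only the term with the mode [- j] of [d_1]
    fails to commute with [k_1(j)]. *)
Lemma d1k1_comm m j v :
  d1k1 m (fmX fk1 j v) = fmX fk1 j (d1k1 m v) - (j%:~R * c) *: fmX fk1 (m + j) v.
Proof.
have [K [hv hw]] := bd_pair v (fmX fk1 j v).
pose K' := (K + absz m + absz j)%N; have KK : (K + absz m <= K')%N by exact: leq_addr.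
rewrite (d1k1_fin hv KK) (d1k1_fin hw KK) (blin_sum (fmX_linear _ _)).
have termE p : dkterm m p (fmX fk1 j v) = fmX fk1 j (dkterm m p v)
    + (if p == - j then (p%:~R * c) *: fmX fk1 (m - p) v else 0).
  rewrite -(addr_eq0 p) /dkterm; case: ltP => p0.
    rewrite (k1_comm form0r (x := fk1) (m - p) j v) // (d1_k1_comm form0r) V_k0.
    by case: ifP => _; rewrite ?scalerA.
  rewrite (d1_k1_comm form0r) (blinD (fmX_linear _ _)) (k1_comm form0r) //.
  congr (_ + _); case: ifP => _; last exact: (blin0 (fmX_linear _ _)).
  by rewrite (blinZ (fmX_linear _ _)) V_k0 (blinZ (fmX_linear _ _)) scalerA.
rewrite (eq_bigr _ (fun p _ => termE p)) big_split /=; congr (_ + _).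
rewrite (bigD1_seq (- j)) ?rangeZ_uniq ?mem_rangeZ //=; last by rewrite /K'; lia.
rewrite eqxx big1 ?addr0 => [|p pj]; last by rewrite (negPf pj).
by rewrite opprK rmorphN /= mulNr scaleNr.
Qed.

(** The correction by [d_1 k_1] cancels the bracket of [L] with [k_1]. *)
Lemma tame_Lbar : tame (@Lbar _ _ _ V c).
Proof.
split=> [p a v w|B p v hv|p j v].
- rewrite /Lbar fmL_linear d1k1_linear !scalerDr opprD addrACA; congr (_ + _).
  by rewrite scalerN !scalerA mulrC.
- rewrite /Lbar [fmL _ _ - _]addrC -scaleNr; apply: bd_lin; [exact: d1k1_bd|exact: bd_L].
have /eqP := fmLX fk1 p j v; rewrite subr_eq /Lbar d1k1_comm => /eqP ->.
rewrite (blinB (fmX_linear _ _)) (blinZ (fmX_linear _ _)) scalerBr opprB scalerA mulrCA mulVf // mulr1.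
by rewrite scaleNr [- (_ *: _) + _]addrC addrA subrK.
Qed.

Definition dbterm m n s v : V :=
  if m - s < 0 then d1bar (m - s) (Ecoef c n s v) else Ecoef c n s (d1bar (m - s) v).

Lemma d1bar_linear p : linear (@d1bar _ _ _ V p).
Proof. by move=> a v w; rewrite /d1bar fmX_linear scalerDr !scalerA mulrC. Qed.

Lemma dbterm_linear m n s : linear (dbterm m n s).
Proof.
move=> a v w; rewrite /dbterm; case: ifP => _.
  by rewrite Ecoef_linear d1bar_linear.
by rewrite d1bar_linear Ecoef_linear.
Qed.

Lemma d1bar_fin m n (K K' : nat) v : bd K%:Z v -> (K + absz m <= K')%N ->
  d1bar_op c m n v = \sum_(s <- rangeZ K') dbterm m n s v.
Proof.
move=> hK KK; rewrite /d1bar_op (@fsumZ _ _ K') // => s Ks.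
case: ltP => ms.
  by rewrite (Ecoef_eq0 c n hK) ?(blin0 (d1bar_linear _)) //; lia.
rewrite [d1bar _ _](_ : _ = 0) ?(blin0 (Ecoef_linear _ _)) //.
by rewrite /d1bar (bd_X0 _ hK) ?scaler0 //; lia.
Qed.

Lemma d1bar_op_linear m n : linear (@d1bar_op _ _ _ V c m n).
Proof.
move=> a v w; have [K [hv hw]] := bd_pair v w.
have hvw : bd K%:Z (a *: v + w) by exact: bd_lin.
rewrite (d1bar_fin n hv (leqnn _)) (d1bar_fin n hw (leqnn _)) (d1bar_fin n hvw (leqnn _)).
by rewrite scaler_sumr -big_split; apply: eq_bigr => s _ /=; rewrite dbterm_linear.
Qed.

Lemma d1bar_op_polyfun m v : polyfun (fun n => d1bar_op c m n v).
Proof.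
have [K hK] := V_bd v.
have hs : polyfun (fun n => \sum_(s <- rangeZ (K + absz m)) dbterm m n s v).
  apply: polyfun_sum => s _; rewrite /dbterm; case: ltP => _.
    by apply: polyfun_lin; [exact: d1bar_linear|exact: (Ecoef_polyfun c s hK)].
  by have [K1 hK1] := V_bd (d1bar (m - s) v); exact: (Ecoef_polyfun c s hK1).
by apply: polyfun_ext hs => n; rewrite (d1bar_fin n hK (leqnn _)).
Qed.

Lemma d1bar_op_0 m v : d1bar_op c m 0 v = d1bar m v.
Proof.
have [K hK] := V_bd v; rewrite (d1bar_fin 0 hK (leqnn _)).
have E0 s w : Ecoef c 0 s w = if s == 0 then w else 0.
  by have [K1 hK1] := V_bd w; exact: (Ecoef_0 c s hK1).
rewrite (bigD1_seq 0) ?rangeZ_uniq ?mem_rangeZ //= /dbterm !E0 eqxx subr0 if_same.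
rewrite big1 ?addr0 // => s s0.
by rewrite !E0 (negPf s0) (blin0 (d1bar_linear _)) if_same.
Qed.

Variable mu : C.

Lemma dbar_op_linear m n : linear (@dbar_op _ _ _ mu V c m n).
Proof.
move=> a v w; rewrite /dbar_op /Lbar_op /k1bar_op d1bar_op_linear.
rewrite (timesE_linear m n tame_Lbar) (timesE_linear m n tame_k1bar).
rewrite !scalerDr opprD [RHS]addrACA; congr (_ + _); last by rewrite scalerN.
by rewrite [RHS]addrACA !scalerA; congr (_ *: _ + _ + (_ *: _ + _)); ring.
Qed.

Lemma dbar_op_polyfun m v : polyfun (fun n => dbar_op mu c m n v).
Proof.
have h1 := polyfunZ 1 1 (timesE_polyfun m v tame_Lbar).
have h2 := polyfunZ 2 mu (timesE_polyfun m v tame_k1bar).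
have h3 := polyfunZ 0 (-1) (d1bar_op_polyfun m v).
apply: polyfun_ext (polyfunD (polyfunD h1 h2) h3) => n.
by rewrite /dbar_op expr1 mulr1 expr0 mul1r scaleN1r.
Qed.

(** At [n = 0] only the term of [d_1] is left. *)
Lemma dbar_op_0 m v : dbar_op mu c m 0 v = m%:~R *: fmX fd1 m v.
Proof.
rewrite /dbar_op expr0n mul0r !scale0r !add0r d1bar_op_0 /d1bar.
by rewrite rmorphN scaleNr opprK.
Qed.

End OneModule.
End VertexModes.

(** * Operators of total degree zero on one module *)

Section RawOperators.
Variables (C : numFieldType) (g : lieAlgebra C) (form : g -> g -> C) (mu : C).
Hypothesis form0r : forall x, form x 0 = 0.
Notation fk1 := (@fk1 C g).
Notation fd1 := (@fd1 C g).

(** The generators of the toroidal algebra at a fixed power of [t_0], so that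
    the power of [t_1] becomes the variable of a polynomial function. *)
Inductive rawsym := RX (m : int) (x : g) | RK0 (m : int) | RK1 (m : int) | RD (m : int).

Definition rop (V : fmodule form) (c : C) (j : rawsym) (n : int) : V -> V :=
  match j with
  | RX m x => x_op c x m n
  | RK0 m => k0_op c m n
  | RK1 m => k1_op c m n
  | RD m => dbar_op mu c m n
  end.

Definition rword := seq (rawsym * int).
Definition rwop (V : fmodule form) (c : C) (w : rword) (v : V) : V :=
  foldr (fun l => rop c l.1 l.2) v w.
Definition rdeg (w : rword) : int := \sum_(l <- w) l.2.

(** What is needed of a module: vertex operators make sense, and [k_0] and
    [d_1(0)] act as scalars. *)
Record admissible (V : fmodule form) (c : C) : Prop := Admissible {
  adm_bd : forall v : V, exists K : nat, bd K%:Z v;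
  adm_c : c != 0;
  adm_k0 : forall v : V, fmk0 v = c *: v;
  adm_d1 : forall v : V, fmX fd1 0 v = 0
}.

Section OneModule.
Variables (V : fmodule form) (c : C).
Hypothesis V_adm : admissible V c.
Implicit Types (v : V).
Let V_bd := adm_bd V_adm.
Let tL := tame_Lbar form0r V_bd (adm_c V_adm) (adm_k0 V_adm).
Let tX x : tame (fmX (f := V) (fdot_in x)) := tame_fmX form0r V (erefl : (fdot_in x).2 = 0).
Let tk : tame (fmX (f := V) fk1) := tame_fmX form0r V (erefl : fk1.2 = 0).

Lemma rop_linear j n : linear (@rop V c j n).
Proof.
case: j => [m x|m|m|m] /=.
- exact: timesE_linear.
- by move=> a v w; rewrite /k0_op (Ecoef_linear c V_bd) scalerDr !scalerA mulrC.
- exact: timesE_linear.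
exact: (dbar_op_linear form0r V_bd (adm_c V_adm) (adm_k0 V_adm)).
Qed.

Lemma rop_polyfun j v : polyfun (fun n => rop c j n v).
Proof.
case: j => [m x|m|m|m] /=.
- exact: timesE_polyfun.
- have [K hK] := V_bd v.
  apply: polyfun_ext (polyfunZ 0 c (Ecoef_polyfun c m hK)) => n.
  by rewrite expr0 mul1r.
- exact: timesE_polyfun.
exact: (dbar_op_polyfun form0r V_bd (adm_c V_adm) (adm_k0 V_adm)).
Qed.

Lemma rop_X0 m x v : rop c (RX m x) 0 v = fmX (fdot_in x) m v.
Proof. exact: (timesE_0 c V_bd m v (tX x)). Qed.
Lemma rop_K10 m v : rop c (RK1 m) 0 v = fmX fk1 m v.
Proof. exact: (timesE_0 c V_bd m v tk). Qed.
Lemma rop_K00 m v : rop c (RK0 m) 0 v = if m == 0 then c *: v else 0.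
Proof.
have [K hK] := V_bd v.
by rewrite /= /k0_op (Ecoef_0 c m hK); case: ifP; rewrite ?scaler0.
Qed.
Lemma rop_D0 m v : rop c (RD m) 0 v = m%:~R *: fmX fd1 m v.
Proof. exact: (dbar_op_0 V_bd (adm_c V_adm)). Qed.

Lemma rwop_linear w : linear (@rwop V c w).
Proof. by elim: w => [//|l w IH] a u v /=; rewrite IH rop_linear. Qed.

Definition degzero_stable (S : V -> Prop) :=
  forall w, rdeg w = 0 -> forall v, S v -> S (rwop c w v).

Variable S : V -> Prop.
Hypotheses (Ss : subspace S) (S_st : degzero_stable S).

Lemma stable_single j v : S v -> S (rop c j 0 v).
Proof. by move=> Sv; apply: (S_st (w := (j, 0) :: nil)) => //; rewrite /rdeg big_cons big_nil. Qed.

Lemma stable_k1 m v : S v -> S (fmX fk1 m v).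
Proof. by move=> Sv; rewrite -rop_K10; exact: stable_single. Qed.

Lemma stable_d1 m v : S v -> S (fmX fd1 m v).
Proof.
move=> Sv; have [->|m0] := eqVneq m 0; first by rewrite (adm_d1 V_adm); exact: (subspace0 Ss).
apply: (subspace_scaleP Ss (a := m%:~R)); first by rewrite intr_eq0.
by rewrite -rop_D0; exact: stable_single.
Qed.

Lemma stable_X x m v : S v -> S (fmX x m v).
Proof.
case: x => [[x b] e] Sv.
have -> : ((x, b, e) : fdot g) = fdot_in x + ((b : C) *: fk1 + (e : C) *: fd1).
  rewrite /fdot_in /Defs.fk1 /Defs.fd1; congr (_, _, _).
  - by rewrite /= !scaler0 !addr0.
  - by rewrite /= -[b *: 1]/(b * 1) mulr1 scaler0 addr0 add0r.
  by rewrite /= -[e *: 1]/(e * 1) mulr1 scaler0 !add0r.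
rewrite !(blinD (fmX_linearl m v)) !(blinZ (fmX_linearl m v)).
apply: (subspaceD Ss); first by rewrite -rop_X0; exact: stable_single.
apply: (subspaceD Ss); apply: (subspaceZ Ss); [exact: stable_k1|exact: stable_d1].
Qed.

Lemma stable_powcoef (A : nat -> V -> V) q s v :
  (forall j w, S w -> S (A j w)) -> S v -> S (powcoef A q s v).
Proof.
move=> hA Sv; elim: q s => [|q IH] s /=.
  by case: ifP => _ //; exact: (subspace0 Ss).
by apply: (subspace_sum Ss) => j _; exact: hA.
Qed.

Lemma stable_expcoef (A : nat -> V -> V) s v :
  (forall j w, S w -> S (A j w)) -> S v -> S (expcoef A s v).
Proof.
by move=> hA Sv; apply: (subspace_sum Ss) => q _; apply: (subspaceZ Ss); exact: stable_powcoef.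
Qed.

Lemma stable_Ecoef n s v : S v -> S (Ecoef c n s v).
Proof.
move=> Sv; apply: (subspace_sum Ss) => q _.
by do 2!(apply: stable_expcoef => [j w Sw|]; first by apply: (subspaceZ Ss); exact: stable_k1).
Qed.

Lemma stable_d1k1 m v : S v -> S (d1k1 m v).
Proof.
move=> Sv; apply: (subspace_sum Ss) => p _; case: ifP => _.
  by apply: stable_d1; exact: stable_k1.
by apply: stable_k1; exact: stable_d1.
Qed.

(** The modes of [L] are recovered from the degree zero elements
    [D(m, n) K_0(0, -n)]: up to terms built from [k_1] and [d_1], they are
    [n h(n)] with [h] polynomial and [h 0] the mode of the field [Lbar]. *)
Lemma stable_L m v : S v -> S (fmL m v).
Proof.
move=> Sv; pose h n := timesE c (Lbar (V := V) c) m n (Ecoef c (- n) 0 v).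
have hp : polyfun h.
  have [K hK] := V_bd v.
  apply: (polyfun_op (Y := fun n => timesE c (Lbar c) m n)) => [n|w|].
  - exact: timesE_linear.
  - exact: timesE_polyfun.
  have := polyfun_affine 0 (-1) (Ecoef_polyfun c 0 hK).
  by apply: polyfun_ext => n; rewrite add0r mulN1r.
have hS n : 0 < n -> S (h n).
  move=> n0; have nn : (n%:~R : C) != 0 by rewrite intr_eq0 gt_eqF.
  have := S_st (w := (RD m, n) :: (RK0 0, - n) :: nil) _ Sv.
  rewrite /rdeg !big_cons big_nil addr0 subrr => /(_ erefl).
  rewrite -[rwop _ _ _]/(rop c (RD m) n (c *: Ecoef c (- n) 0 v)) (blinZ (rop_linear (RD m) n)).
  move/(subspace_scaleP Ss (adm_c V_adm)).
  set w := Ecoef c (- n) 0 v; have Sw : S w by exact: stable_Ecoef.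
  rewrite /= /dbar_op -addrA addrC => hD.
  apply: (subspace_scaleP Ss nn); apply: (subspace_addl Ss _ hD).
  apply: (subspaceB Ss).
    apply: (subspaceZ Ss); apply: (subspace_sum Ss) => s _.
    by apply: (subspaceZ Ss); apply: stable_k1; exact: stable_Ecoef.
  apply: (subspace_sum Ss) => s _; case: ifP => _.
    by apply: (subspaceZ Ss); apply: stable_d1; exact: stable_Ecoef.
  by apply: stable_Ecoef; apply: (subspaceZ Ss); exact: stable_d1.
have := polyfun_extend Ss hp hS 0; rewrite /h oppr0.
have [K hK] := V_bd v; rewrite (Ecoef_0 c 0 hK) eqxx (timesE_0 c V_bd m v tL) /Lbar addrC.
by apply: (subspace_addl Ss); rewrite -scaleNr; apply: (subspaceZ Ss); exact: stable_d1k1.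
Qed.

End OneModule.

Section Morphisms.
Variables (V W : fmodule form) (c : C) (th : V -> W).
Hypotheses (V_adm : admissible V c) (W_adm : admissible W c).
Hypothesis thl : linear th.
Hypothesis thX : forall x m v, th (fmX x m v) = fmX x m (th v).
Hypothesis thL : forall m v, th (fmL m v) = fmL m (th v).
Let V_bd := adm_bd V_adm.
Let W_bd := adm_bd W_adm.

Lemma bd_nat B v : bd B v -> bd B (th v).
Proof.
have e w u : th (wop w u) = wop w (th u).
  by elim: w => [//|[[x|] m] w IH] /=; rewrite /mop /= ?thX ?thL IH.
by move=> h w /h hw; rewrite -e hw; exact: (blin0 thl).
Qed.

Lemma Ecoef_mor n s v : th (Ecoef c n s v) = Ecoef c n s (th v).
Proof.
have [K hK] := V_bd v.
by apply: (Ecoef_nat c thl _ n s hK (bd_nat hK)) => j w; exact: thX.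
Qed.

Lemma timesE_mor (F : int -> V -> V) (G : int -> W -> W) m n v : tame F -> tame G ->
  (forall p u, th (F p u) = G p (th u)) -> th (timesE c F m n v) = timesE c G m n (th v).
Proof.
move=> tF tG FG; have [K hK] := V_bd v.
rewrite (timesE_fin c V_bd n tF hK (leqnn _)) (timesE_fin c W_bd n tG (bd_nat hK) (leqnn _)).
by rewrite (blin_sum thl); apply: eq_bigr => s _; rewrite FG Ecoef_mor.
Qed.

Lemma Lbar_mor p v : th (Lbar c p v) = Lbar c p (th v).
Proof.
rewrite /Lbar (blinB thl) (blinZ thl) thL; congr (_ - _ *: _).
have [K hK] := V_bd v.
rewrite (d1k1_fin hK (leqnn _)) (d1k1_fin (bd_nat hK) (leqnn _)).
rewrite (blin_sum thl); apply: eq_bigr => s _.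
by rewrite /dkterm; case: ifP => _; rewrite !thX.
Qed.

Lemma rop_mor j n v : th (rop c j n v) = rop c j n (th v).
Proof.
case: j => [m x|m|m|m] /=.
- apply: timesE_mor => [||p u]; [exact: tame_fmX|exact: tame_fmX|exact: thX].
- by rewrite /k0_op (blinZ thl) Ecoef_mor.
- apply: timesE_mor => [||p u]; [exact: tame_fmX|exact: tame_fmX|exact: thX].
rewrite /dbar_op (blinB thl) (blinD thl) !(blinZ thl); congr (_ *: _ + _ *: _ - _).
- apply: timesE_mor => [||p u]; last exact: Lbar_mor.
    exact: (tame_Lbar form0r V_bd (adm_c V_adm) (adm_k0 V_adm)).
  exact: (tame_Lbar form0r W_bd (adm_c W_adm) (adm_k0 W_adm)).
- apply: timesE_mor => [||p u]; [exact: tame_k1bar|exact: tame_k1bar|].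
  by rewrite /k1bar (blinZ thl) thX.
have [K hK] := V_bd v.
rewrite (d1bar_fin V_bd (adm_c V_adm) n hK (leqnn _)) (d1bar_fin W_bd (adm_c W_adm) n (bd_nat hK) (leqnn _)).
rewrite (blin_sum thl); apply: eq_bigr => s _; rewrite /dbterm.
by case: ifP => _; rewrite ?Ecoef_mor /d1bar (blinZ thl) thX ?Ecoef_mor.
Qed.

Lemma rwop_mor w v : th (rwop c w v) = rwop c w (th v).
Proof. by elim: w => [//|l w IH] /=; rewrite rop_mor IH. Qed.

End Morphisms.

End RawOperators.

(** * Rigidity of correspondences between irreducible modules *)

Section Product.
Variables (C : numFieldType) (g : lieAlgebra C) (form : g -> g -> C) (V W : fmodule form).

Lemma pair_eq (A B : Type) (p q : A * B) : p.1 = q.1 -> p.2 = q.2 -> p = q.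
Proof. by case: p q => [a b] [a' b'] /= -> ->. Qed.

Let pw (A : V -> V) (B : W -> W) (p : V * W) : V * W := (A p.1, B p.2).

(** The product of two modules lets a relation between them be treated as a
    subspace of one module. *)
Definition fm_prod : fmodule form.
Proof.
refine (@FModule C g form (V * W)%type (fun m => pw (fmL m) (fmL m))
  (fun x m => pw (fmX x m) (fmX x m)) (pw (@fmk0 _ _ _ V) (@fmk0 _ _ _ W))
  (pw (@fmkv _ _ _ V) (@fmkv _ _ _ W)) _ _ _ _ _ _ _ _ _ _ _ _ _).
- by move=> m a u v; apply: pair_eq; exact: fmL_linear.
- by move=> x m a u v; apply: pair_eq; exact: fmX_linear.
- by move=> m v a x y; apply: pair_eq; exact: fmX_linearl.
- by move=> a u v; apply: pair_eq; exact: fmk0_linear.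
- by move=> a u v; apply: pair_eq; exact: fmkv_linear.
- by move=> m n v; apply: pair_eq => /=; rewrite fmLL; case: ifP.
- by move=> x y m n v; apply: pair_eq => /=; rewrite fmXX; case: ifP.
- by move=> x m n v; apply: pair_eq => /=; rewrite fmLX.
- by move=> m v; apply: pair_eq; exact: fmk0L.
- by move=> x m v; apply: pair_eq; exact: fmk0X.
- by move=> m v; apply: pair_eq; exact: fmkvL.
- by move=> x m v; apply: pair_eq; exact: fmkvX.
- by move=> v; apply: pair_eq; exact: fmk0kv.
Defined.

Lemma wop_prod w (p : fm_prod) : wop w p = (wop w p.1, wop w p.2).
Proof.
elim: w => [|l w IH]; first by case: p.
by rewrite /= IH; case: l => [[x|] m].
Qed.

Lemma adm_prod c : admissible V c -> admissible W c -> admissible fm_prod c.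
Proof.
move=> hV hW; split.
- move=> [v w]; have [K hK] := adm_bd hV v; have [K' hK'] := adm_bd hW w.
  exists (K + K')%N => r hr; rewrite wop_prod /= hK ?hK' //.
    by apply: le_lt_trans hr; rewrite lez_nat leq_addl.
  by apply: le_lt_trans hr; rewrite lez_nat leq_addr.
- exact: adm_c hV.
- by move=> [v w]; apply: pair_eq => /=; [exact: adm_k0 hV v|exact: adm_k0 hW w].
by move=> [v w]; apply: pair_eq => /=; [exact: adm_d1 hV v|exact: adm_d1 hW w].
Qed.

End Product.

Section Rigidity.
Variables (C : numFieldType) (g : lieAlgebra C) (H : {vspace g}).
Variables (pos : hdual H -> Prop) (form : g -> g -> C) (mu : C).
Hypothesis triangular : triangular_decomposable pos.
Hypothesis pos_sum : no_null_positive_sum pos.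
Hypothesis form0r : forall x, form x 0 = 0.

Lemma wt_barE (lam : weight H) (u : f0car H) :
  wt_bar mu lam u = lam u.1.1 + 24%:R * mu * wt_k0 lam * u.2 :> C.
Proof.
pose f (u : f0car H) : C^o := lam u.1.1 + 24%:R * mu * wt_k0 lam * u.2.
have fl : linear f.
  move=> a x y; rewrite /f /= linearP /= mulrDr addrACA -[a *: (_ + _)]/(a * _) mulrDr.
  by congr (_ + _ + (_ + _)); rewrite -[_ *: _]/(a * _) mulrCA.
pose F : {linear f0car H -> C^o} := HB.pack f (GRing.isLinear.Build C _ C^o _ _ fl).
exact: (lfunE F u).
Qed.

Lemma wt_bar_k0 (lam : weight H) : wt_bar mu lam ((0, 1, 0), (0, 0), 0) = wt_k0 lam.
Proof. by rewrite wt_barE /= mulr0 addr0. Qed.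
Lemma wt_bar_kv (lam : weight H) : wt_bar mu lam ((0, 0, 0), (0, 0), 1) = 24%:R * mu * wt_k0 lam.
Proof. by rewrite wt_barE /= mulr1 linear0 add0r. Qed.
Lemma wt_bar_center (lam : weight H) (b e : C) : wt_bar mu lam ((0, 0, 0), (b, e), 0) = 0.
Proof. by rewrite wt_barE /= mulr0 linear0 addr0. Qed.

Lemma wt_bar_inj : injective (@wt_bar C g H mu).
Proof.
move=> lam lam' h; apply/lfunP => u.
have := congr1 (fun e : fweight H => e (u, (0, 0), 0) : C) h.
by rewrite /= !wt_barE /= !mulr0 !addr0.
Qed.

Section OneModule.
Variables (V : fmodule form) (lam : weight H) (Om : V).
Hypothesis V_irr : irreducible_submodule (@fact _ _ _ V) (fun _ => True).
Hypothesis V_hw : highest_weight_vector pos (wt_bar mu lam) Om.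
Hypothesis c0 : wt_k0 lam != 0.

Lemma hw_admissible : admissible V (wt_k0 lam).
Proof.
split=> [v||v|v].
- have [B hB] := hw_bd V_irr V_hw v; exists (absz B); apply: bd_le hB; lia.
- exact: c0.
- by rewrite (hw_k0 V_irr V_hw) wt_bar_k0.
by rewrite (hw_center V_irr V_hw 0 1 v) wt_bar_center scale0r.
Qed.

Lemma hw_kv_wt v : fmkv v = (24%:R * mu * wt_k0 lam) *: v :> V.
Proof. by rewrite (hw_kv V_irr V_hw) wt_bar_kv. Qed.

(** A subspace stable under degree zero words is a submodule for the whole
    Virasoro-affine algebra, by [stable_X] and [stable_L]. *)
Lemma degzero_irreducible (S : V -> Prop) v : subspace S ->
  degzero_stable mu (wt_k0 lam) S -> S v -> v <> 0 -> forall u, S u.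
Proof.
move=> Ss S_st Sv v0; apply: (irr_full V_irr _ Sv v0); apply: fstable_letters => //.
- move=> [[x|] m] u Su; rewrite /mop /=.
    exact: (stable_X form0r hw_admissible Ss S_st).
  exact: (stable_L form0r hw_admissible Ss S_st).
- by move=> u Su; rewrite (adm_k0 hw_admissible); exact: subspaceZ.
by move=> u Su; rewrite hw_kv_wt; exact: subspaceZ.
Qed.

End OneModule.

Section Relation.
Variables (V W : fmodule form) (lam lam' : weight H) (Om : V) (Om' : W).
Hypothesis V_irr : irreducible_submodule (@fact _ _ _ V) (fun _ => True).
Hypothesis W_irr : irreducible_submodule (@fact _ _ _ W) (fun _ => True).
Hypothesis V_hw : highest_weight_vector pos (wt_bar mu lam) Om.
Hypothesis W_hw : highest_weight_vector pos (wt_bar mu lam') Om'.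
Hypothesis c0 : wt_k0 lam != 0.
Hypothesis c'0 : wt_k0 lam' != 0.

Variable S : W -> V -> Prop.
Hypothesis S0 : S 0 0.
Hypothesis Slin : forall a w v w' v', S w v -> S w' v' -> S (a *: w + w') (a *: v + v').
Hypothesis Sst : forall r w v, rdeg r = 0 -> S w v ->
  S (rwop mu (wt_k0 lam') r w) (rwop mu (wt_k0 lam) r v).
Hypothesis Sfun : forall v, S 0 v -> v = 0.

Let V_adm := hw_admissible V_irr V_hw c0.
Let W_adm := hw_admissible W_irr W_hw c'0.

(** A nonzero partial map commuting with the degree zero operators commutes
    with the whole Virasoro-affine algebra, so it carries the highest weight
    vector to a highest weight vector. *)
Lemma rigid_graph w0 v0 : S w0 v0 -> v0 <> 0 ->
  [/\ lam' = lam, forall x m w v, S w v -> S (fmX x m w) (fmX x m v),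
      forall m w v, S w v -> S (fmL m w) (fmL m v)
    & exists t : C, S Om' (t *: Om)].
Proof.
move=> Swv v00.
(* The word [k_0(0,0)] compares the levels, so that both modules can be treated
   at the same level. *)
have cc : wt_k0 lam' = wt_k0 lam.
  apply/eqP; rewrite eq_sym -subr_eq0; apply: contrapT => /negP d0; apply: v00.
  have := Sst (r := (RK0 g 0, 0) :: nil) _ Swv; rewrite /rdeg big_cons big_nil addr0 => /(_ erefl).
  have K0 (M : fmodule form) c (M_adm : admissible M c) (u : M) :
      rwop mu c ((RK0 g 0, 0) :: nil) u = c *: u.
    by rewrite -[LHS]/(rop mu c (RK0 g 0) 0 u) (rop_K00 mu M_adm).
  rewrite (K0 _ _ V_adm) (K0 _ _ W_adm) => /(Slin (- wt_k0 lam') Swv).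
  rewrite scaleNr addNr scaleNr addrC -scalerBl => /Sfun h.
  by rewrite -[v0](scalerK d0) h scaler0.
have W_adm' : admissible W (wt_k0 lam) by rewrite -cc.
have P_adm := adm_prod W_adm' V_adm.
pose SP (p : fm_prod W V) := S p.1 p.2.
have SPs : subspace SP by split=> // a p q; exact: Slin.
have rw1 r (p : fm_prod W V) : (rwop mu (wt_k0 lam) r p).1 = rwop mu (wt_k0 lam) r p.1.
  by by apply: (@rwop_mor _ _ _ mu form0r (fm_prod W V) W _ fst P_adm W_adm').
have rw2 r (p : fm_prod W V) : (rwop mu (wt_k0 lam) r p).2 = rwop mu (wt_k0 lam) r p.2.
  by apply: (@rwop_mor _ _ _ mu form0r (fm_prod W V) V _ snd P_adm V_adm).
have SPst : degzero_stable mu (wt_k0 lam) SP.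
  move=> r r0 p Sp; rewrite /SP rw1 rw2; have := Sst r0 Sp.
  by rewrite cc.
have SX x m w v : S w v -> S (fmX x m w) (fmX x m v).
  exact: (stable_X form0r P_adm SPs SPst x m (v := (w, v))).
have SL m w v : S w v -> S (fmL m w) (fmL m v).
  exact: (stable_L form0r P_adm SPs SPst m (v := (w, v))).
have Sl l w v : S w v -> S (mop l w) (mop l v).
  by case: l => [[x|] m]; [exact: SX|exact: SL].
have Wk0 (w : W) : fmk0 w = wt_k0 lam *: w by exact: (adm_k0 W_adm').
have Wkv w : fmkv w = (24%:R * mu * wt_k0 lam) *: w :> W.
  by rewrite (hw_kv_wt W_irr W_hw) cc.
have Vkv := hw_kv_wt V_irr V_hw.
have SZ a w v : S w v -> S (a *: w) (a *: v).
  by move=> h; have := Slin a h S0; rewrite !addr0.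
have Sf0 u w v : S w v -> S (f0act u w) (f0act (u : f0car H) v).
  case: u => [[[[h b0] e0] [b1 e1]] bv] Sw; rewrite /f0act.
  have SD w1 v1 w2 v2 : S w1 v1 -> S w2 v2 -> S (w1 + w2) (v1 + v2).
    by move=> h1 h2; have := Slin 1 h1 h2; rewrite !scale1r.
  apply: (SD); last by apply: (SZ); rewrite Wkv Vkv; exact: SZ.
  apply: (SD); last by rewrite -!scaleNr; apply: (SZ); exact: SL.
  apply: (SD); last by apply: (SZ); rewrite Wk0 (adm_k0 V_adm); exact: SZ.
  exact: SX.
have w00 : w0 <> 0 by move=> h; apply: v00; apply: Sfun; rewrite -h.
have [y Sy] : exists y, S Om' y.
  apply: (irr_full W_irr (W := fun w => exists v, S w v) _ _ w00); last by exists v0.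
  apply: fstable_letters.
  - split; first by exists 0.
    by move=> a u v [u' hu] [v' hv]; exists (a *: u' + v'); exact: Slin.
  - by move=> l w [v hv]; exists (mop l v); exact: Sl.
  - by move=> w [v hv]; exists (wt_k0 lam *: v); rewrite Wk0; exact: SZ.
  - by move=> w [v hv]; exists ((24%:R * mu * wt_k0 lam) *: v); rewrite Wkv; exact: SZ.
have y0 : y <> 0.
  move=> y0; rewrite y0 in Sy; apply: v00; apply: Sfun.
  suff Sw0 : S w0 0 by have := Slin (-1) Sw0 Swv; rewrite scaler0 add0r scaleN1r addNr.
  apply: (irr_full W_irr (W := fun w => S w 0) _ Sy (hw_neq0 W_hw)).
  apply: fstable_letters.
  - by split=> // a u v hu hv; have := Slin a hu hv; rewrite scaler0 addr0.
  - by move=> l w hw; have := Sl l _ _ hw; rewrite (blin0 (@mop_linear _ _ _ V l)).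
  - by move=> w hw; have := SZ (wt_k0 lam) _ _ hw; rewrite Wk0 scaler0.
  - by move=> w hw; have := SZ (24%:R * mu * wt_k0 lam) _ _ hw; rewrite Wkv scaler0.
have y_hw : highest_weight_vector pos (wt_bar mu lam') y.
  have [_ p1 n1 f1] := W_hw; split.
  - exact/eqP.
  - move=> m m0; have [l1 x1] := p1 m m0; split=> [|x]; apply: Sfun.
      by rewrite -l1; exact: SL.
    by rewrite -(x1 x); exact: SX.
  - by move=> x hx; apply: Sfun; rewrite -(n1 x hx); exact: SX.
  move=> u; apply/eqP; rewrite -subr_eq0; apply/eqP; apply: Sfun.
  have := Slin (- (wt_bar mu lam' u : C)) Sy (Sf0 u _ _ Sy).
  by rewrite f1 scaleNr addNr scaleNr addrC.
have [wtE [t yE]] := hw_unique triangular pos_sum V_irr V_hw y_hw.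
split=> //; last by exists t; rewrite -yE.
exact: (wt_bar_inj (esym wtE)).
Qed.

End Relation.

Lemma rigid_neq (V W : fmodule form) (lam lam' : weight H) (Om : V) (Om' : W) (S : W -> V -> Prop) :
  irreducible_submodule (@fact _ _ _ V) (fun _ => True) ->
  irreducible_submodule (@fact _ _ _ W) (fun _ => True) ->
  highest_weight_vector pos (wt_bar mu lam) Om ->
  highest_weight_vector pos (wt_bar mu lam') Om' ->
  wt_k0 lam != 0 -> wt_k0 lam' != 0 -> lam' <> lam -> S 0 0 ->
  (forall a w v w' v', S w v -> S w' v' -> S (a *: w + w') (a *: v + v')) ->
  (forall r w v, rdeg r = 0 -> S w v ->
     S (rwop mu (wt_k0 lam') r w) (rwop mu (wt_k0 lam) r v)) ->
  (forall v, S 0 v -> v = 0) -> forall w v, S w v -> v = 0.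
Proof.
move=> V_irr W_irr V_hw W_hw c0 c'0 ll S0 Slin Sst Sfun w v Sw.
apply: contrapT => v0.
by have [] := rigid_graph V_irr W_irr V_hw W_hw c0 c'0 S0 Slin Sst Sfun Sw v0.
Qed.

(** By [rigid_graph] the relation contains the graph of multiplication by some
    [t], and it is single valued. *)
Lemma rigid_eq (V : fmodule form) (lam : weight H) (Om : V) (S : V -> V -> Prop) :
  irreducible_submodule (@fact _ _ _ V) (fun _ => True) ->
  highest_weight_vector pos (wt_bar mu lam) Om ->
  wt_k0 lam != 0 -> S 0 0 ->
  (forall a w v w' v', S w v -> S w' v' -> S (a *: w + w') (a *: v + v')) ->
  (forall r w v, rdeg r = 0 -> S w v ->
     S (rwop mu (wt_k0 lam) r w) (rwop mu (wt_k0 lam) r v)) ->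
  (forall v, S 0 v -> v = 0) -> exists t : C, forall w v, S w v -> v = t *: w.
Proof.
move=> V_irr V_hw c0 S0 Slin Sst Sfun.
case: (pselect (exists w v, S w v /\ v <> 0)) => [[w0 [v0 [S0v v00]]]|h]; last first.
  exists 0 => w v Sw; rewrite scale0r; apply: contrapT => v0; apply: h; by exists w, v.
have [_ SX SL [t SOm]] := rigid_graph V_irr V_irr V_hw V_hw c0 c0 S0 Slin Sst Sfun S0v v00.
have V_adm := hw_admissible V_irr V_hw c0.
have Vkv := hw_kv_wt V_irr V_hw.
have SZ a w v : S w v -> S (a *: w) (a *: v).
  by move=> h; have := Slin a _ _ _ _ h S0; rewrite !addr0.
have all_t w : S w (t *: w).
  move: w; apply: (irr_full V_irr (W := fun w => S w (t *: w)) _ SOm (hw_neq0 V_hw)).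
  apply: fstable_letters.
  - split=> [|a u v hu hv]; first by rewrite scaler0.
    by have := Slin a _ _ _ _ hu hv; rewrite scalerDr !scalerA mulrC.
  - move=> [[x|] m] w hw; rewrite /mop /=.
      by have := SX x m _ _ hw; rewrite (blinZ (fmX_linear _ _)).
    by have := SL m _ _ hw; rewrite (blinZ (fmL_linear _)).
  - by move=> w hw; rewrite (adm_k0 V_adm) scalerA [t * _]mulrC -scalerA; exact: SZ.
  - by move=> w hw; rewrite Vkv scalerA [t * _]mulrC -[X in S _ X]scalerA; exact: SZ.
exists t => w v Sw; apply/eqP; rewrite -subr_eq0; apply/eqP; apply: Sfun.
by have := Slin (-1) _ _ _ _ (all_t w) Sw; rewrite !scaleN1r addNr addrC.
Qed.

End Rigidity.

(** * Density of the degree zero operators *)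

Section Span.
Variables (C : fieldType) (W : lmodType C).
Implicit Types (x y : W) (ys : seq W).

(** The span of a list, by recursion on the list, as the bicommutant argument
    proceeds. *)
Fixpoint lspan ys x : Prop :=
  if ys is y :: ys' then exists t : C, lspan ys' (x - t *: y) else x = 0.

Lemma lspan_cons y ys x : lspan ys x -> lspan (y :: ys) x.
Proof. by move=> h; exists 0; rewrite scale0r subr0. Qed.

Lemma lspan_sub ys : subspace (lspan ys).
Proof.
elim: ys => [|y ys [h0 hl]]; first by split=> // a u v -> ->; rewrite scaler0 addr0.
split=> [|a u v [t hu] [s hv]]; first by apply: lspan_cons.
exists (a * t + s); have := hl a _ _ hu hv; congr lspan.
by rewrite scalerBr scalerA scalerDl opprD addrACA.
Qed.

Lemma lspan_mem ys y : y \in ys -> lspan ys y.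
Proof.
elim: ys => [//|z ys IH]; rewrite inE => /predU1P[->|/IH]; last exact: lspan_cons.
by exists 1; rewrite scale1r subrr; exact: (subspace0 (lspan_sub ys)).
Qed.

End Span.

Section Density.
Variables (C : numFieldType) (g : lieAlgebra C) (H : {vspace g}).
Variables (pos : hdual H -> Prop) (form : g -> g -> C) (mu : C).
Hypothesis triangular : triangular_decomposable pos.
Hypothesis pos_sum : no_null_positive_sum pos.
Hypothesis form0r : forall x, form x 0 = 0.
Variable V : fweight H -> fmodule form.
Hypothesis V_irr : forall eta, irreducible_highest_weight pos eta (V eta).

(** The factors are taken in a family indexed by all weights, so that an
    operator can be given uniformly on factors with equal or different weights. *)
Definition irmod (lam : weight H) : fmodule form := V (wt_bar mu lam).
Notation M := irmod.
Implicit Types (lam : weight H).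

Let M_irr lam : irreducible_submodule (@fact _ _ _ (M lam)) (fun _ => True).
Proof. by case: (V_irr (wt_bar mu lam)). Qed.
Let M_hw lam : exists Om : M lam, highest_weight_vector pos (wt_bar mu lam) Om.
Proof. by case: (V_irr (wt_bar mu lam)). Qed.

Lemma irmod_admissible lam : wt_k0 lam != 0 -> admissible (M lam) (wt_k0 lam).
Proof. by have [Om hOm] := M_hw lam; exact: (hw_admissible (M_irr lam) hOm). Qed.

(** Operators defined uniformly on all the modules at once by words of total
    [t_1]-degree zero. *)
Inductive degzero : (forall lam, M lam -> M lam) -> Prop :=
  | degzero_word w : rdeg w = 0 -> degzero (fun lam => rwop mu (wt_k0 lam) w)
  | degzero_lin a b b' : degzero b -> degzero b' ->
      degzero (fun lam v => a *: b lam v + b' lam v)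
  | degzero_comp b b' : degzero b -> degzero b' -> degzero (fun lam v => b lam (b' lam v)).

Lemma rdeg_nil : rdeg (nil : rword g) = 0.
Proof. exact: big_nil. Qed.

Lemma degzero_id : degzero (fun _ v => v).
Proof. exact: (degzero_word rdeg_nil). Qed.

Lemma degzero_linear b lam : degzero b -> wt_k0 lam != 0 -> linear (b lam).
Proof.
move=> hb l0; elim: hb => [w _|a b1 b2 _ h1 _ h2|b1 b2 _ h1 _ h2] c u v.
- exact: (rwop_linear mu form0r (irmod_admissible l0)).
- by rewrite h1 h2 !scalerDr !scalerA addrACA mulrC.
by rewrite h2 h1.
Qed.

Record left_ideal (I : (forall lam, M lam -> M lam) -> Prop) : Prop := LeftIdeal {
  li_deg : forall b, I b -> degzero b;
  li_ne : exists b, I b;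
  li_lin : forall a b b', I b -> I b' -> I (fun lam v => a *: b lam v + b' lam v);
  li_word : forall w b, rdeg w = 0 -> I b -> I (fun lam v => rwop mu (wt_k0 lam) w (b lam v))
}.

Definition ann lam (ys : seq (M lam)) (zs : seq {mu' : weight H & M mu'}) b :=
  [/\ degzero b, forall y, y \in ys -> b lam y = 0
    & forall z, List.In z zs -> b (projT1 z) (projT2 z) = 0].

Definition good_list lam (zs : seq {mu' : weight H & M mu'}) :=
  forall z, List.In z zs -> projT1 z <> lam /\ wt_k0 (projT1 z) != 0.

Lemma ann_ideal lam ys zs : wt_k0 lam != 0 -> good_list lam zs -> left_ideal (@ann lam ys zs).
Proof.
move=> l0 hz.
have rlin (ka : weight H) w : wt_k0 ka != 0 -> linear (rwop mu (wt_k0 ka) w : M ka -> M ka).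
  by move=> k0; exact: (rwop_linear mu form0r (irmod_admissible k0)).
split.
- by move=> b [].
- exists (fun ka v => (-1) *: v + v); split.
  + by apply: (degzero_lin (-1) degzero_id); exact: degzero_id.
  + by move=> y _; rewrite scaleN1r addNr.
  by move=> z _; rewrite scaleN1r addNr.
- move=> a b b' [d1 y1 z1] [d2 y2 z2]; split.
  + exact: degzero_lin.
  + by move=> y ys'; rewrite y1 // y2 // scaler0 addr0.
  by move=> z zs'; rewrite z1 // z2 // scaler0 addr0.
move=> w b w0 [d1 y1 z1]; split.
- exact: (degzero_comp (degzero_word w0)).
- by move=> y ys'; rewrite y1 // (blin0 (rlin _ w l0)).
by move=> z zs'; rewrite z1 // (blin0 (rlin _ w _)) //; case: (hz z zs').
Qed.

(** The values at [x] of the members of a left ideal form a subspace stable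
    under degree zero words. *)
Lemma ideal_image I lam x b : left_ideal I -> wt_k0 lam != 0 -> I b -> b lam x <> 0 ->
  forall w : M lam, exists2 b', I b' & b' lam x = w.
Proof.
move=> hI l0 Ib bx w; have [Om hOm] := M_hw lam.
have Ss : subspace (fun w => exists b', I b' /\ b' lam x = w).
  split=> [|a u v [b1 [I1 <-]] [b2 [I2 <-]]].
    by exists (fun ka v => (-1) *: b ka v + b ka v); split; [exact: li_lin|rewrite scaleN1r addNr].
  by exists (fun ka v => a *: b1 ka v + b2 ka v); split=> //; exact: li_lin.
have St : degzero_stable mu (wt_k0 lam) (fun w : M lam => exists b', I b' /\ b' lam x = w).
  move=> r r0 v [b1 [I1 <-]].
  by exists (fun ka v => rwop mu (wt_k0 ka) r (b1 ka v)); split=> //; exact: li_word.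
have Sbx : exists b', I b' /\ b' lam x = b lam x by exists b.
have [b' [Ib' <-]] := degzero_irreducible form0r (M_irr lam) hOm l0 Ss St Sbx bx w.
by exists b'.
Qed.

(** Jacobson density for the family of modules.  If everything killing [ys]
    and [zs] kills [x], then for a [z] of [zs] or a [y] of [ys] the relation
    between [b z] or [b y] and [b x], for [b] killing the rest of the lists, is
    single valued.  Rigidity makes it zero for [z], so that [z] can be dropped,
    and a scalar [t] for [y], so that [y] can be dropped from the list if [x] is
    replaced by [x - t y]. *)
Lemma bicommutant lam (ys : seq (M lam)) zs x : wt_k0 lam != 0 -> good_list lam zs ->
  (forall b, ann ys zs b -> b lam x = 0) -> lspan ys x.
Proof.
move=> l0; have [Om hOm] := M_hw lam.
elim: ys x => [|y ys IH] x hz hx.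
  elim: zs x hz hx => [|[ka z] zs IH] x hz hx.
    have := hx (fun _ v => v); rewrite /= => -> //.
    by split=> //; exact: degzero_id.
  have hz' : good_list lam zs by move=> z' z's; apply: hz; right.
  have [/= ka_lam ka0] := hz (existT _ ka z) (or_introl erefl).
  have [Om' hOm'] := M_hw ka.
  have hI := @ann_ideal lam nil zs l0 hz'.
  apply: IH => // b0 hb0.
  apply: (@rigid_neq _ _ _ _ _ mu triangular pos_sum form0r (M lam) (M ka) lam ka Om Om'
    (fun w v => exists2 b, @ann lam nil zs b & w = b ka z /\ v = b lam x)
    (M_irr lam) (M_irr ka) hOm hOm' l0 ka0 ka_lam _ _ _ _ (b0 ka z)); last by exists b0.
  - have [b Ib] := li_ne hI; exists (fun la v => (-1) *: b la v + b la v); first exact: (li_lin hI).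
    by rewrite !scaleN1r !addNr.
  - move=> a w v w' v' [b1 I1 [-> ->]] [b2 I2 [-> ->]].
    by exists (fun la v => a *: b1 la v + b2 la v) => //; exact: (li_lin hI).
  - move=> r w v r0 [b1 I1 [-> ->]].
    by exists (fun la v => rwop mu (wt_k0 la) r (b1 la v)) => //; exact: (li_word hI).
  move=> v [b [d1 y1 z1] [bz ->]]; apply: hx; split=> // z' [<- //=|]; last exact: z1.
have hI := @ann_ideal lam ys zs l0 hz.
have [||||t ht] := @rigid_eq _ _ _ _ _ mu triangular pos_sum form0r (M lam) lam Om
    (fun w v => exists2 b, ann ys zs b & w = b lam y /\ v = b lam x) (M_irr lam) hOm l0.
- have [b Ib] := li_ne hI; exists (fun la v => (-1) *: b la v + b la v); first exact: (li_lin hI).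
  by rewrite !scaleN1r !addNr.
- move=> a w v w' v' [b1 I1 [-> ->]] [b2 I2 [-> ->]].
  by exists (fun la v => a *: b1 la v + b2 la v) => //; exact: (li_lin hI).
- move=> r w v r0 [b1 I1 [-> ->]].
  by exists (fun la v => rwop mu (wt_k0 la) r (b1 la v)) => //; exact: (li_word hI).
- move=> v [b [d1 y1 z1] [bz ->]]; apply: hx; split=> // y'.
  by rewrite inE => /predU1P[->|/y1 //]; rewrite -bz.
exists t; apply: IH => // b hb; have [db _ _] := hb.
have bl := degzero_linear db l0.
rewrite (blinB bl) (blinZ bl) (ht (b lam y) (b lam x)); first by rewrite subrr.
by exists b.
Qed.

Lemma density lam (ys : seq (M lam)) zs x w : wt_k0 lam != 0 -> good_list lam zs ->
  ~ lspan ys x -> exists2 b, ann ys zs b & b lam x = w.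
Proof.
move=> l0 hz hx.
have [b0 [hb0 bx]] : exists b, ann ys zs b /\ b lam x <> 0.
  apply: contrapT => /forallNP h; apply: hx; apply: (bicommutant l0 hz) => b hb.
  by apply: contrapT => bx; apply: (h b).
exact: (ideal_image (ann_ideal ys l0 hz) l0 hb0 bx w).
Qed.

End Density.

(** * Tensor products *)

Section FreeQuotientTheory.
Variables (C : fieldType) (X : choiceType) (rel : {freeg X / C} -> Prop).

Lemma fq_pi_linear : linear (fq_pi rel).
Proof. by move=> a u v; rewrite fq_piD fq_piZ. Qed.

Section Lift.
Variables (U : lmodType C) (f : X -> U).
Hypothesis f_rel : forall u, rel u -> fglift f u = 0.

Lemma fq_lift_pi u : fq_lift f (fq_pi rel u) = fglift f u.
Proof.
apply/eqP; rewrite -subr_eq0 -fgliftB.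
have /fq_piP/asboolP[s hs ->] := fq_piK (fq_pi rel u).
rewrite fglift_sum big1_seq //= => p /hs hp.
by rewrite fgliftZ f_rel ?scaler0.
Qed.

Lemma fq_lift_linear : linear (@fq_lift _ _ rel U f).
Proof.
move=> a x y; rewrite -[x]fq_piK -[y]fq_piK -fq_pi_linear.
by rewrite !fq_lift_pi // fgliftD fgliftZ.
Qed.
End Lift.

Lemma fq_rel u : rel u -> fq_pi rel u = 0.
Proof.
move=> hu; rewrite -(blin0 fq_pi_linear); apply/fq_piP; rewrite subr0; apply/asboolP.
exists ((1, u) :: nil) => [p|]; first by rewrite inE => /eqP ->.
by rewrite big_seq1 scale1r.
Qed.

(** An element is a combination of the finitely many generators occurring in
    a representative. *)
Lemma fq_fin (x : freequot rel) : exists s : seq X,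
  forall S : freequot rel -> Prop, subspace S -> (forall z, z \in s -> S (fq_gen rel z)) -> S x.
Proof.
exists (dom (fq_repr x)) => S hS hx; rewrite -[x]fq_piK -[fq_repr x]freeg_sumE.
rewrite (blin_sum fq_pi_linear) big_seq; apply: (subspace_sum hS) => z /hx hz.
have -> : << coeff z (fq_repr x) *g z >> = coeff z (fq_repr x) *: << z >> :> {freeg X / C}.
  by apply/eqP/freeg_eqP => w; rewrite coeffZ !coeffU mulrA mulr1.
by rewrite (blinZ fq_pi_linear); exact: (subspaceZ hS).
Qed.

End FreeQuotientTheory.

Section TensorTheory.
Variables (C : fieldType) (I : finType) (V : I -> lmodType C).
Local Notation T := (tensor V).
Local Notation tens := (@tens C I V).
Implicit Types (v w : forall i, V i).

Lemma dfwith_id v i (x y : V i) : dfwith (dfwith v x) y = dfwith v y.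
Proof.
apply: functional_extensionality_dep => j; case: (dfwithP (dfwith v x) y j) => [|k ik].
  by rewrite dfwith_in.
by rewrite !dfwith_out.
Qed.

Lemma dfwith_self v i : dfwith v (v i) = v.
Proof. by apply: functional_extensionality_dep => j; case: dfwithP. Qed.

Lemma dfwithC v i j (x : V i) (y : V j) : i != j ->
  dfwith (dfwith v x) y = dfwith (dfwith v y) x.
Proof.
move=> ij; apply: functional_extensionality_dep => l.
case: (dfwithP (dfwith v x) y l) => [|l' jl]; first by rewrite dfwith_out // dfwith_in.
case: (dfwithP (dfwith v y) x l') jl => [jl|l'' il jl]; first by rewrite dfwith_in.
by rewrite !dfwith_out.
Qed.

Lemma tens_slot v i : linear (fun x : V i => tens (dfwith v x) : T).
Proof.
move=> a x y; apply/eqP; rewrite -subr_eq0 opprD addrA; apply/eqP.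
set r := @multilinear_rel C I V; have pil := fq_pi_linear r.
rewrite /tens /fq_gen -(blinZ pil) -!(blinB pil); apply: fq_rel.
by exists v, i, x, y, a.
Qed.

Lemma tens_eq0 v i : v i = 0 -> tens v = 0.
Proof. by move=> vi; rewrite -(dfwith_self v i) vi (blin0 (tens_slot v (i := i))). Qed.

Definition multilinear (U : lmodType C) (f : (forall i, V i) -> U) :=
  forall v i, linear (fun x : V i => f (dfwith v x)).

Lemma multilinear_rel0 (U : lmodType C) (f : (forall i, V i) -> U) : multilinear f ->
  forall u, multilinear_rel u -> fglift (f : {classic (forall i, V i)} -> U) u = 0.
Proof.
move=> hf u [w [i [x [y [a ->]]]]]; rewrite !fgliftB fgliftZ.
rewrite (liftU _ 1) (liftU _ 1) (liftU _ 1) !scale1r hf.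
by rewrite [X in X - _ - _]addrC addrK subrr.
Qed.

Lemma tensor_lift_linear (U : lmodType C) (f : (forall i, V i) -> U) : multilinear f ->
  linear (tensor_lift f : T -> U).
Proof. by move=> hf; exact: (fq_lift_linear (multilinear_rel0 hf)). Qed.

Lemma tensor_lift_tens (U : lmodType C) (f : (forall i, V i) -> U) v : multilinear f ->
  (tensor_lift f : T -> U) (tens v) = f v.
Proof. by move=> hf; apply: tensor_liftE => {}v i a x y; exact: hf. Qed.

Lemma tens_fin (u : T) : exists s : seq (forall i, V i), forall S : T -> Prop, subspace S ->
  (forall v, List.In v s -> S (tens v)) -> S u.
Proof.
have [s hs] := fq_fin u; exists s => S hS hv; apply: hs => // z.
elim: s hv => [|y s IH] hv; first by rewrite in_nil.
by rewrite inE => /predU1P[->|/IH]; [apply: hv; left|apply=> v vs; apply: hv; right].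
Qed.

Lemma tens_ind (S : T -> Prop) : subspace S -> (forall v, S (tens v)) -> forall u, S u.
Proof. by move=> hS hv u; have [s] := tens_fin u; apply. Qed.

Lemma eq_subspace (U W : lmodType C) (f h : U -> W) : linear f -> linear h ->
  subspace (fun u => f u = h u).
Proof.
move=> fl hl; split=> [|a u v fu fv]; first by rewrite (blin0 fl) (blin0 hl).
by rewrite fl hl fu fv.
Qed.

Lemma tens_ext (U : lmodType C) (f h : T -> U) : linear f -> linear h ->
  (forall v, f (tens v) = h (tens v)) -> forall u, f u = h u.
Proof. by move=> fl hl; exact: (tens_ind (eq_subspace fl hl)). Qed.

(** * Operators acting on a single factor *)

Section Slot.
Variable i : I.
Implicit Types F G : V i -> V i.

Definition slotop F : T -> T := tensor_lift (fun v => tens (dfwith v (F (v i)))).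

Lemma slot_multilinear F : linear F -> multilinear (fun v => tens (dfwith v (F (v i))) : T).
Proof.
move=> Fl v j a x y; have [ij|ij] := eqVneq i j.
  by subst j; rewrite !dfwith_in !dfwith_id Fl; exact: tens_slot.
rewrite /= !(dfwith_out (T := V)) 1?eq_sym // !(dfwithC v _ _ (i := j) (j := i)) 1?eq_sym //.
exact: tens_slot.
Qed.

Lemma slotop_linear F : linear F -> linear (slotop F).
Proof. by move=> Fl; exact: (tensor_lift_linear (slot_multilinear Fl)). Qed.

Lemma slotopE F v : linear F -> slotop F (tens v) = tens (dfwith v (F (v i))).
Proof. by move=> Fl; exact: (tensor_lift_tens _ (slot_multilinear Fl)). Qed.

Lemma slotop_comp F G u : linear F -> linear G -> slotop F (slotop G u) = slotop (F \o G) u.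
Proof.
move=> Fl Gl; have FGl : linear (F \o G) by move=> a x y /=; rewrite Gl Fl.
apply: (tens_ext (f := slotop F \o slotop G)) u.
- by move=> a x y /=; rewrite (slotop_linear Gl) (slotop_linear Fl).
- exact: slotop_linear.
by move=> v /=; rewrite !slotopE // dfwith_in dfwith_id.
Qed.

Lemma slotop_lin a F G u : linear F -> linear G ->
  slotop (fun x => a *: F x + G x) u = a *: slotop F u + slotop G u.
Proof.
move=> Fl Gl; have FGl : linear (fun x => a *: F x + G x).
  by move=> b x y /=; rewrite Gl Fl !scalerDr !scalerA addrACA mulrC.
apply: (tens_ext (h := fun u => a *: slotop F u + slotop G u)) u.
- exact: slotop_linear.
- move=> b x y; rewrite (slotop_linear Gl) (slotop_linear Fl).
  by rewrite !scalerDr !scalerA addrACA mulrC.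
by move=> v /=; rewrite !slotopE // tens_slot.
Qed.

Lemma slotop_scalar (c : C) u : slotop ( *:%R c) u = c *: u.
Proof.
have cl (W : lmodType C) : linear ( *:%R c : W -> W).
  by move=> a x y; rewrite scalerDr !scalerA mulrC.
apply: (tens_ext (slotop_linear (cl _)) (cl _)) => v.
by rewrite slotopE // (blinZ (tens_slot v (i := i))) dfwith_self.
Qed.

Lemma eq_slotop F G u : F =1 G -> slotop F u = slotop G u.
Proof. by move=> /funext ->. Qed.

End Slot.

End TensorTheory.
Arguments slotop {C I V} i F u.

Section Tensor2Theory.
Variables (C : fieldType) (U V : lmodType C).
Local Notation T := (tensor2 U V).

Lemma tens2_linearl (v : V) : linear (fun u : U => tens2 u v : T).
Proof.
move=> a x y; apply/eqP; rewrite -subr_eq0 opprD addrA; apply/eqP.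
set r := @bilinear_rel C U V; have pil := fq_pi_linear r.
rewrite /tens2 /fq_gen -(blinZ pil) -!(blinB pil); apply: fq_rel.
by left; exists a, x, y, v.
Qed.

Lemma tens2_linearr (u : U) : linear (fun v : V => tens2 u v : T).
Proof.
move=> a x y; apply/eqP; rewrite -subr_eq0 opprD addrA; apply/eqP.
set r := @bilinear_rel C U V; have pil := fq_pi_linear r.
rewrite /tens2 /fq_gen -(blinZ pil) -!(blinB pil); apply: fq_rel.
by right; exists a, u, x, y.
Qed.

Lemma tensor2_lift_linear (W : lmodType C) (f : U -> V -> W) :
  (forall v, linear (f^~ v)) -> (forall u, linear (f u)) -> linear (tensor2_lift f : T -> W).
Proof.
move=> hl hr; apply: fq_lift_linear => w.
by case=> [[a [x [y [z ->]]]]|[a [z [x [y ->]]]]]; rewrite !fgliftB fgliftZ;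
  rewrite !(liftU _ 1) !scale1r /= ?hl ?hr [X in X - _ - _]addrC addrK subrr.
Qed.

Lemma tens2_ind (S : T -> Prop) : subspace S -> (forall u v, S (tens2 u v)) -> forall x, S x.
Proof. by move=> hS hv x; have [s hs] := fq_fin x; apply: hs => // -[u v] _; exact: hv. Qed.

End Tensor2Theory.

(** * Coordinates of a tensor *)

Section FreeLists.
Variables (C : fieldType) (W : lmodType C).
Implicit Types (x y : W) (ys : seq W).

Lemma lspan_min ys x (S : W -> Prop) : subspace S -> (forall y, y \in ys -> S y) ->
  lspan ys x -> S x.
Proof.
move=> hS; elim: ys x => [|y ys IH] x hy /=; first by move->; exact: subspace0.
move=> [t /IH h]; rewrite -[x](subrK (t *: y)); apply: (subspaceD hS).
  by apply: h => z zs; apply: hy; rewrite inE zs orbT.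
by apply: (subspaceZ hS); apply: hy; exact: mem_head.
Qed.

(** Stated with positions rather than members, so that repeated vectors are
    not free. *)
Definition lfree ys := forall j, (j < size ys)%N ->
  ~ lspan (take j ys ++ drop j.+1 ys) (nth 0 ys j).

(** Drop members lying in the span of the others as long as there are some. *)
Lemma lfree_generators (xs : seq W) : exists2 ys, lfree ys & forall x, x \in xs -> lspan ys x.
Proof.
have [n] := ubnP (size xs); elim: n xs => // n IH xs xsn.
have [hf|] := pselect (lfree xs); first by exists xs => // x; exact: lspan_mem.
move=> /existsNP[j /not_implyP[jx /contrapT hj]].
have [|ys ysf hys] := IH (take j xs ++ drop j.+1 xs).
  rewrite size_cat size_take size_drop jx; lia.
exists ys => // x.
have h y : y \in take j xs ++ drop j.+1 xs -> lspan ys y by exact: hys.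
have hjs : lspan ys (nth 0 xs j) by exact: (lspan_min (lspan_sub ys) h hj).
rewrite -(cat_take_drop j xs) mem_cat (drop_nth 0 jx) inE.
by case/or3P => [xj|/eqP-> //|xj]; apply: h; rewrite mem_cat xj ?orbT.
Qed.

End FreeLists.

Section Slots.
Variables (C : fieldType) (I : finType) (V : I -> lmodType C).
Local Notation T := (tensor V).
Local Notation tens := (@tens C I V).
Implicit Types (v w x : forall i, V i) (s : I -> I).

Definition slots s (F : I -> forall r, V r -> V r) (u : T) : T :=
  foldr (fun i => slotop (s i) (F i (s i))) u (enum I).

Lemma slots_tens s F v : injective s -> (forall i r, linear (F i r)) ->
  exists v', slots s F (tens v) = tens v' /\ forall i, v' (s i) = F i (s i) (v (s i)).
Proof.
move=> s_inj Fl; rewrite /slots.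
suff [v' [h1 h2 _]] : exists v', [/\ foldr (fun i => slotop (s i) (F i (s i))) (tens v) (enum I) = tens v',
    forall i, i \in enum I -> v' (s i) = F i (s i) (v (s i))
  & forall i, i \notin enum I -> v' (s i) = v (s i)].
  by exists v'; split=> // i; apply: h2; rewrite mem_enum.
elim: (enum I) (enum_uniq I) => [_|i l IH] /=; first by exists v.
move=> /andP[il /IH[v' [-> h1 h2]]].
exists (dfwith v' (F i (s i) (v' (s i)))); split=> [|j|j]; first exact: slotopE.
- rewrite inE => /predU1P[->|jl]; first by rewrite dfwith_in h2.
  by rewrite dfwith_out ?h1 // (inj_eq s_inj); apply: contraNneq il => ->.
rewrite inE negb_or => /andP[ji jl].
by rewrite dfwith_out ?h2 // (inj_eq s_inj) eq_sym.
Qed.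

Lemma slots_linear s F : (forall i r, linear (F i r)) -> linear (slots s F).
Proof.
move=> Fl a x y; rewrite /slots; elim: (enum I) => //= i l ->.
exact: slotop_linear.
Qed.

Lemma subspace_preim (W W' : lmodType C) (f : W -> W') (S : W' -> Prop) :
  linear f -> subspace S -> subspace (fun u => S (f u)).
Proof.
move=> fl hS; split=> [|a u v hu hv]; first by rewrite (blin0 fl); exact: subspace0.
by rewrite fl; exact: subspaceP.
Qed.

(** A nonzero tensor has a nonzero coordinate with respect to products of free
    lists; [x] is the product of basis vectors at that coordinate, and [ys i]
    consists of the other members of the list in the factor [i]. *)
Lemma pure_component (u : T) : u <> 0 -> exists (c : C) x (ys : forall i, seq (V i)),
  [/\ c != 0, forall i, ~ lspan (ys i) (x i)
    & forall F : forall i, V i -> V i, (forall i, linear (F i)) ->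
        (forall i y, y \in ys i -> F i y = 0) ->
        slots id (fun=> F) u = c *: tens (fun i => F i (x i))].
Proof.
move=> u0; have [vs hvs] := tens_fin u.
pose xs i := [seq v i | v <- vs].
pose es i := s2val (cid2 (lfree_generators (xs i))).
have es_free i : lfree (es i) := s2valP (cid2 (lfree_generators (xs i))).
have es_gen i y : y \in xs i -> lspan (es i) y := s2valP' (cid2 (lfree_generators (xs i))) y.
pose m := \max_i size (es i).
have es_m i : (size (es i) <= m)%N by exact: (leq_bigmax i).
pose e (f : {ffun I -> 'I_m}) i := nth 0 (es i) (f i).
pose Sp (z : T) := exists gam : {ffun I -> 'I_m} -> C, z = \sum_f gam f *: tens (e f).
have SpS : subspace Sp.
  split=> [|a _ _ [g1 ->] [g2 ->]].
    by exists (fun=> 0); rewrite big1 // => f _; rewrite scale0r.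
  exists (fun f => a * g1 f + g2 f); rewrite scaler_sumr -big_split /=.
  by apply: eq_bigr => f _; rewrite scalerDl scalerA.
have Sp_tens (l : seq I) v : (forall i, i \in l -> lspan (es i) (v i)) ->
    (forall i, i \notin l -> exists j : 'I_m, v i = nth 0 (es i) j) -> Sp (tens v).
  elim: l v => [|i l IH] v hl hn.
    have /choice[f hf] : forall i, exists j : 'I_m, v i = nth 0 (es i) j by move=> i; exact: hn.
    have -> : v = e (finfun f).
      by apply: functional_extensionality_dep => i; rewrite /e ffunE hf.
    exists (fun f' => (f' == finfun f)%:R); rewrite (bigD1 (finfun f)) //= eqxx scale1r.
    by rewrite big1 ?addr0 // => f' /negPf ->; rewrite scale0r.
  rewrite -(dfwith_self v i).
  apply: (lspan_min (subspace_preim (tens_slot v (i := i)) SpS) _ (hl i (mem_head _ _))) => y yi.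
  apply: IH => j jl.
    have [ij|ij] := eqVneq i j; last by rewrite dfwith_out //; apply: hl; rewrite inE jl orbT.
    by subst j; rewrite dfwith_in; exact: lspan_mem.
  have [ij|ij] := eqVneq i j; last by rewrite dfwith_out //; apply: hn; rewrite inE negb_or eq_sym ij.
  subst j; rewrite dfwith_in; have ym : (index y (es i) < m)%N.
    by apply: leq_trans (es_m i); rewrite index_mem.
  by exists (Ordinal ym); rewrite /= nth_index.
have [gam uE] : Sp u.
  apply: hvs => // v vs_v; apply: (Sp_tens (enum I)) => i; last by rewrite mem_enum.
  move=> _; apply: es_gen; rewrite /xs; elim: (vs) vs_v => //= v' l IH [->|/IH h].
    exact: mem_head.
  by rewrite inE h orbT.
have [f0 hf0] : exists f0, gam f0 *: tens (e f0) <> 0.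
  apply: contrapT => /forallNP h; apply: u0; rewrite uE big1 // => f _.
  by apply: contrapT; exact: h.
pose ys i := take (f0 i) (es i) ++ drop (f0 i).+1 (es i).
exists (gam f0), (e f0), ys; split.
- by apply/eqP => g0; apply: hf0; rewrite g0 scale0r.
- move=> i; have [ji|ji] := ltnP (f0 i) (size (es i)); first exact: (es_free i).
  by case: hf0; rewrite (@tens_eq0 _ _ _ (e f0) i) ?scaler0 // /e nth_default.
move=> F Fl Fy.
rewrite uE (blin_sum (slots_linear id (fun=> Fl))) (bigD1 f0) //= [X in _ + X]big1.
  rewrite addr0 (blinZ (slots_linear id (fun=> Fl))).
  have [v' [-> hv']] := slots_tens (e f0) (s := id) (fun _ _ h => h) (fun=> Fl).
  by congr (_ *: tens _); apply: functional_extensionality_dep => i; rewrite hv'.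
move=> f ff0; rewrite (blinZ (slots_linear id (fun=> Fl))).
have [v' [-> hv']] := slots_tens (e f) (s := id) (fun _ _ h => h) (fun=> Fl).
have [i fi] : exists i, f i != f0 i.
  apply: contrapT => /forallNP h; move/eqP: ff0; apply; apply/ffunP => i.
  by apply/eqP; apply: contrapT => /negP hi; exact: (h i).
rewrite (@tens_eq0 _ _ _ v' i) ?scaler0 // hv'.
have [fs|fs] := ltnP (f i) (size (es i)); last by rewrite /e nth_default // (blin0 (Fl i)).
apply: Fy; rewrite /ys mem_cat; move: fi fs; rewrite -(inj_eq val_inj) /= neq_ltn /e.
case/orP => [lt fs|lt fs].
  by rewrite -(nth_take 0 lt) mem_nth // size_take; case: ifP.
by rewrite -(subnKC lt) -nth_drop mem_nth ?orbT // size_drop ltn_sub2r // (leq_ltn_trans lt fs).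
Qed.

End Slots.

(** * Separation of the tensor factors *)

Section Separation.
Variables (C : numFieldType) (I : finType) (V : I -> lmodType C).
Variables (R : Type) (X : R -> int -> forall i, V i -> V i).
Hypotheses (X_linear : forall j n i, linear (X j n (i := i))).
Hypotheses (X_polyfun : forall j i v, polyfun (fun n => X j n (i := i) v)).
Variable a : I -> C.
Hypotheses (a_neq0 : forall i, a i != 0) (a_inj : injective a).
Local Notation T := (tensor V).

Lemma slotop_polyfun j i (u : T) : polyfun (fun n => slotop i (X j n (i := i)) u).
Proof.
have pl : subspace (fun u : T => polyfun (fun n => slotop i (X j n (i := i)) u)).
  split=> [|b u1 u2 h1 h2].
    by apply: polyfun_ext (polyfun_cst 0) => n; rewrite (blin0 (slotop_linear (X_linear j n (i:=i)))).
  apply: polyfun_ext (polyfunD (polyfunZ 0 b h1) h2) => n.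
  by rewrite (slotop_linear (X_linear j n (i:=i))) expr0 mul1r.
apply: (tens_ind pl) => v.
by apply: polyfun_ext (polyfun_lin (tens_slot v (i := i)) (X_polyfun j (v i))) => n; rewrite slotopE.
Qed.

Variable i1 : I.

(** Symmetries of the parameters are determined by the image [rho] of [i1];
    this is the image of [i], if there is one. *)
Definition sym_image (rho i : I) : option I := [pick r | a r * a i1 == a i * a rho].

Lemma sym_image_some rho i r : a r * a i1 = a i * a rho -> sym_image rho i = Some r.
Proof.
move=> h; rewrite /sym_image; case: pickP => [r' /eqP h'|/(_ r)]; last by rewrite h eqxx.
by congr Some; apply: a_inj; apply: (mulIf (a_neq0 i1)); rewrite h h'.
Qed.

Lemma sym_imageP rho i r : sym_image rho i = Some r -> a r * a i1 = a i * a rho.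
Proof. by rewrite /sym_image; case: pickP => // r' /eqP h [<-]. Qed.

Definition sym_act (rho i : I) (F : forall i, V i -> V i) (u : T) : T :=
  if sym_image rho i is Some r then slotop r (F r) u else 0.

Definition slot_word := seq (R * int * I).
Definition sym_word_act rho (w : slot_word) (u : T) : T :=
  foldr (fun l => sym_act rho l.2 (X l.1.1 l.1.2)) u w.
Definition slot_degree (w : slot_word) : int := \sum_(l <- w) l.1.2.

Lemma sym_act_linear rho i F : (forall i, linear (F i)) -> linear (sym_act rho i F).
Proof.
move=> Fl; rewrite /sym_act; case: (sym_image rho i) => [r|]; first exact: slotop_linear.
by move=> b x y; rewrite scaler0 addr0.
Qed.

Lemma sym_word_act_linear rho w : linear (sym_word_act rho w).
Proof. by elim: w => [//|l w IH] b x y /=; rewrite IH sym_act_linear. Qed.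

Variable U : int -> T -> Prop.
Hypotheses (U_sub : forall l, subspace (U l)).
Hypothesis U_stable : forall l u j n, U l u ->
  U (l + n) (\sum_i a i ^ n *: slotop i (X j n (i := i)) u).

(** The letters of [w] are localized one after another: shifting the power of
    [t_1] from the outer letter to the one being localized by a varying amount
    [x] multiplies each term by [b ^ x] times a polynomial in [x], where the
    base [b] is the ratio of two parameters. *)
Lemma separation j0 w : forall l u n0, U l u ->
  U (l + (n0 + slot_degree w))
    (\sum_rho (a rho / a i1) ^ (n0 + slot_degree w) *:
        slotop rho (X j0 n0 (i := rho)) (sym_word_act rho w u)).
Proof.
elim/last_ind: w => [|w [[j n] i] IH] l u n0 Ulu.
  rewrite /slot_degree big_nil addr0.
  have := subspaceZ (U_sub _) ((a i1)^-1 ^ n0) (U_stable j0 n0 Ulu).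
  rewrite scaler_sumr; congr U; apply: eq_bigr => rho _.
  by rewrite scalerA expfzMl mulrC.
set N := n0 + slot_degree (rcons w (j, n, i)).
have NE : N = n0 + (slot_degree w + n) by rewrite /N /slot_degree big_rcons.
pose G rho r (x : int) := (a rho / a i1) ^ N *:
  slotop rho (X j0 (n0 + n + - 1 * x) (i := rho)) (sym_word_act rho w (slotop r (X j x (i := r)) u)).
pose b (p : I * I) := a p.2 * a i1 / a p.1.
have b0 p : b p != 0 by rewrite !mulf_neq0 ?invr_neq0.
have Gp (p : I * I) : polyfun (G p.1 p.2).
  apply: (polyfun_lin (Y := *:%R ((a p.1 / a i1) ^ N))) => [c x y|].
    by rewrite scalerDr !scalerA mulrC.
  apply: (polyfun_op (Y := fun x => slotop p.1 (X j0 (n0 + n + - 1 * x) (i := p.1)))) => [x|v|].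
  - exact: slotop_linear.
  - apply: (polyfun_affine (f := fun x => slotop p.1 (X j0 x (i := p.1)) v)).
    exact: slotop_polyfun.
  - by apply: polyfun_lin; [exact: sym_word_act_linear|exact: slotop_polyfun].
have key (x : int) : U (l + N) (\sum_(p : I * I) b p ^ x *: G p.1 p.2 x).
  have := IH (l + x) _ (n0 + n - x) (U_stable j x Ulu).
  have -> : l + x + (n0 + n - x + slot_degree w) = l + N by rewrite NE; lia.
  have -> : n0 + n - x + slot_degree w = N - x by rewrite NE; lia.
  congr U; rewrite -(pair_bigA _ (fun rho r => b (rho, r) ^ x *: G rho r x)) /=.
  apply: eq_bigr => rho _.
  rewrite (blin_sum (sym_word_act_linear rho w)) (blin_sum (slotop_linear (X_linear j0 _ (i := rho)))).
  rewrite scaler_sumr; apply: eq_bigr => r _.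
  rewrite (blinZ (sym_word_act_linear rho w)) (blinZ (slotop_linear (X_linear j0 _ (i := rho)))).
  rewrite /G !scalerA mulN1r; congr (_ *: _).
  rewrite expfzDr ?mulf_neq0 ?invr_neq0 // /b -mulrA [RHS]mulrC -mulrA; congr (_ * _).
  rewrite -exprz_inv -expfzMl; congr (_ ^ _).
  by rewrite invf_div mulrC ?mulrA.
have := exp_poly_separation (U_sub _) b0 Gp (fun x _ => key x) (a i) n.
rewrite -(pair_big_dep predT (fun rho r => b (rho, r) == a i) (fun rho r => G rho r n)) /=.
congr U; apply: eq_bigr => rho _.
rewrite /sym_word_act foldr_rcons -/(sym_word_act rho w _) /= /sym_act; case Es : (sym_image rho i) => [r|]; last first.
  rewrite big_pred0 => [|r].
    by rewrite (blin0 (sym_word_act_linear rho w)) (blin0 (slotop_linear (X_linear j0 _ (i := rho)))) scaler0.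
  apply/negP => /eqP h; move: Es; rewrite (@sym_image_some rho i r) //.
  by rewrite -h /b divfK.
rewrite (big_pred1 r) => [|r' /=].
  have nE : n0 + n + -1 * n = n0 by rewrite mulN1r addrK.
  by rewrite /G nE; reflexivity.
have h := sym_imageP Es; rewrite /b.
apply/eqP/eqP => [h'|->]; last by rewrite h mulfK.
by apply: a_inj; apply: (mulIf (a_neq0 i1)); rewrite h -h' divfK.
Qed.

End Separation.

(** * Permutations of the tensor factors *)

Section Permutation.
Variables (C : numFieldType) (g : lieAlgebra C) (H : {vspace g}).
Variables (form : g -> g -> C) (mu : C) (V : fweight H -> fmodule form).
Variables (k : nat) (lam : 'I_k -> weight H).
Variable s : 'I_k -> 'I_k.
Hypothesis lam_s : forall i, lam (s i) = lam i.
Hypothesis s_inj : injective s.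
Local Notation Vf := (Vfactor mu V lam).
Local Notation T := (Vhat mu V lam).
Implicit Types (v : forall i, Vf i).

(** Factors with equal weights are the same module only up to the equality of
    their weights. *)
Definition transp (l l' : weight H) (e : l = l') (x : irmod mu V l) : irmod mu V l' :=
  eq_rect l (fun l => irmod mu V l : Type) x l' e.

Lemma transp_linear l l' (e : l = l') : linear (transp e).
Proof. by case: l' / e. Qed.

Lemma transp_nat (F : forall l, irmod mu V l -> irmod mu V l) l l' (e : l = l') x :
  transp e (F l x) = F l' (transp e x).
Proof. by case: l' / e. Qed.

Lemma transp_trans l l' l'' (e : l = l') (e' : l' = l'') x :
  transp e' (transp e x) = transp (etrans e e') x.
Proof. by case: l'' / e'; case: l' / e. Qed.

Lemma transp_slot v i j l (e : lam j = l) (e' : lam i = l) : j = i ->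
  transp e (v j) = transp e' (v i).
Proof. by move=> ji; subst j; rewrite (eq_irrelevance e e'). Qed.

Definition permute v : forall i, Vf i := fun i => transp (lam_s i) (v (s i)).

Lemma permute_dfwith v i (x : Vf (s i)) :
  permute (dfwith v x) = dfwith (permute v) (transp (lam_s i) x : Vf i).
Proof.
apply: functional_extensionality_dep => j; rewrite /permute.
case: (dfwithP (T := Vf) _ (transp (lam_s i) x) j) => [|j' ij]; first by rewrite dfwith_in.
by rewrite dfwith_out // (inj_eq s_inj).
Qed.

(** For the cyclic permutation of the statement this is [sigma_hat]. *)
Definition permute_hat : T -> T :=
  tensor_lift (fun v : forall i, Vf i => tens (permute v) : T).

Lemma permute_multilinear : multilinear (V := fun i => Vf i) (fun v => tens (permute v) : T).
Proof.
move=> v j; have [s' ss' s's] := injF_bij s_inj; rewrite -(s's j) => a x y.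
rewrite !permute_dfwith transp_linear.
exact: (tens_slot (V := fun i => Vf i)).
Qed.

Lemma permute_hat_linear : linear permute_hat.
Proof. exact: (tensor_lift_linear permute_multilinear). Qed.

Lemma permute_hatE v : permute_hat (tens v) = tens (permute v).
Proof. exact: (tensor_lift_tens _ permute_multilinear). Qed.

Lemma permute_hat_slot (F : forall l, irmod mu V l -> irmod mu V l) i (u : T) :
  (forall j, linear (F (lam j))) ->
  permute_hat (slotop (s i) (F (lam (s i))) u) = slotop i (F (lam i)) (permute_hat u).
Proof.
move=> Fl; have h := @slotop_linear C _ (fun i => Vf i).
apply: (tens_ext (f := permute_hat \o slotop (s i) (F (lam (s i))))
   (h := slotop i (F (lam i)) \o permute_hat)) u => [a x y|a x y|v] /=.
- by rewrite (h _ _ (Fl (s i))); exact: permute_hat_linear.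
- by rewrite permute_hat_linear (h _ _ (Fl i)).
rewrite (slotopE _ (Fl (s i))) !permute_hatE permute_dfwith (slotopE _ (Fl i)).
by rewrite transp_nat.
Qed.

Lemma iter_permute_hat_slot (F : forall l, irmod mu V l -> irmod mu V l) j i (u : T) :
  (forall j, linear (F (lam j))) ->
  iter j permute_hat (slotop (iter j s i) (F (lam (iter j s i))) u) =
  slotop i (F (lam i)) (iter j permute_hat u).
Proof.
move=> Fl; elim: j i => [//|j IH] i; rewrite (iterSr j s i) !(iterS j permute_hat).
by rewrite (IH (s i)) permute_hat_slot.
Qed.

Lemma iter_permute_hat_linear j : linear (iter j permute_hat).
Proof. by elim: j => [//|j IH] a x y /=; rewrite IH permute_hat_linear. Qed.

(** Composed transports along equal weights are irrelevant by uniqueness of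
    identity proofs. *)
Lemma iter_permute r u : (forall i, iter r s i = i) -> iter r permute_hat u = u.
Proof.
move=> sr.
have lamE j i : lam (iter j s i) = lam i by elim: j => //= j IH; rewrite lam_s.
have iterE j v i : iter j permute v i = transp (lamE j i) (v (iter j s i)).
  elim: j i => [|j IH] i /=; first exact: (transp_slot _ (erefl (lam i))).
  by rewrite {1}/permute IH transp_trans; apply: transp_slot; rewrite -iterSr.
apply: (tens_ext (iter_permute_hat_linear r) (h := id)) u => // v.
have -> : iter r permute_hat (tens v) = tens (iter r permute v).
  elim: r {sr} => [//|r IH]; rewrite !iterS IH permute_hatE; reflexivity.
by congr tens; apply: functional_extensionality_dep => i; rewrite iterE; exact: (transp_slot _ _ (erefl (lam i)) (sr i)).
Qed.

End Permutation.

(** * A nonzero mode in a prescribed degree *)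

Section BareLinearSums.
Variables (C : comPzRingType) (U W : lmodType C).

Lemma blin_scale (c : C) (f : U -> W) : linear f -> linear (fun x => c *: f x).
Proof. by move=> fl a x y; rewrite fl scalerDr !scalerA mulrC. Qed.

Lemma blin_bigsum (J : Type) (s : seq J) (P : pred J) (F : J -> U -> W) :
  (forall j, linear (F j)) -> linear (fun x => \sum_(j <- s | P j) F j x).
Proof.
move=> Fl a x y; elim: s => [|j s IH]; first by rewrite !big_nil scaler0 addr0.
by rewrite !big_cons; case: (P j) => //; rewrite IH Fl scalerDr addrACA.
Qed.
End BareLinearSums.

Section Pivot.
Variables (C : numFieldType) (g : lieAlgebra C) (form : g -> g -> C) (mu : C).
Variables (I : finType) (W : I -> fmodule form) (i : I) (c : C).
Hypothesis form0r : forall x, form x 0 = 0.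
Hypothesis W_adm : admissible (W i) c.
Local Notation T := (tensor (fun i => W i : lmodType C)).

(** The highest mode that survives the annihilation half of [E(N, z)] on [u]
    meets only the constant term of the creation half. *)
Lemma pivot (N : int) (u : T) : u <> 0 ->
  exists m : int, slotop i (rop mu c (RK0 g m) N : W i -> W i) u <> 0.
Proof.
move=> u0; have [vs hvs] := tens_fin u.
have [K hK] : exists K : nat, forall v, List.In v vs -> bd K%:Z (v i).
  elim: vs {hvs} => [|v vs [K hK]]; first by exists 0%N.
  have [K' hK'] := adm_bd W_adm (v i); exists (K + K')%N => v' [<-|/hK h].
    by apply: bd_leN hK'; exact: leq_addl.
  by apply: bd_leN h; exact: leq_addr.
pose A q := slotop i (@ep _ _ _ (W i) c N q) u.
have epl q : linear (@ep _ _ _ (W i) c N q) := ep_linear _ _ _.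
have eml q : linear (@em _ _ _ (W i) c N q) := em_linear _ _ _.
have ex0 (B : nat -> W i -> W i) v : expcoef B 0 v = v.
  by rewrite /expcoef big_ord1 /= fact0 invr1 scale1r.
have A0 : A 0%N = u.
  rewrite -[RHS](scale1r u) -(slotop_scalar i 1); apply: eq_slotop => v.
  by rewrite scale1r; exact: ex0.
have Aout q : (K < q)%N -> A q = 0.
  move=> Kq; apply: (hvs (fun u => slotop i (@ep _ _ _ (W i) c N q) u = 0)).
    split=> [|b x y hx hy]; first exact: (blin0 (slotop_linear (epl q))).
    by rewrite (slotop_linear (epl q)) hx hy scaler0 addr0.
  move=> v /hK vK; rewrite slotopE // (ep_eq0 _ _ vK Kq).
  by apply: (@tens_eq0 _ _ (fun i => W i : lmodType C) _ i); rewrite dfwith_in.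
have exA : exists q, A q != 0 by exists 0%N; rewrite A0; exact/eqP.
have maxA q : A q != 0 -> (q <= K)%N.
  by move=> h; rewrite leqNgt; apply: contra h => /Aout ->.
case: (ex_maxnP exA maxA) => q0 Aq0 q0max; exists q0%:Z.
have rl : linear (rop mu c (RK0 g q0%:Z) N : W i -> W i) by exact: (rop_linear mu form0r W_adm).
have -> : slotop i (rop mu c (RK0 g q0%:Z) N : W i -> W i) u =
    c *: \sum_(q <- iota 0 K.+1 | q0%:Z <= q%:Z) slotop i (@em _ _ _ (W i) c N (absz (q%:Z - q0%:Z))) (A q).
  pose B (u : T) := c *: \sum_(q <- iota 0 K.+1 | q0%:Z <= q%:Z)
    slotop i (@em _ _ _ (W i) c N (absz (q%:Z - q0%:Z))) (slotop i (@ep _ _ _ (W i) c N q) u).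
  have Bl : linear B.
    apply: blin_scale; apply: blin_bigsum => q b x y.
    by rewrite (slotop_linear (epl q)) (slotop_linear (eml _)).
  apply: (hvs _ (eq_subspace (slotop_linear rl) Bl)) => v /hK vK.
  rewrite (slotopE _ rl) /= /k0_op (Ecoef_fin _ _ _ vK).
  rewrite (blinZ (tens_slot (V := fun i => W i) v (i := i))) /B; congr (_ *: _).
  rewrite (blin_sum (tens_slot (V := fun i => W i) v (i := i))); apply: eq_bigr => q _.
  by rewrite (slotopE _ (epl q)) (slotopE _ (eml _)) dfwith_in dfwith_id.
have q0K : q0 \in iota 0 K.+1 by rewrite mem_iota /= add0n ltnS; exact: maxA.
rewrite big_mkcond (bigD1_seq q0) ?iota_uniq //= lexx big1 => [|q qne].
  rewrite addr0 subrr /= => /eqP; rewrite scaler_eq0 (negPf (adm_c W_adm)) /=.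
  rewrite (eq_slotop (G := *:%R 1)) => [|v]; last by rewrite scale1r; exact: ex0.
  by rewrite slotop_scalar scale1r (negPf Aq0).
case: ifP => // qq0; have -> : A q = 0.
  apply/eqP; apply: contraLR qne => /q0max qle; rewrite negbK eqn_leq qle /=.
  by rewrite lez_nat in qq0.
exact: (blin0 (slotop_linear (eml _))).
Qed.

End Pivot.

(** * Degree zero operators on the separated factors *)

Section Core.
Variables (C : numFieldType) (g : lieAlgebra C) (H : {vspace g}).
Variables (pos : hdual H -> Prop) (form : g -> g -> C) (mu : C).
Hypothesis triangular : triangular_decomposable pos.
Hypothesis pos_sum : no_null_positive_sum pos.
Hypothesis form0r : forall x, form x 0 = 0.
Variable V : fweight H -> fmodule form.
Hypothesis V_irr : forall eta, irreducible_highest_weight pos eta (V eta).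
Variables (k : nat) (lam : 'I_k -> weight H) (a : 'I_k -> C).
Hypotheses (lam_k0 : forall i, wt_k0 (lam i) != 0).
Hypotheses (a_neq0 : forall i, a i != 0) (a_inj : injective a).
Local Notation Vf := (Vfactor mu V lam).
Local Notation T := (Vhat mu V lam).
Local Notation c i := (wt_k0 (lam i)).
Local Notation M := (irmod mu V).

Definition ropf (j : rawsym g) (n : int) (i : 'I_k) : Vf i -> Vf i := rop mu (c i) j n.

Lemma factor_adm i : admissible (Vf i) (c i).
Proof. exact: (irmod_admissible mu V_irr (lam_k0 i)). Qed.

Lemma ropf_linear j n i : linear (ropf j n (i := i)).
Proof. exact: (rop_linear mu form0r (factor_adm i)). Qed.

Lemma ropf_polyfun j i v : polyfun (fun n => ropf j n (i := i) v).
Proof. exact: (rop_polyfun mu form0r (factor_adm i)). Qed.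

Lemma factor_degzero_linear b i : @degzero C g H form mu V b -> linear (b (lam i) : Vf i -> Vf i).
Proof. by move=> db; exact: (degzero_linear form0r V_irr db (lam_k0 i)). Qed.

Variable i1 : 'I_k.
Local Notation wact := (sym_word_act ropf a i1).
Local Notation lact := (sym_act a i1 (V := fun i => Vf i : lmodType C)).
Local Notation sym := (sym_image a i1).

Variable U : int -> T -> Prop.
Hypotheses (U_sub : forall l, subspace (U l)).
Hypothesis U_stable : forall l u j n, U l u ->
  U (l + n) (\sum_i a i ^ n *: slotop i (ropf j n (i := i)) u).

Variables (l N : int).

Lemma sym_word_act_cat rho w1 w2 u : wact rho (w1 ++ w2) u = wact rho w1 (wact rho w2 u).
Proof. exact: foldr_cat. Qed.

(** The scalar by which the operator [k_0(0,0)] placed on [i] acts after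
    the symmetry; it vanishes if [i] has no image. *)
Definition pad rho i : C := if sym rho i is Some r then c r else 0.
Definition fam_coef rho : C :=
  (a rho / a i1) ^ N * (c rho * \prod_(i <- enum 'I_k) pad rho i).

Lemma fam_coef_total rho : fam_coef rho != 0 -> forall i, exists r, sym rho i = Some r.
Proof.
move=> d0 i; case Es : (sym rho i) => [r|]; first by exists r.
move: d0; rewrite /fam_coef (big_rem i) ?mem_enum //= {1}/pad Es mul0r !mulr0.
by rewrite eqxx.
Qed.

(** Families of vectors, one for each candidate symmetry, whose weighted sum
    lies in [U] together with all its images under degree zero words. *)
Definition stable_family (x : 'I_k -> T) := forall w : slot_word 'I_k (rawsym g), slot_degree w = 0 ->
  U (l + N) (\sum_rho fam_coef rho *: wact rho w (x rho)).

(** The operators [k_0(0,0)] act by nonzero scalars; one for each factor is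
    inserted to discard the [rho] which do not come from a symmetry of all the
    parameters. *)
Lemma stable_family_start j u : U l u ->
  stable_family (fun rho => slotop rho (ropf j N (i := rho)) u).
Proof.
move=> Ulu w w0; pose pads := [seq (RK0 g 0, 0 : int, i) | i <- enum 'I_k].
have := separation ropf_linear ropf_polyfun a_neq0 a_inj i1 U_sub U_stable (RK0 g 0)
  (w ++ pads ++ (j, N, i1) :: nil) 0 Ulu.
have dE : 0 + slot_degree (w ++ pads ++ (j, N, i1) :: nil) = N.
  rewrite /slot_degree !big_cat big_seq1 /= -/(slot_degree w) w0 !add0r big_map big1 ?add0r //.
have padE rho z : slotop rho (ropf (RK0 g 0) 0 (i := rho)) z = c rho *: z :> T.
  rewrite -(slotop_scalar rho (c rho) z); apply: eq_slotop => v.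
  exact: (rop_K00 mu (factor_adm rho) 0 v).
have padsE rho z : wact rho pads z = (\prod_(i <- enum 'I_k) pad rho i) *: z.
  rewrite /pads; elim: (enum 'I_k) => [|i s IH] /=; first by rewrite big_nil scale1r.
  rewrite IH big_cons -scalerA /pad /sym_act; case: (sym_image _ _ _ _) => [r|]; last by rewrite scale0r.
  by rewrite padE.
rewrite dE; congr U; apply: eq_bigr => rho _.
rewrite padE !sym_word_act_cat padsE (blinZ (sym_word_act_linear ropf_linear a i1 rho w)) /fam_coef -!scalerA.
congr (_ *: (_ *: (_ *: sym_word_act _ _ _ _ _ _))).
by rewrite /= /sym_act (@sym_image_some _ _ _ a_neq0 a_inj i1 rho i1 rho) // mulrC.
Qed.

Lemma stable_family_step i b x : @degzero C g H form mu V b -> stable_family x ->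
  stable_family (fun rho => lact rho i (fun r => b (lam r)) (x rho)).
Proof.
move=> db; elim: db x => {b} [r r0|e b b' db IH db' IH'|b b' db IH db' IH'] x hx w w0.
- pose wr : slot_word 'I_k (rawsym g) := [seq (l, i) | l <- r].
  have /hx : slot_degree (w ++ wr) = 0.
    by rewrite /slot_degree big_cat /= -/(slot_degree w) w0 add0r big_map.
  congr U; apply: eq_bigr => rho _; have [-> |d0] := eqVneq (fam_coef rho) 0.
    by rewrite !scale0r.
  rewrite sym_word_act_cat; congr (_ *: sym_word_act _ _ _ _ _ _).
  have [q Eq] := fam_coef_total d0 i; rewrite /sym_act Eq /wr.
  elim: (r) => [|l' r' IH] /=.
    by rewrite -[LHS]scale1r -(slotop_scalar q 1); apply: eq_slotop => v; rewrite scale1r.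
  rewrite IH /sym_act Eq slotop_comp //; first exact: ropf_linear.
  exact: (rwop_linear mu form0r (factor_adm q)).
- have := subspaceP (U_sub _) e (IH x hx w w0) (IH' x hx w w0).
  rewrite scaler_sumr -big_split; congr U; apply: eq_bigr => rho _ /=.
  have [-> |d0] := eqVneq (fam_coef rho) 0; first by rewrite !scale0r scaler0 addr0.
  rewrite scalerA [e * _]mulrC -scalerA -scalerDr; congr (_ *: _).
  rewrite -(sym_word_act_linear ropf_linear); congr (sym_word_act _ _ _ _ _ _).
  have [q Eq] := fam_coef_total d0 i; rewrite /sym_act Eq.
  by rewrite slotop_lin //; exact: factor_degzero_linear.
have := IH _ (IH' x hx) w w0; congr U; apply: eq_bigr => rho _ /=.
have [-> |d0] := eqVneq (fam_coef rho) 0; first by rewrite !scale0r.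
congr (_ *: sym_word_act _ _ _ _ _ _).
have [q Eq] := fam_coef_total d0 i; rewrite /sym_act Eq.
by rewrite slotop_comp //; exact: factor_degzero_linear.
Qed.

Lemma stable_family_slots (b : 'I_k -> forall l, M l -> M l) x :
  (forall i, @degzero C g H form mu V (b i)) -> stable_family x ->
  U (l + N) (\sum_rho fam_coef rho *:
     foldr (fun i => lact rho i (fun r => b i (lam r))) (x rho) (enum 'I_k)).
Proof.
move=> db hx; suff : stable_family (fun rho =>
    foldr (fun i => lact rho i (fun r => b i (lam r))) (x rho) (enum 'I_k)).
  by move=> /(_ nil); apply; exact: big_nil.
by elim: (enum 'I_k) => [//|i s IH]; exact: stable_family_step.
Qed.

End Core.

(** * Generation of one graded piece by another *)

Section Graded.
Variables (C : numFieldType) (g : lieAlgebra C) (H : {vspace g}).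
Variables (pos : hdual H -> Prop) (form : g -> g -> C) (mu : C).
Hypothesis triangular : triangular_decomposable pos.
Hypothesis pos_sum : no_null_positive_sum pos.
Hypothesis form0r : forall x, form x 0 = 0.
Variable V : fweight H -> fmodule form.
Hypothesis V_irr : forall eta, irreducible_highest_weight pos eta (V eta).
Variables (k : nat) (lam : 'I_k -> weight H) (a : 'I_k -> C).
Hypotheses (lam_k0 : forall i, wt_k0 (lam i) != 0).
Hypotheses (a_neq0 : forall i, a i != 0) (a_inj : injective a).
Local Notation Vf := (Vfactor mu V lam).
Local Notation T := (Vhat mu V lam).
Local Notation c i := (wt_k0 (lam i)).
Local Notation M := (irmod mu V).
Local Notation ropf := (@ropf C g H form mu V k lam).
Let adm := factor_adm mu V_irr lam_k0.
Let ropl := ropf_linear (mu := mu) form0r V_irr lam_k0.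

Variables (s0 : 'I_k -> 'I_k) (lam_s0 : forall i, lam (s0 i) = lam i).
Variables (eps : C) (r : nat).
Hypothesis r_prim : r.-primitive_root eps.
Hypothesis a_s0 : forall i, a (s0 i) = eps * a i.
Hypothesis sym_max : forall (s : 'I_k -> 'I_k) z, (forall i, a (s i) = z * a i) ->
  (forall i, lam (s i) = lam i) -> z ^+ r = 1.
Local Notation ph := (permute_hat (mu := mu) (V := V) lam_s0).

Let r_gt0 : (0 < r)%N := prim_order_gt0 r_prim.

Lemma eps_neq0 : eps != 0.
Proof.
apply/eqP => e0; have := prim_expr_order r_prim.
by rewrite e0 expr0n gtn_eqF // => /eqP; rewrite eq_sym oner_eq0.
Qed.

Lemma s0_inj : injective s0.
Proof.
by move=> i j e; apply: a_inj; apply: (mulfI eps_neq0); rewrite -!a_s0 e.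
Qed.

Lemma iter_a j i : a (iter j s0 i) = eps ^+ j * a i.
Proof. by elim: j => [|j IH]; rewrite ?mul1r //= a_s0 IH exprS mulrA. Qed.

Lemma iter_lam j i : lam (iter j s0 i) = lam i.
Proof. by elim: j => //= j IH; rewrite lam_s0. Qed.

Lemma iter_r i : iter r s0 i = i.
Proof. by apply: a_inj; rewrite iter_a (prim_expr_order r_prim) mul1r. Qed.

Lemma ph_linear : linear ph.
Proof. exact: (permute_hat_linear lam_s0 s0_inj). Qed.

Lemma iter_ph_r u : iter r ph u = u.
Proof. exact: (iter_permute lam_s0 s0_inj u iter_r). Qed.

Lemma iter_ph_eigen j u (e : C) : ph u = e *: u -> iter j ph u = e ^+ j *: u.
Proof.
by move=> h; elim: j => [|j IH]; rewrite ?scale1r //= IH (blinZ ph_linear) h scalerA exprSr.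
Qed.

Lemma tagged_list i (vs : seq (forall i, Vf i)) : exists zs : seq {l : weight H & M l},
  good_list (lam i) zs /\ forall v i', List.In v vs -> lam i' <> lam i ->
    List.In (existT (fun l => M l : Type) (lam i') (v i')) zs.
Proof.
elim: vs => [|v vs [zs [hz hzs]]]; first by exists nil; split.
suff [zs' [hz' hzs']] : exists zs' : seq {l : weight H & M l},
    good_list (lam i) zs' /\ forall i', i' \in enum 'I_k -> lam i' <> lam i ->
    List.In (existT (fun l => M l : Type) (lam i') (v i')) zs'.
  exists (zs' ++ zs); split=> [z zz|v' i' [<-|vs_v'] hi].
  - by have [/hz'|/hz] := List.in_app_or zs' zs z zz.
  - by apply: List.in_or_app; left; apply: hzs'; rewrite ?mem_enum.
  by apply: List.in_or_app; right; exact: hzs.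
elim: (enum 'I_k) => [|j s [zs' [hz' hzs']]]; first by exists nil; split.
case: (pselect (lam j = lam i)) => hj.
  by exists zs'; split=> // i'; rewrite inE => /predU1P[->|/hzs'].
exists (existT (fun l => M l : Type) (lam j) (v j) :: zs'); split.
  by move=> z [<-|/hz'] //=; split=> //; exact: lam_k0.
by move=> i'; rewrite inE => /predU1P[->|i's] hi; [left|right; exact: hzs'].
Qed.

(** Density on each factor: [x i] is sent to the given [w i], the vectors in
    [ys i] to 0, as well as the components of [vs] with other weights. *)
Lemma slot_operators (vs : seq (forall i, Vf i)) (x w : forall i, Vf i)
    (ys : forall i, seq (Vf i)) : (forall i, ~ lspan (ys i) (x i)) ->
  exists b : 'I_k -> forall l, M l -> M l,
    [/\ forall i, @degzero C g H form mu V (b i),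
        forall i, b i (lam i) (x i) = w i,
        forall i y, y \in ys i -> b i (lam i) y = 0
      & forall i i' v, List.In v vs -> lam i' <> lam i -> b i (lam i') (v i') = 0].
Proof.
move=> hx.
have /choice[b hb] : forall i, exists b : forall l, M l -> M l,
    [/\ @degzero C g H form mu V b, b (lam i) (x i) = w i,
      forall y, y \in ys i -> b (lam i) y = 0
      & forall i' v, List.In v vs -> lam i' <> lam i -> b (lam i') (v i') = 0].
  move=> i; have [zs [hz hzs]] := tagged_list i vs.
  have [b [db by0 bz0] bx] := density (mu := mu) triangular pos_sum form0r V_irr (w i)
    (lam_k0 i) hz (hx i).
  exists b; split=> // i' v vs_v hi; exact: (bz0 _ (hzs v i' vs_v hi)).
by exists b; split=> i; case: (hb i).
Qed.

Variable U : int -> T -> Prop.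
Hypotheses (U_sub : forall l, subspace (U l)).
Hypothesis U_stable : forall l u j n, U l u ->
  U (l + n) (\sum_i a i ^ n *: slotop i (ropf j n (i := i)) u).

(** The family obtained by applying the operator of [pivot] to the images of
    [i1] and then the operators of [slot_operators] consists of scalar multiples
    of [tens w] transformed by powers of the symmetry.  Its weighted sum [Z] is,
    up to a scalar, a projection of [tens w] to the eigenvectors, and by
    linearity [U] contains the projections of all vectors. *)
Lemma graded_full (i1 : 'I_k) l N u x (e : C) : U l u -> u <> 0 -> ph u = e *: u ->
  ph x = (eps ^ N * e) *: x -> U (l + N) x.
Proof.
move=> Ulu u0 phu phx.
have [m hm] := pivot mu (i := i1) form0r (adm i1) N u0.
pose x0 rho : T := slotop rho (ropf (RK0 g m) N (i := rho)) u.
have x0ne : x0 i1 <> 0 by exact: hm.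
have [cc [xx [ys [cc0 xfree hF]]]] := pure_component x0ne.
have [vs hvs] : exists vs : seq (forall i, Vf i), forall rho (S : T -> Prop), subspace S ->
    (forall v, List.In v vs -> S (tens v)) -> S (x0 rho).
  suff [vs hvs] : exists vs : seq (forall i, Vf i), forall rho, rho \in enum 'I_k ->
      forall S : T -> Prop, subspace S -> (forall v, List.In v vs -> S (tens v)) -> S (x0 rho).
    by exists vs => rho; apply: hvs; rewrite mem_enum.
  elim: (enum 'I_k) => [|rho s [vs hvs]]; first by exists nil.
  have [vs' hvs'] := tens_fin (x0 rho); exists (vs' ++ vs) => rho'.
  rewrite inE => /predU1P[->|rs] S hS hv.
    by apply: hvs' => // v vv; apply: hv; apply: List.in_or_app; left.
  by apply: (hvs _ rs) => // v vv; apply: hv; apply: List.in_or_app; right.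
pose pk rho := [pick j : 'I_r | iter j s0 i1 == rho].
(* The contributions of the powers [j] of the symmetry, the vector [x0 rho]
   having been moved back to the factor [i1]. *)
pose Z (z : T) : T := \sum_rho fam_coef lam a i1 N rho *:
  (if pk rho is Some j then e ^+ j *: iter (r - j) ph z else 0).
have Zl : linear Z.
  apply: blin_bigsum => rho; apply: blin_scale; case: (pk rho) => [j|].
    by apply: blin_scale; exact: (iter_permute_hat_linear lam_s0 s0_inj).
  by move=> b y z; rewrite scaler0 addr0.
have s_orbit rho (s : 'I_k -> 'I_k) (j : nat) : (forall i, sym_image a i1 rho i = Some (s i)) ->
    iter j s0 i1 = rho -> forall i, s i = iter j s0 i.
  move=> hs hj i; apply: a_inj; apply: (mulIf (a_neq0 i1)).
  by rewrite (sym_imageP (hs i)) -hj !iter_a mulrCA mulrA.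
have Ztens w : U (l + N) (Z (tens w)).
  have [b [db bx bys bvs]] := slot_operators vs w xfree.
  have bl i q : linear (b i (lam q) : Vf q -> Vf q).
    exact: (factor_degzero_linear form0r V_irr lam_k0).
  have := stable_family_slots form0r V_irr lam_k0 U_sub db
    (stable_family_start form0r V_irr lam_k0 a_neq0 a_inj i1 U_sub U_stable N (RK0 g m) Ulu).
  move=> hU; apply: (subspace_scaleP (U_sub _) cc0); move: hU.
  rewrite scaler_sumr; congr U; apply: eq_bigr => rho _; rewrite -/(x0 rho).
  have [-> |d0] := eqVneq (fam_coef lam a i1 N rho) 0; first by rewrite !scale0r scaler0.
  rewrite [RHS]scalerA [cc * _]mulrC -[RHS]scalerA; congr (_ *: _).
  have /choice[s hs] := fam_coef_total d0.
  have s_inj : injective s.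
    move=> i j sij; apply: a_inj; apply: (mulIf (a_neq0 rho)).
    by rewrite -(sym_imageP (hs i)) -(sym_imageP (hs j)) sij.
  have sa i : a (s i) = a rho / a i1 * a i.
    by apply: (mulIf (a_neq0 i1)); rewrite (sym_imageP (hs i)) mulrAC divfK // mulrC.
  have s1 : s i1 = rho by apply: a_inj; rewrite sa divfK.
  pose F i q : Vf q -> Vf q := b i (lam q).
  rewrite (_ : foldr _ _ _ = slots s F (x0 rho)); last first.
    rewrite /slots; elim: (enum 'I_k) => [//|i q IH] /=.
    by rewrite IH /sym_act hs.
  have [hl|/existsNP[i hi]] := pselect (forall i, lam (s i) = lam i); last first.
    have -> : slots s F (x0 rho) = 0.
      apply: (hvs rho (fun z => slots s F z = 0)).
        split=> [|b' y z hy hz]; first exact: (blin0 (slots_linear s bl)).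
        by rewrite (slots_linear s bl) hy hz scaler0 addr0.
      move=> v vv; have [v' [-> hv']] := slots_tens v s_inj bl.
      by apply: (tens_eq0 (i := s i)); rewrite hv'; exact: bvs.
    rewrite /pk; case: pickP => [j /eqP hj|_]; last by rewrite scaler0.
    by case: hi; rewrite (s_orbit _ _ _ hs hj) iter_lam.
  have [j0 hj0] := prim_rootP r_prim (sym_max sa hl).
  rewrite /pk; case: pickP => [j /eqP hj|/(_ j0)]; last first.
    by move/eqP; case; apply: a_inj; rewrite iter_a -hj0 divfK.
  have sE := s_orbit _ _ _ hs hj.
  have phs z : iter j ph (slots s F z) = slots id F (iter j ph z).
    rewrite /slots; elim: (enum 'I_k) => [//|i q IH] /=.
    rewrite sE (iter_permute_hat_slot lam_s0 s0_inj (F := b i)) ?IH // => q'.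
    exact: bl.
  have phx0 : iter j ph (x0 rho) = e ^+ j *: x0 i1.
    rewrite -hj.
    have -> := iter_permute_hat_slot lam_s0 s0_inj (F := fun l => rop mu (wt_k0 l) (RK0 g m) N) j i1 u _.
      rewrite (iter_ph_eigen j phu).
      exact: (blinZ (slotop_linear (ropl (RK0 g m) N (i := i1))) (e ^+ j) u).
    by move=> q; exact: (ropl (RK0 g m) N (i := q)).
  rewrite -[LHS]iter_ph_r -{1}(subnK (ltnW (ltn_ord j))) iterD phs phx0.
  have {}hF : slots id F (x0 i1) = cc *: tens (fun i => F i i (xx i)) :=
    hF (fun i => F i i) (fun i => bl i i) bys.
  rewrite (blinZ (slots_linear id bl)) hF.
  rewrite !(blinZ (iter_permute_hat_linear lam_s0 s0_inj _)).
  rewrite !scalerA mulrC; congr (_ *: iter _ _ (tens _)).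
  by apply: functional_extensionality_dep => i; exact: bx.
have Zx : U (l + N) (Z x).
  by apply: (tens_ind (subspace_preim Zl (U_sub _))).
pose D := c i1 * \prod_(i <- enum 'I_k) c i.
have D0 : D != 0 by rewrite mulf_neq0 // prodf_seq_neq0; apply/allP => i _; exact: lam_k0.
(* The automorphism has order [r] and the eigenvalue [e] on [u]. *)
have er : e ^+ r = 1.
  have := iter_ph_r u; rewrite (iter_ph_eigen r phu) => /eqP.
  rewrite -[X in _ == X]scale1r -subr_eq0 -scalerBl scaler_eq0 subr_eq0.
  by case/orP => [/eqP //|/eqP].
(* On an eigenvector all the terms of [Z] are equal. *)
have ZxE : Z x = (\sum_(rho | isSome (pk rho)) D) *: x.
  rewrite /Z scaler_suml [RHS]big_mkcond; apply: eq_bigr => rho _.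
  rewrite /pk; case: pickP => [j /eqP hj|_] /=; last by rewrite scaler0.
  rewrite (iter_ph_eigen _ phx) !scalerA; congr (_ *: _).
  have zE : a rho / a i1 = eps ^+ j by rewrite -hj iter_a mulfK.
  have -> : fam_coef lam a i1 N rho = (eps ^+ j) ^ N * D.
    have cE : c i1 = c rho by rewrite -hj iter_lam.
    rewrite /fam_coef /D zE cE; congr (_ * (_ * _)).
    apply: eq_bigr => i _; rewrite /pad (@sym_image_some _ _ _ a_neq0 a_inj i1 rho i (iter j s0 i)).
      by rewrite iter_lam.
    by rewrite -hj !iter_a mulrCA mulrA.
  have -> : (eps ^+ j) ^ N = (eps ^ N) ^+ j by rewrite !exprnP exprzAC.
  have h1 : (eps ^ N) ^+ j * (e ^+ j * (eps ^ N * e) ^+ (r - j)) = 1.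
    rewrite mulrA -exprMn -exprD subnKC 1?ltnW // exprMn er mulr1.
    by rewrite exprnP exprzAC -exprnP (prim_expr_order r_prim) exp1rz.
  by rewrite -[RHS]mul1r -h1; ring.
move: Zx; rewrite ZxE; apply: (subspace_scaleP (U_sub _)).
rewrite sumr_const -mulr_natl mulf_neq0 // pnatr_eq0 -lt0n.
apply/card_gt0P; exists i1; rewrite unfold_in /pk.
by case: pickP => // /(_ (Ordinal r_gt0)); rewrite /= eqxx.
Qed.

End Graded.

(** * Homogeneous components *)

(** Subtract [chi i0] times the sum from its image under [D]: the term [i0]
    disappears and the others are rescaled by nonzero scalars. *)
Lemma eigen_separation (C : fieldType) (W : lmodType C) (D : W -> W) (U : W -> Prop)
    (I : eqType) (chi : I -> C) (y : I -> W) (s : seq I) :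
  linear D -> subspace U -> (forall v, U v -> U (D v)) ->
  {in s &, injective chi} -> uniq s -> (forall i, D (y i) = chi i *: y i) ->
  U (\sum_(i <- s) y i) -> forall i, i \in s -> U (y i).
Proof.
move=> Dl Us UD; elim: s y => [//|i0 s IH] y chi_inj /= /andP[i0s s_uniq] yE Uy.
have chi_s : {in s &, injective chi}.
  by move=> i j is_ js; apply: chi_inj; rewrite inE ?is_ ?js orbT.
have Us_y i : i \in s -> U (y i).
  move=> is_; have d0 : chi i - chi i0 != 0.
    rewrite subr_eq0; apply: contraNneq i0s => h.
    by rewrite -(chi_inj i i0) // inE ?is_ ?eqxx ?orbT.
  apply: (subspace_scaleP Us d0).
  apply: (IH (fun i => (chi i - chi i0) *: y i)) => // [j|].
    by rewrite (blinZ Dl) yE !scalerA mulrC.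
  have := subspaceB Us (UD _ Uy) (subspaceZ Us (chi i0) Uy).
  rewrite big_cons (blinD Dl) yE scalerDr opprD addrACA subrr add0r (blin_sum Dl) scaler_sumr -sumrB.
  by congr U; apply: eq_bigr => j _; rewrite yE scalerBl.
move=> i; rewrite inE => /predU1P[->|]; last exact: Us_y.
move: Uy; rewrite big_cons addrC; apply: subspace_addl => //.
by rewrite big_seq; apply: subspace_sum => // j; exact: Us_y.
Qed.

Section LaurentTheory.
Variables (C : fieldType) (U : lmodType C).
Local Notation T := (tensor2 U (laurent C)).

Lemma laurent_shift_linear n : linear (@laurent_shift C n).
Proof. by move=> a u v; rewrite /laurent_shift fgliftD fgliftZ. Qed.

Lemma laurent_diag_linear (w : int -> C) : linear (laurent_diag w).
Proof. by move=> a u v; rewrite /laurent_diag fgliftD fgliftZ. Qed.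

Lemma laurent_shiftE n l : laurent_shift n (lmonom C l) = lmonom C (l + n).
Proof. by rewrite /laurent_shift (liftU _ 1) scale1r. Qed.

Lemma laurent_diagE (w : int -> C) l : laurent_diag w (lmonom C l) = w l *: lmonom C l.
Proof. by rewrite /laurent_diag (liftU _ 1) scale1r. Qed.

Lemma coeff_linear l : linear (coeff l : laurent C -> C^o).
Proof. by move=> a p q; rewrite coeffD coeffZ. Qed.

Lemma lmonom_ind (S : laurent C -> Prop) : subspace S -> (forall l, S (lmonom C l)) -> forall p, S p.
Proof.
move=> hS hl p; rewrite -[p]freeg_sumE; apply: (subspace_sum hS) => z _.
have -> : << coeff z p *g z >> = coeff z p *: lmonom C z :> laurent C.
  by apply/eqP/freeg_eqP => w; rewrite coeffZ !coeffU mulrA mulr1.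
exact: (subspaceZ hS).
Qed.

Lemma tens2_monom_ind (S : T -> Prop) : subspace S ->
  (forall v l, S (tens2 v (lmonom C l))) -> forall x, S x.
Proof.
move=> hS hv; apply: (tens2_ind hS) => v.
exact: (lmonom_ind (subspace_preim (tens2_linearr v) hS)).
Qed.

Lemma tens2_monom_ext (W : lmodType C) (f h : T -> W) : linear f -> linear h ->
  (forall v l, f (tens2 v (lmonom C l)) = h (tens2 v (lmonom C l))) -> forall x, f x = h x.
Proof. by move=> fl hl; exact: (tens2_monom_ind (eq_subspace fl hl)). Qed.

Definition component (l : int) : T -> U := tensor2_lift (fun v p => coeff l p *: v).

Let comp_l l (p : laurent C) : linear (fun v : U => coeff l p *: v).
Proof. exact: blin_scale. Qed.
Let comp_r l (v : U) : linear (fun p : laurent C => coeff l p *: v).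
Proof. by move=> a p q; rewrite coeffD coeffZ scalerDl scalerA. Qed.

Lemma component_linear l : linear (component l).
Proof. exact: (tensor2_lift_linear (comp_l l) (comp_r l)). Qed.

Lemma componentE l v l' : component l (tens2 v (lmonom C l')) = if l == l' then v else 0.
Proof.
rewrite /component (tensor2_liftE (comp_l l) (comp_r l)) coeffU mul1r eq_sym.
by case: eqP => _; rewrite ?scale1r ?scale0r.
Qed.

Lemma component_sum x : exists2 s : seq int, uniq s &
  x = \sum_(l <- s) tens2 (component l x) (lmonom C l).
Proof.
(* Any larger list of degrees will do as well, which makes the property
   stable under addition. *)
pose S x := exists s0 : seq int, forall s, uniq s -> {subset s0 <= s} ->
  x = \sum_(l <- s) tens2 (component l x) (lmonom C l) :> T.
have tl l := tens2_linearl (U := U) (lmonom C l).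
have SS : subspace S.
  split=> [|a u v [s1 h1] [s2 h2]].
    by exists nil => s _ _; rewrite big1 // => l _; rewrite (blin0 (component_linear l)) (blin0 (tl l)).
  exists (s1 ++ s2) => s s_uniq hs.
  rewrite {1}(h1 s) // => [|l ls]; last by apply: hs; rewrite mem_cat ls.
  rewrite {1}(h2 s) // => [|l ls]; last by apply: hs; rewrite mem_cat ls orbT.
  rewrite scaler_sumr -big_split; apply: eq_bigr => l _ /=.
  by rewrite (component_linear l) (tl l).
have [s0 h] : S x.
  apply: (tens2_monom_ind SS) => v l; exists (l :: nil) => s s_uniq hs.
  rewrite (bigD1_seq l) //=; last by apply: hs; exact: mem_head.
  rewrite componentE eqxx big1 ?addr0 // => l' /negPf ll; rewrite componentE ll.
  exact: (blin0 (tl _)).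
exists (undup s0); first exact: undup_uniq.
by apply: h => [|l ls]; [exact: undup_uniq|rewrite mem_undup].
Qed.

End LaurentTheory.

Section SlotSum.
Variables (C : numFieldType) (g : lieAlgebra C) (H : {vspace g}) (form : g -> g -> C).
Variables (mu : C) (V : fweight H -> fmodule form) (k : nat) (lam : 'I_k -> weight H).
Local Notation Vf := (Vfactor mu V lam).
Local Notation T := (Vhat mu V lam).

Lemma slot_sumE (w : 'I_k -> C) (F : forall i, Vf i -> Vf i) (u : T) : (forall i, linear (F i)) ->
  slot_sum w F u = \sum_i w i *: slotop i (F i) u.
Proof.
move=> Fl; have ml : multilinear (V := fun i => Vf i) (fun v => \sum_i w i *: (tens (dfwith v (F i (v i))) : T)).
  move=> v j; apply: blin_bigsum => i; apply: blin_scale.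
  exact: (slot_multilinear (V := fun i => Vf i) (Fl i)).
apply: (tens_ext (V := fun i => Vf i) (f := slot_sum w F) (h := fun u => \sum_i w i *: slotop i (F i) u)) u => [||v].
- exact: (tensor_lift_linear ml).
- by apply: blin_bigsum => i; apply: blin_scale; exact: slotop_linear.
rewrite /slot_sum (tensor_lift_tens _ ml); apply: eq_bigr => i _.
by rewrite slotopE.
Qed.

End SlotSum.

(** * Irreducibility of the eigenspaces of a symmetry *)

Section Eigenspaces.
Variables (C : numFieldType) (g : lieAlgebra C) (H : {vspace g}).
Variables (pos : hdual H -> Prop) (form : g -> g -> C) (mu : C).
Hypothesis triangular : triangular_decomposable pos.
Hypothesis pos_sum : no_null_positive_sum pos.
Hypothesis form0r : forall x, form x 0 = 0.
Variable V : fweight H -> fmodule form.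
Hypothesis V_irr : forall eta, irreducible_highest_weight pos eta (V eta).
Variables (k : nat) (lam : 'I_k -> weight H) (a : 'I_k -> C).
Hypothesis (k_gt0 : (0 < k)%N).
Hypotheses (lam_k0 : forall i, wt_k0 (lam i) != 0).
Hypotheses (a_neq0 : forall i, a i != 0) (a_inj : injective a).
Local Notation Vf := (Vfactor mu V lam).
Local Notation T := (Vhat mu V lam).
Local Notation TT := (Vtilde mu V lam).
Local Notation c i := (wt_k0 (lam i)).
Local Notation M := (irmod mu V).
Local Notation ropf := (@ropf C g H form mu V k lam).
Local Notation tmon v l := (tens2 v (lmonom C l) : TT).
Let adm := factor_adm mu V_irr lam_k0.
Let ropl := ropf_linear (mu := mu) form0r V_irr lam_k0.
Let tl l := tens2_linearl (U := T) (lmonom C l).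

(** The common form of all generators, by an operator given uniformly on all
    factors; [d_0] is included with [n = 0]. *)
Lemma ghat_uniform (t : ghat_gen g) : exists F : forall l, M l -> M l,
  (forall i, linear (F (lam i) : Vf i -> Vf i)) /\
  forall u : T, ghat_act a t u = \sum_i a i ^ ghat_deg t *: slotop i (F (lam i) : Vf i -> Vf i) u.
Proof.
have rop_case j n : exists F : forall l, M l -> M l, (forall i, linear (F (lam i) : Vf i -> Vf i)) /\
    forall u : T, slot_sum (fun i => a i ^ n) (fun i => ropf j n (i := i)) u =
      \sum_i a i ^ n *: slotop i (F (lam i) : Vf i -> Vf i) u.
  exists (fun l => rop mu (wt_k0 l) j n); split=> [i|u]; first exact: (ropl j n (i := i)).
  by apply: slot_sumE => i; exact: (ropl j n (i := i)).
case: t => [m n x|m n|m n|m n|].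
- exact: (rop_case (RX m x) n).
- exact: (rop_case (RK0 g m) n).
- exact: (rop_case (RK1 g m) n).
- exact: (rop_case (RD g m) n).
exists (fun l v => - fmL 0 v).
have Ll i : linear (fun v : Vf i => - fmL 0 v).
  by move=> b x y; rewrite fmL_linear opprD scalerN.
split=> // u; rewrite /ghat_act (slot_sumE _ _ Ll).
by apply: eq_bigr => i _; rewrite expr0z.
Qed.

Lemma ghat_act_linear t : linear (ghat_act a t : T -> T).
Proof.
have [F [Fl FE]] := ghat_uniform t.
have L : linear (fun u : T => \sum_i a i ^ ghat_deg t *: slotop i (F (lam i) : Vf i -> Vf i) u).
  by apply: blin_bigsum => i; apply: blin_scale; exact: (slotop_linear (Fl i)).
by move=> b x y; rewrite !FE; exact: L.
Qed.

Definition raw_gen (j : rawsym g) (n : int) : ghat_gen g :=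
  match j with
  | RX m x => GX m n x | RK0 m => GK0 g m n | RK1 m => GK1 g m n | RD m => GDtilde g m n
  end.

Lemma raw_genE j n (u : T) :
  ghat_act a (raw_gen j n) u = \sum_i a i ^ n *: slotop i (ropf j n (i := i)) u.
Proof.
have h := slot_sumE (fun i => a i ^ n) u (fun i => ropl j n (i := i)).
by case: j h => [m x|m|m|m].
Qed.

Lemma raw_gen_deg j n : ghat_deg (raw_gen j n) = n.
Proof. by case: j. Qed.

Let act_r (t : ghat_gen g) (v : T) :
  linear (fun p : laurent C => tens2 (ghat_act a t v) (laurent_shift (ghat_deg t) p) : TT).
Proof. by move=> b p q; rewrite laurent_shift_linear tens2_linearr. Qed.
Let act_l (t : ghat_gen g) (p : laurent C) :
  linear (fun v : T => tens2 (ghat_act a t v) (laurent_shift (ghat_deg t) p) : TT).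
Proof. by move=> b v w; rewrite ghat_act_linear tens2_linearl. Qed.
Let diag_r (w : int -> C) (F : T -> T) (v : T) :
  linear (fun p : laurent C => tens2 (F v) (laurent_diag w p) : TT).
Proof. by move=> b p q; rewrite laurent_diag_linear tens2_linearr. Qed.
Let diag_l (w : int -> C) (F : T -> T) (p : laurent C) : linear F ->
  linear (fun v : T => tens2 (F v) (laurent_diag w p) : TT).
Proof. by move=> Fl b v u; rewrite Fl tens2_linearl. Qed.

Lemma gtilde_linear t : linear (gtilde_act mu V lam a t).
Proof.
case: t => [t|]; first exact: (tensor2_lift_linear (act_l t) (act_r t)).
apply: tensor2_lift_linear => [p|v]; last exact: (diag_r _ id).
exact: (@diag_l _ id).
Qed.

Lemma gtilde_hat t v l : gtilde_act mu V lam a (GHat t) (tmon v l) =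
  tmon (ghat_act a t v) (l + ghat_deg t).
Proof.
rewrite /gtilde_act (tensor2_liftE (act_l t) (act_r t)).
by rewrite laurent_shiftE.
Qed.

Lemma gtilde_d1 v l : gtilde_act mu V lam a (GD1 g) (tmon v l) = l%:~R *: tmon v l.
Proof.
rewrite /gtilde_act (tensor2_liftE (fun p => @diag_l (fun l => l%:~R) id p (fun _ _ _ => erefl))
  (diag_r (fun l => l%:~R) id)).
by rewrite laurent_diagE (blinZ (tens2_linearr v)).
Qed.

(** The components are eigenvectors of [d_1] for different eigenvalues. *)
Lemma graded_component (U : TT -> Prop) x l : submodule (gtilde_act mu V lam a) U ->
  U x -> U (tmon (component l x) l).
Proof.
move=> [Us U_st] Ux; have [s s_uniq xE] := component_sum x.
have Us_l l' : l' \in s -> U (tmon (component l' x) l').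
  move=> l's.
  apply: (@eigen_separation _ _ _ U _ (fun l => l%:~R) (fun l => tmon (component l x) l) s
    (gtilde_linear (GD1 g)) Us _ _ s_uniq) => // [v|i j _ _ /intr_inj //|i|].
  - exact: U_st.
  - exact: gtilde_d1.
  by rewrite -xE.
have [ls|ls] := boolP (l \in s); first exact: Us_l.
have -> : component l x = 0.
  rewrite xE (blin_sum (component_linear l)) big1_seq // => i /andP[_ is_].
  by rewrite componentE; case: eqP => // li; rewrite li is_ in ls.
by rewrite (blin0 (tl l)); exact: subspace0.
Qed.

Variables (s0 : 'I_k -> 'I_k) (lam_s0 : forall i, lam (s0 i) = lam i).
Variables (eps : C) (r : nat).
Hypothesis r_prim : r.-primitive_root eps.
Hypothesis a_s0 : forall i, a (s0 i) = eps * a i.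
Hypothesis sym_max : forall (s : 'I_k -> 'I_k) z, (forall i, a (s i) = z * a i) ->
  (forall i, lam (s i) = lam i) -> z ^+ r = 1.
Local Notation ph := (permute_hat (mu := mu) (V := V) lam_s0).
Let s_inj : injective s0 := s0_inj a_inj r_prim a_s0.
Let phl : linear ph := permute_hat_linear lam_s0 s_inj.
Let r_gt0 : (0 < r)%N := prim_order_gt0 r_prim.
Let e0 : eps != 0 := eps_neq0 r_prim.

(** For the ordering of the statement this is [sigma]. *)
Definition symmetry : TT -> TT :=
  tensor2_lift (fun (v : T) (p : laurent C) =>
    tens2 (ph v) (laurent_diag (fun l => eps ^ (- l)) p)).
Definition eigen (i : nat) (v : TT) : Prop := symmetry v = eps ^- i *: v.

Lemma symmetry_linear : linear symmetry.
Proof.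
apply: tensor2_lift_linear => [p|v]; last exact: (diag_r _ ph).
exact: (diag_l _ _ phl).
Qed.

Lemma symmetryE v l : symmetry (tmon v l) = eps ^ (- l) *: tmon (ph v) l.
Proof.
rewrite /symmetry (tensor2_liftE (fun p => diag_l _ p phl) (diag_r _ ph)).
by rewrite laurent_diagE (blinZ (tens2_linearr _)).
Qed.

Lemma ph_ghat t (u : T) : ph (ghat_act a t u) = eps ^ ghat_deg t *: ghat_act a t (ph u).
Proof.
have [F [Fl FE]] := ghat_uniform t; rewrite !FE (blin_sum phl).
rewrite (reindex_inj s_inj) scaler_sumr; apply: eq_bigr => i _ /=.
rewrite (blinZ phl) (permute_hat_slot lam_s0 s_inj (F := F) i u Fl).
by rewrite a_s0 expfzMl scalerA.
Qed.

Lemma symmetry_gtilde t x :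
  symmetry (gtilde_act mu V lam a t x) = gtilde_act mu V lam a t (symmetry x).
Proof.
have sl := symmetry_linear; have gl := gtilde_linear t.
apply: (tens2_monom_ext (f := symmetry \o gtilde_act mu V lam a t)
  (h := gtilde_act mu V lam a t \o symmetry)) x => [b x y|b x y|v l] /=.
- by rewrite gl sl.
- by rewrite sl gl.
rewrite symmetryE (blinZ gl); case: t {gl} => [t|]; last first.
  by rewrite !gtilde_d1 (blinZ sl) symmetryE !scalerA mulrC.
rewrite !gtilde_hat symmetryE ph_ghat (blinZ (tl _)) scalerA -expfzDr //.
by congr (eps ^ _ *: _); rewrite opprD subrK.
Qed.

Lemma eigen_submodule i : submodule (gtilde_act mu V lam a) (eigen i).
Proof.
split=> [|t v hv]; last by rewrite /eigen symmetry_gtilde hv (blinZ (gtilde_linear t)).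
by apply: (eq_subspace symmetry_linear); exact: blin_scale.
Qed.

Lemma iter_symmetry x : iter r symmetry x = x.
Proof.
have il j : linear (iter j symmetry).
  by elim: j => [//|j IH] b x' y /=; rewrite IH symmetry_linear.
apply: (tens2_monom_ext (il r) (h := id)) x => // v l.
have -> : iter r symmetry (tmon v l) = (eps ^ (- l)) ^+ r *: tmon (iter r ph v) l.
  elim: r => [|j IH]; first by rewrite scale1r.
  by rewrite !iterS IH (blinZ symmetry_linear) symmetryE scalerA exprSr.
rewrite (iter_ph_r a_inj lam_s0 r_prim a_s0).
by rewrite exprnP exprzAC -exprnP (prim_expr_order r_prim) exp1rz scale1r.
Qed.

(** Over the primitive [r]-th root of unity [eps], the automorphism of order
    [r] is diagonalized by its discrete Fourier transform. *)
Lemma eigen_direct_sum : direct_sum_of (fun i : 'I_r => eigen i).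
Proof.
have e_inj : injective (fun i : 'I_r => eps ^- i).
  move=> i j /invr_inj /eqP; rewrite (eq_prim_root_expr r_prim) => /eqP.
  by rewrite !modn_small // => /val_inj.
split=> [v|s f s_uniq hf f0]; last first.
  have s0' : subspace (fun v : TT => v = 0).
    by split=> // b u w -> ->; rewrite scaler0 addr0.
  apply: (@eigen_separation _ _ symmetry (fun v => v = 0) _ (fun i : 'I_r => eps ^- i)) => //.
  - exact: symmetry_linear.
  - by move=> w ->; exact: (blin0 symmetry_linear).
  by move=> i j _ _; exact: e_inj.
(* The summand for [i] is the average over [j] of the [q i j]. *)
pose q (i j : nat) := eps ^+ (i * j) *: iter j symmetry v.
exists (enum 'I_r), (fun i : 'I_r => r%:R^-1 *: \sum_(j < r) q i j); split=> [i|].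
  rewrite /eigen (blinZ symmetry_linear) scalerA mulrC -scalerA; congr (_ *: _).
  rewrite (blin_sum symmetry_linear); apply: (scalerI (expf_neq0 i e0)).
  rewrite scalerA mulfV ?expf_neq0 // scale1r.
  have -> : eps ^+ i *: \sum_(j < r) symmetry (q i j) = \sum_(j < r) q i j.+1.
    rewrite scaler_sumr; apply: eq_bigr => j _.
    by rewrite /q (blinZ symmetry_linear) scalerA -exprD mulnS iterS.
  have qr : q i r = q i 0%N.
    by rewrite /q iter_symmetry mulnC exprM (prim_expr_order r_prim) expr1n muln0.
  apply: (addrI (q i 0%N)); rewrite -(big_ord_recl r (fun j => q i j)) big_ord_recr /= qr.
  by rewrite addrC.
rewrite big_enum -scaler_sumr exchange_big /=.
rewrite (bigD1 (Ordinal r_gt0)) //= [X in _ + X]big1 => [|j j0].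
  rewrite addr0 (eq_bigr (fun=> v)) => [|i _]; last by rewrite /q muln0 scale1r.
  rewrite sumr_const card_ord -scaler_nat scalerA mulVf ?scale1r //.
  by rewrite pnatr_eq0 -lt0n.
rewrite /q -scaler_suml; have -> : \sum_(i < r) eps ^+ (i * j) = 0; last by rewrite scale0r.
have z1 : eps ^+ j != 1.
  apply: contra j0 => h; rewrite -(inj_eq val_inj) /=.
  by move: h; rewrite -(prim_order_dvd r_prim) /dvdn modn_small.
apply: (mulfI (x := eps ^+ j - 1)); first by rewrite subr_eq0.
rewrite mulr0; transitivity ((eps ^+ j) ^+ r - 1); last first.
  by rewrite -exprM mulnC exprM (prim_expr_order r_prim) expr1n subrr.
by rewrite [RHS]subrX1; congr (_ * _); apply: eq_bigr => i _; rewrite mulnC exprM.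
Qed.

(** The tensor of highest weight vectors, chosen uniformly in the weights, is
    fixed by the permutation; the product of the vacuum functionals shows that it
    is nonzero. *)
Lemma eigen_neq0 i : exists2 v, eigen i v & v != 0.
Proof.
have vac l : exists om : M l, exists2 phi : M l -> C^o, linear phi & phi om = 1.
  have [irr [om om_hw]] := V_irr (wt_bar mu l).
  have [phi [h1 h2 _ _]] := vacuum_functional triangular pos_sum irr om_hw.
  by exists om, phi.
pose om l := projT1 (cid (vac l)); pose phi l := s2val (cid2 (projT2 (cid (vac l)))).
have phil l : linear (phi l) := s2valP (cid2 (projT2 (cid (vac l)))).
have phi_om l : phi l (om l) = 1 := s2valP' (cid2 (projT2 (cid (vac l)))).
pose v : T := tens (fun i => om (lam i) : Vf i).
have transp_om l l' (e : l = l') : transp e (om l) = om l' by case: l' / e.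
have phv : ph v = v.
  rewrite /v (permute_hatE lam_s0 s_inj); congr tens.
  apply: functional_extensionality_dep => j; rewrite /permute.
  exact: transp_om.
exists (tmon v i); first by rewrite /eigen symmetryE phv -exprnN.
apply/eqP => v0.
have {}v0 : v = 0 by have := congr1 (component i) v0; rewrite componentE eqxx (blin0 (component_linear _)).
pose Phi (w : forall i, Vf i) : C^o := \prod_j phi (lam j) (w j).
have Phil : multilinear (V := fun i => Vf i) Phi.
  move=> w j b x y.
  have E z : Phi (dfwith w (i := j) z) = phi (lam j) z * \prod_(j' | j' != j) phi (lam j') (w j').
    rewrite /Phi (bigD1 j) //= dfwith_in; congr (_ * _).
    by apply: eq_bigr => j' jj'; rewrite dfwith_out // eq_sym.
  by rewrite !E phil mulrDl -scalerAl.
have := congr1 (tensor_lift Phi) v0; rewrite (tensor_lift_tens _ Phil) (blin0 (tensor_lift_linear Phil)).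
by rewrite /Phi big1 => [/eqP|j _]; [rewrite oner_eq0|exact: phi_om].
Qed.

(** A nonzero submodule has a nonzero component, to which [graded_full]
    applies. *)
Lemma eigen_irreducible i : irreducible_submodule (gtilde_act mu V lam a) (eigen i).
Proof.
split; [exact: eigen_submodule|exact: eigen_neq0|].
move=> U U_sm UW; have [Us U_st] := U_sm.
have [h|/existsNP[x /not_implyP[Ux x0]]] := pselect (forall v, U v -> v = 0); first by left.
right=> y Wy.
have [l ul] : exists l, component l x <> 0.
  apply: contrapT => /forallNP h; apply: x0; have [s _ ->] := component_sum x.
  rewrite big1 // => l _; have /contrapT -> := h l; exact: (blin0 (tl l)).
have eig l' z : eigen i (tmon z l') -> ph z = (eps ^ l' * eps ^- i) *: z.
  rewrite /eigen symmetryE => /(congr1 (component l')).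
  rewrite !(blinZ (component_linear _)) !componentE eqxx => h.
  by rewrite -scalerA -h scalerA -expfzDr // subrr expr0z scale1r.
have Uu : U (tmon (component l x) l) by exact: graded_component.
have pu := eig _ _ (UW _ Uu).
have [s _ ->] := component_sum y; apply: (subspace_sum Us) => l' _.
have Wl' : eigen i (tmon (component l' y) l') by exact: (graded_component _ (eigen_submodule i)).
have py := eig _ _ Wl'.
have := @graded_full _ _ _ _ _ mu triangular pos_sum form0r V V_irr k lam a lam_k0 a_neq0 a_inj
  s0 lam_s0 eps r r_prim a_s0 sym_max (fun l v => U (tmon v l)) _ _ (Ordinal k_gt0)
  l (l' - l) (component l x) (component l' y) _ Uu ul pu.
have lE : l + (l' - l) = l' by rewrite addrC subrK.
rewrite /= lE; apply=> [n|n u j m Uu'|].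
- exact: (subspace_preim (tl n) Us).
- have := U_st (GHat (raw_gen j m)) _ Uu'.
  by rewrite gtilde_hat raw_gen_deg raw_genE.
by rewrite mulrA -expfzDr // subrK.
Qed.

End Eigenspaces.

(** * Symmetries of the parameters, and the theorem *)

Section Symmetries.
Variables (C : numFieldType) (g : lieAlgebra C) (H : {vspace g}) (mu : C).
Variables (k : nat) (lam : 'I_k -> weight H) (a : 'I_k -> C).
Hypotheses (k_gt0 : (0 < k)%N) (a_neq0 : forall i, a i != 0) (a_inj : injective a).

Definition symmetric_by (s : 'I_k -> 'I_k) (z : C) :=
  (forall i, a (s i) = z * a i) /\ (forall i, lam (s i) = lam i).

(** The ratios of the symmetries form a finite subgroup of the units, which is
    cyclic. *)
Lemma maximal_symmetry : exists r eps s0, [/\ r.-primitive_root eps, symmetric_by s0 eps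
  & forall s z, symmetric_by s z -> z ^+ r = 1].
Proof.
pose i1 := Ordinal k_gt0.
pose P z := exists s, symmetric_by s z.
pose rs := undup [seq z <- [seq a i / a i1 | i <- enum 'I_k] | `[< P z >]].
have rsP z : (z \in rs) = `[< P z >].
  rewrite mem_undup mem_filter andb_idr // => /asboolP[s [h _]].
  by apply/mapP; exists (s i1); rewrite ?mem_enum // h mulfK.
have P_neq0 z : P z -> z != 0.
  by case=> s [h _]; apply: contraNneq (a_neq0 (s i1)) => z0; rewrite h z0 mul0r.
have PM z w : P z -> P w -> P (z * w).
  move=> [s [h1 h2]] [t [h3 h4]]; exists (s \o t); split=> i /=.
    by rewrite h1 h3 mulrA.
  by rewrite h2 h4.
have rs1 : 1 \in rs.
  by rewrite rsP; apply/asboolP; exists id; split=> i //; rewrite mul1r.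
have rs_gt0 : (0 < size rs)%N by rewrite lt0n size_eq0; apply: contraTneq rs1 => ->.
(* Multiplication by an element permutes the finite set of ratios, whose
   product is therefore multiplied by 1. *)
have root z : P z -> z ^+ size rs = 1.
  move=> Pz; have z0 := P_neq0 z Pz.
  have sub : {subset [seq z * w | w <- rs] <= rs}.
    move=> _ /mapP[w wrs ->]; rewrite rsP; apply/asboolP; apply: PM => //.
    by apply/asboolP; rewrite -rsP.
  have un : uniq [seq z * w | w <- rs] by rewrite map_inj_uniq ?undup_uniq //; exact: mulfI.
  have pe : perm_eq [seq z * w | w <- rs] rs.
    apply: (uniq_perm un (undup_uniq _)).
    have [|_ h] := uniq_min_size un sub; first by rewrite size_map.
    exact: h.
  have : \prod_(w <- rs) (z * w) = \prod_(w <- rs) w by rewrite -[RHS](perm_big _ pe) big_map.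
  rewrite big_split big_const_seq count_predT iter_mulr_1 => /eqP.
  rewrite -subr_eq0 -{2}[\prod_(w <- rs) w]mul1r -mulrBl mulf_eq0 subr_eq0.
  case/orP => /eqP // /eqP; rewrite prodf_seq_eq0 => /hasP[w /=].
  by rewrite rsP => /asboolP /P_neq0 /negPf ->.
have /hasP[eps] : has (size rs).-primitive_root rs.
  apply: has_prim_root => //; last exact: undup_uniq.
  by apply/allP => z; rewrite rsP => /asboolP/root/unity_rootP.
rewrite rsP => /asboolP[s0 hs0] pr.
by exists (size rs), eps, s0; split=> // s z hs; apply: root; exists s.
Qed.

(** Reindexing the sums that define [psi] by a symmetry of ratio [z] shows that
    a product of degree [n] has value 0 unless [z ^ n = 1]; if [t_1 ^ r] is in
    the image, some product of degree [r] has a nonzero value. *)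
Lemma image_symmetry r s z : psi_image_is mu lam a r -> symmetric_by s z -> z ^+ r = 1.
Proof.
move=> im [sa sl].
have z0 : z != 0.
  by apply: contraNneq (a_neq0 (s (Ordinal k_gt0))) => z0; rewrite sa z0 mul0r.
have s_inj : injective s.
  by move=> i j e; apply: a_inj; apply: (mulfI z0); rewrite -!sa e.
have psi_s (n : int) (f : weight H -> C) : \sum_i a i ^ n * f (lam i) != 0 -> z ^ n = 1.
  have E : \sum_i a i ^ n * f (lam i) = z ^ n * \sum_i a i ^ n * f (lam i).
    rewrite {1}(reindex_inj s_inj) mulr_sumr; apply: eq_bigr => i _ /=.
    by rewrite sa sl expfzMl mulrA.
  move=> h; apply: (mulIf h); by rewrite mul1r -E.
have psi_gen t : psi_hat mu lam a t != 0 -> z ^ (heis_deg t) = 1.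
  case: t => [n h|n|n|] /=; last by rewrite eqxx.
  - exact: (psi_s n (fun l => wt_h l h)).
  - exact: (psi_s n (fun l => wt_k0 l)).
  case: ifP => [/eqP -> _|_]; first by rewrite expr0z.
  exact: (psi_s n (fun l => wt_d0 l + mu * wt_k0 l)).
have psi_word (w : seq (heis_gen H)) : \prod_(t <- w) psi_hat mu lam a t != 0 ->
    z ^ (\sum_(t <- w) heis_deg t) = 1.
  elim: w => [|t w IH]; first by rewrite !big_nil expr0z.
  rewrite !big_cons mulf_eq0 negb_or => /andP[/psi_gen ht /IH hw].
  by rewrite expfzDr // ht hw mulr1.
have [u uE] : exists u, psi_tilde mu lam a u = lmonom C r%:Z.
  apply/im => l; rewrite coeffU mul1r; have [<- _|_] := eqVneq r%:Z l; first exact: dvdzz.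
  by rewrite eqxx.
have : coeff r%:Z (psi_tilde mu lam a u) != 0 by rewrite uE coeffU mul1r eqxx oner_eq0.
rewrite /psi_tilde (blin_sum (coeff_linear r%:Z)) => h.
have [w hw] : exists w : C * seq (heis_gen H), coeff r%:Z ((w.1 * \prod_(t <- w.2) psi_hat mu lam a t)
   *: lmonom C (\sum_(t <- w.2) heis_deg t)) != 0.
  apply: contrapT => hN; move/eqP: h; apply; rewrite big1 // => w _.
  by apply/eqP; apply: contrapT => /negP hw; apply: hN; exists w.
move: hw; rewrite coeffZ coeffU mul1r mulf_eq0 negb_or => /andP[].
rewrite mulf_eq0 negb_or => /andP[_ /psi_word].
by have [-> //|_ _] := eqVneq (\sum_(t <- w.2) heis_deg t) r%:Z; rewrite eqxx.
Qed.

(** The exponent [(i %% r).+1] of [eps] is increased by one modulo [r]. *)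
Lemma well_ordered_ratio r eps a0 : well_ordered lam a r eps a0 ->
  forall i, a (sig r i) = eps * a i.
Proof.
case=> rk pr hl ha i; have r0 := prim_order_gt0 pr.
rewrite !ha val_insubd sig_nat_lt // sig_nat_div // mulrA; congr (_ * _).
rewrite /sig_nat modnMDl modn_mod -exprS; apply/eqP; rewrite (eq_prim_root_expr pr).
by have := modnDml (i %% r).+1 1 r; rewrite !addn1 => ->.
Qed.

End Symmetries.

Theorem theorem4p5 (R : realType) (g : lieAlgebra R[i])
  (g_simple : simple_lie g)
  (H : {vspace g}) (H_cartan : cartan_subalgebra H)
  (pos : hdual H -> Prop) (pos_system : positive_system pos)
  (form : g -> g -> R[i]) (form_normalized : normalized_form H form)
  (mu : R[i])
  (V : fweight H -> fmodule form)
  (V_irr : forall eta, irreducible_highest_weight pos eta (V eta))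
  (k : nat) (k_gt0 : (0 < k)%N)
  (lam : 'I_k -> weight H) (a : 'I_k -> R[i])
  (lam_k0 : forall i, wt_k0 (lam i) != 0)
  (a_neq0 : forall i, a i != 0) (a_inj : injective a) :
  completely_reducible (gtilde_act mu V lam a) /\
  (forall (r : nat) (r_gt0 : (0 < r)%N) (r_image : psi_image_is mu lam a r)
     (eps : R[i]) (a0 : nat -> R[i]) (ord : well_ordered lam a r eps a0),
     let W (i : 'I_r) :=
       Vtilde_eigen mu V eps (well_ordered_sig ord) i in
     direct_sum_of W /\
     (forall i : 'I_r, irreducible_submodule (gtilde_act mu V lam a) (W i))).
Proof.
have [triangular pos_sum] :=
  simple_lie_triangular g_simple H_cartan pos_system form_normalized.
have form0r x : form x 0 = 0.
  by case: form_normalized => fl fs _ _; rewrite fs; exact: (blin0 (fl x)).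
split=> [|r r_gt0 r_image eps a0 ord W].
  have [r [eps [s0 [pr [sa sl] smax]]]] := maximal_symmetry lam k_gt0 a_neq0.
  exists 'I_r, (fun i : 'I_r => eigen (mu := mu) (V := V) sl eps i); split=> [i|].
    exact: (eigen_irreducible mu triangular pos_sum form0r V_irr k_gt0 lam_k0 a_neq0 a_inj sl pr sa
      (fun s z h1 h2 => smax s z (conj h1 h2)) i).
  exact: (eigen_direct_sum mu V a_inj sl pr sa).
have [_ pr _ _] := ord; have sa := well_ordered_ratio ord.
have smax (s : 'I_k -> 'I_k) (z : R[i]) : (forall i, a (s i) = z * a i) ->
    (forall i, lam (s i) = lam i) -> z ^+ r = 1.
  by move=> h1 h2; exact: (image_symmetry k_gt0 a_neq0 a_inj r_image (conj h1 h2)).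
split; first exact: (eigen_direct_sum mu V a_inj (well_ordered_sig ord) pr sa).
move=> i.
exact: (eigen_irreducible mu triangular pos_sum form0r V_irr k_gt0 lam_k0 a_neq0 a_inj
  (well_ordered_sig ord) pr sa smax i).
Qed.
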